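(* Let $k\in\mathbb{N}$ and suppose that the sequence $(\ell_{n,k})_{n\in\mathbb{N}_0}$ is square-summable. Then for every $t\in\mathbb{R}$, $$\zeta^k\!\left(\tfrac12+it\right)=\sum_{n\ge -k}\ell_{n,k}\left(\frac{\frac12-it}{\frac12+it}\right)^n,$$ the series converging (as the limit of its partial sums over $-k\le n\le N$, $N\to\infty$). In particular, if the Lindelöf Hypothesis is true, this expansion holds for every $k\in\mathbb{N}$ and every $t\in\mathbb{R}$.
   Context: $\zeta$ denotes the Riemann zeta function. For $k\in\mathbb{N}$, $\lambda_{j,k}$ ($j\in\mathbb{N}_0$) are defined by $(s-1)^k\zeta^k(s)=\sum_{j\ge0}\frac{\lambda_{j,k}}{j!}(s-1)^j$ for $|s-1|\le1$, and $\ell_{n,k}=(-1)^n\sum_{j=1}^n\binom{n-1}{j-1}\frac{\lambda_{j+k,k}}{(j+k)!}$ for $n\ge1$, $\ell_{n,k}=(-1)^k\sum_{j=0}^{k+n}\binom{k-j}{-n}(-1)^j\frac{\lambda_{j,k}}{j!}$ for $-k\le n\le 0$. The Lindelöf Hypothesis is the statement $\zeta(\frac12+it)=O(|t|^\varepsilon)$ for every $\varepsilon>0$. *)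

(* Defs.v *)
From Stdlib Require Import Reals ZArith ClassicalEpsilon.
From Coquelicot Require Import Coquelicot.
Open Scope R_scope.

Definition cpow_pos (x : R) (s : C) : C :=
  (exp (Re s * ln x) * cos (Im s * ln x), exp (Re s * ln x) * sin (Im s * ln x)).

Definition eta_term (s : C) (n : nat) : C :=
  Cmult (RtoC ((-1) ^ n)) (cpow_pos (INR (S n)) (Copp s)).

(* eta(s): the sum of the (conditionally) convergent alternating series,
   computed componentwise; it converges for Re s > 0. *)
Definition eta (s : C) : C :=
  (Series (fun n => Re (eta_term s n)), Series (fun n => Im (eta_term s n))).

(* Riemann zeta via  zeta(s) = eta(s) / (1 - 2^(1-s)),  valid for Re s > 0
   away from the zeros of 1 - 2^(1-s) (which for Re s > 0 are
   s = 1 + 2 pi i m / ln 2; the only one with |s-1| < 1 is s = 1). *)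
Definition zeta (s : C) : C :=
  Cdiv (eta s) (Cminus (RtoC 1) (cpow_pos 2 (Cminus (RtoC 1) s))).

Definition Gk (k : nat) (s : C) : C :=
  Cpow (Cmult (Cminus s (RtoC 1)) (zeta s)) k.

(* The Taylor coefficients lambda_{j,k}/j! of (s-1)^k zeta^k(s) at s = 1:
   the (unique) sequence c with  sum_j c_j (s-1)^j = (s-1)^k zeta^k(s)
   on the punctured disk 0 < |s-1| < 1. *)
Definition is_taylor_coef (k : nat) (c : nat -> C) : Prop :=
  forall s : C, 0 < Cmod (Cminus s (RtoC 1)) < 1 ->
    is_series (V := C_NormedModule)
      (fun j => Cmult (c j) (Cpow (Cminus s (RtoC 1)) j)) (Gk k s).

Definition lam_over_fact (k : nat) : nat -> C :=
  epsilon (inhabits (fun _ => RtoC 0)) (is_taylor_coef k).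

Definition lam (j k : nat) : C := Cmult (RtoC (INR (fact j))) (lam_over_fact k j).

(* ell_{n,k}, n : Z (taken to be 0 for n < -k, where it is not used). *)
Definition ell (n : Z) (k : nat) : C :=
  if (0 <? n)%Z then
    let m := Z.to_nat n in
    Cmult (RtoC ((-1) ^ m))
      (sum_n (fun i => (* j = i+1, j from 1 to m *)
         Cmult (RtoC (Binomial.C (m - 1) i))
               (Cdiv (lam (S i + k) k) (RtoC (INR (fact (S i + k))))))
         (m - 1))
  else if (- Z.of_nat k <=? n)%Z then
    let p := Z.to_nat (- n) in
    Cmult (RtoC ((-1) ^ k))
      (sum_n (fun j =>
         Cmult (RtoC (Binomial.C (k - j) p))
           (Cmult (RtoC ((-1) ^ j)) (Cdiv (lam j k) (RtoC (INR (fact j))))))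
         (k - p))
  else RtoC 0.

Definition CpowZ (w : C) (n : Z) : C :=
  if (0 <=? n)%Z then Cpow w (Z.to_nat n) else Cinv (Cpow w (Z.to_nat (- n))).

Definition Lindelof : Prop :=
  forall eps : R, 0 < eps -> exists M T : R, 0 < T /\
    forall t : R, T <= Rabs t ->
      Cmod (zeta (1/2, t)) <= M * Rpower (Rabs t) eps.

(* The expansion:  zeta^k(1/2+it) = sum_{n >= -k} ell_{n,k} w^n,
   w = (1/2 - it)/(1/2 + it), as the limit of partial sums over
   -k <= n <= N, N -> oo  (reindexed by m = n + k >= 0). *)
Definition expansion_holds (k : nat) (t : R) : Prop :=
  let w := Cdiv (1/2, - t) (1/2, t) in
  is_series (V := C_NormedModule)
    (fun m : nat => Cmult (ell (Z.of_nat m - Z.of_nat k)%Z k)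
                          (CpowZ w (Z.of_nat m - Z.of_nat k)%Z))
    (Cpow (zeta (1/2, t)) k).

(* Main.v *)
Require Import Defs.
From Stdlib Require Import Reals ZArith Lra Lia ClassicalEpsilon.
From Coquelicot Require Import Coquelicot.

(* Put s = 1/(1+w), which maps the unit disc onto Re s > 1/2, and
   F(w) = w^k zeta(s)^k, a function holomorphic for Re w > -1 whose Taylor
   coefficients at 0 are a_m = ell_(m-k),k.  The expansion is the convergence of
   the Taylor series of F at a boundary point w0 <> -1 of the unit disc, which by
   the Fatou-Riesz theorem holds as soon as a_m -> 0.  Square-summability gives
   this at once.  Under the Lindelof Hypothesis |F(w)|^2 = O(|1+w|^(-1/2)) on the
   unit circle; after multiplication by ((1+w)/(1+w+e))^(k+1) the function F is
   continuous on the closed disc, and Parseval's identity with e -> 0 bounds the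
   sum of the |a_m|^2.

   Holomorphy is used only in the form "uniform limit of polynomials": the Cauchy
   estimates, the mean value property and Parseval's identity for polynomials are
   finite sums over roots of unity. *)

Local Open Scope C_scope.

(** Three obstacles shape the proof. At s = 1, the point matching w = 0, [zeta] has only a default
    value; so everything is done with [zreg], the limit of Euler-Maclaurin sums for (s - 1) zeta(s),
    and F becomes (-(1 + w) zreg(1/(1 + w)))^k because s - 1 = -w s. The numbers lambda are given
    only through a series about s = 1, which would have to be rearranged after the substitution s -
    1 = -w/(1 + w); instead that series is truncated, and expansions in w are compared up to O(w^N)
    near 0 for each N. Finally, |1 + w|^(-1/2) must be averaged over roots of unity although it is
    unbounded near -1: it is dominated by positive kernels Re 1/(1 + w + 4^(-i)) with weights
    2^(-i), whose averages are finite geometric sums, and the arc below the smallest scale is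
    controlled by the damping factor. The exponent 1/2 stems from the choice epsilon = 1/(4k) in the
    Lindelof Hypothesis. *)

Lemma Cmod_minus_sym (x y : C) : Cmod (x - y) = Cmod (y - x).
Proof. rewrite <- (Cmod_opp (x - y)). f_equal. ring. Qed.

Lemma Cmod_minus_triangle (x y z : C) :
  (Cmod (x - z) <= Cmod (x - y) + Cmod (y - z))%R.
Proof. replace (x - z) with ((x - y) + (y - z)) by ring. apply Cmod_triangle. Qed.

Lemma Cmod_le_minus (x y : C) : (Cmod x <= Cmod y + Cmod (x - y))%R.
Proof. replace x with (y + (x - y)) at 1 by ring. apply Cmod_triangle. Qed.

Lemma im_le_Cmod (z : C) : (Rabs (Im z) <= Cmod z)%R.
Proof.
  eapply Rle_trans; [| apply Rmax_Cmod]. apply Rmax_r.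
Qed.

Lemma Cmod_le_re_im (z : C) : (Cmod z <= Rabs (Re z) + Rabs (Im z))%R.
Proof.
  apply Rsqr_incr_0_var; [| pose proof (Rabs_pos (Re z)); pose proof (Rabs_pos (Im z)); lra].
  rewrite !Rsqr_pow2, Cmod2_alt, <- (pow2_abs (Re z)), <- (pow2_abs (Im z)).
  pose proof (Rabs_pos (Re z)); pose proof (Rabs_pos (Im z)); nra.
Qed.

Lemma Cmod_RtoC_pos (x : R) : (0 <= x)%R -> Cmod (RtoC x) = x.
Proof. intros. rewrite Cmod_R. now apply Rabs_pos_eq. Qed.

(** * Finite sums of complex and real numbers *)

Fixpoint csum (f : nat -> C) (n : nat) : C :=
  match n with O => RtoC 0 | S m => csum f m + f m end.

Lemma csum_ext (f g : nat -> C) (n : nat) :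
  (forall i, (i < n)%nat -> f i = g i) -> csum f n = csum g n.
Proof.
  induction n as [|n IH]; intros H; simpl; [easy|].
  rewrite IH, (H n); auto.
Qed.

Lemma csum_plus (f g : nat -> C) (n : nat) :
  csum (fun i => f i + g i) n = csum f n + csum g n.
Proof. induction n as [|n IH]; simpl; [ring | rewrite IH; ring]. Qed.

Lemma csum_minus (f g : nat -> C) (n : nat) :
  csum (fun i => f i - g i) n = csum f n - csum g n.
Proof. induction n as [|n IH]; simpl; [ring | rewrite IH; ring]. Qed.

Lemma csum_mult_l (a : C) (f : nat -> C) (n : nat) :
  csum (fun i => a * f i) n = a * csum f n.
Proof. induction n as [|n IH]; simpl; [ring | rewrite IH; ring]. Qed.

Lemma csum_zero (f : nat -> C) (n : nat) :
  (forall i, (i < n)%nat -> f i = 0) -> csum f n = 0.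
Proof.
  induction n as [|n IH]; intros H; simpl; [easy|].
  rewrite IH, (H n) by auto. ring.
Qed.

Lemma csum_single (f : nat -> C) (n k : nat) :
  (k < n)%nat -> (forall i, (i < n)%nat -> i <> k -> f i = 0) -> csum f n = f k.
Proof.
  induction n as [|n IH]; intros Hk H; [lia|]; simpl.
  destruct (Nat.eq_dec k n) as [->|Hn].
  - rewrite csum_zero by (intros; apply H; lia). ring.
  - rewrite IH, (H n) by (intros; try apply H; lia). ring.
Qed.

Lemma csum_swap (f : nat -> nat -> C) (n m : nat) :
  csum (fun i => csum (f i) m) n = csum (fun j => csum (fun i => f i j) n) m.
Proof.
  induction n as [|n IH]; simpl.
  - rewrite csum_zero; auto.
  - rewrite IH, <- csum_plus. now apply csum_ext.
Qed.

Lemma csum_app (f : nat -> C) (n m : nat) :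
  csum f (n + m) = csum f n + csum (fun i => f (n + i)%nat) m.
Proof.
  induction m as [|m IH]; simpl; [rewrite Nat.add_0_r; ring|].
  rewrite Nat.add_succ_r; simpl. rewrite IH. ring.
Qed.

Lemma csum_const (a : C) (n : nat) : csum (fun _ => a) n = RtoC (INR n) * a.
Proof.
  induction n as [|n IH]; simpl csum; [simpl; ring|].
  rewrite IH, S_INR, RtoC_plus. ring.
Qed.

Lemma csum_extend (f : nat -> C) (n m : nat) :
  (n <= m)%nat -> (forall i, (n <= i)%nat -> f i = 0) -> csum f m = csum f n.
Proof.
  intros Hm H. replace m with (n + (m - n))%nat by lia.
  rewrite csum_app, (csum_zero (fun i => f (n + i)%nat)); [ring|]. intros; apply H; lia.
Qed.

Lemma sum_n_csum (f : nat -> C) (n : nat) :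
  sum_n (G := C_AbelianMonoid) f n = csum f (S n).
Proof.
  induction n as [|n IH].
  - rewrite sum_O. simpl. now rewrite Cplus_0_l.
  - rewrite sum_Sn, IH. reflexivity.
Qed.

Lemma csum_geom (x : C) (n : nat) : (1 - x) * csum (fun i => x ^ i) n = 1 - x ^ n.
Proof.
  induction n as [|n IH]; [cbn [csum]; ring|].
  simpl csum. rewrite Cmult_plus_distr_l, IH, Cpow_S. ring.
Qed.

Fixpoint rsum (f : nat -> R) (n : nat) : R :=
  match n with O => 0%R | S m => (rsum f m + f m)%R end.

Lemma rsum_le (f g : nat -> R) (n : nat) :
  (forall i, (i < n)%nat -> (f i <= g i)%R) -> (rsum f n <= rsum g n)%R.
Proof.
  induction n as [|n IH]; intros H; simpl; [lra|].
  apply Rplus_le_compat; auto.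
Qed.

Lemma rsum_ext (f g : nat -> R) (n : nat) :
  (forall i, (i < n)%nat -> f i = g i) -> rsum f n = rsum g n.
Proof.
  induction n as [|n IH]; intros H; simpl; [easy|].
  rewrite IH, (H n); auto.
Qed.

Lemma rsum_plus (f g : nat -> R) (n : nat) :
  rsum (fun i => f i + g i)%R n = (rsum f n + rsum g n)%R.
Proof. induction n as [|n IH]; simpl; [ring | rewrite IH; ring]. Qed.

Lemma rsum_mult_l (a : R) (f : nat -> R) (n : nat) :
  rsum (fun i => a * f i)%R n = (a * rsum f n)%R.
Proof. induction n as [|n IH]; simpl; [ring | rewrite IH; ring]. Qed.

Lemma rsum_const (a : R) (n : nat) : rsum (fun _ => a) n = (INR n * a)%R.
Proof.
  induction n as [|n IH]; simpl rsum; [simpl; ring|].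
  rewrite IH, S_INR. ring.
Qed.

Lemma rsum_nonneg (f : nat -> R) (n : nat) :
  (forall i, (0 <= f i)%R) -> (0 <= rsum f n)%R.
Proof. intros H; induction n as [|n IH]; simpl; [lra | specialize (H n); lra]. Qed.

Lemma rsum_mono (f : nat -> R) (n m : nat) :
  (forall i, (0 <= f i)%R) -> (n <= m)%nat -> (rsum f n <= rsum f m)%R.
Proof. intros H; induction 1 as [|m Hm IH]; simpl; [lra | specialize (H m); lra]. Qed.

Lemma rsum_swap (f : nat -> nat -> R) (n m : nat) :
  rsum (fun i => rsum (f i) m) n = rsum (fun j => rsum (fun i => f i j) n) m.
Proof.
  induction n as [|n IH]; simpl.
  - induction m as [|m IHm]; simpl; [easy | rewrite <- IHm; ring].
  - rewrite IH, <- rsum_plus. now apply rsum_ext.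
Qed.

Lemma rsum_geom (x : R) (n : nat) : ((1 - x) * rsum (fun i => x ^ i) n = 1 - x ^ n)%R.
Proof.
  induction n as [|n IH]; [simpl; ring|].
  simpl rsum. rewrite Rmult_plus_distr_l, IH. simpl. ring.
Qed.

Lemma rsum_geom_le (x : R) (n : nat) :
  (0 <= x < 1)%R -> (rsum (fun i => x ^ i) n <= / (1 - x))%R.
Proof.
  intros Hx. apply Rmult_le_reg_l with (1 - x)%R; [lra|].
  rewrite rsum_geom, Rinv_r by lra. pose proof (pow_le x n (proj1 Hx)). lra.
Qed.

Lemma rsum_geom_le_gt1 (x : R) (n : nat) :
  (1 < x)%R -> (rsum (fun i => x ^ i) n <= x ^ n / (x - 1))%R.
Proof.
  intros Hx. apply Rmult_le_reg_l with (x - 1)%R; [lra|].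
  replace ((x - 1) * (x ^ n / (x - 1)))%R with (x ^ n)%R by (field; lra).
  pose proof (rsum_geom x n). lra.
Qed.

Lemma Cmod_csum_le (f : nat -> C) (g : nat -> R) (n : nat) :
  (forall i, (i < n)%nat -> (Cmod (f i) <= g i)%R) -> (Cmod (csum f n) <= rsum g n)%R.
Proof.
  induction n as [|n IH]; intros H; simpl; [rewrite Cmod_0; lra|].
  eapply Rle_trans; [apply Cmod_triangle|]. apply Rplus_le_compat; auto.
Qed.

(** * Limits of complex sequences, measured by [Cmod] *)

Definition Clim (u : nat -> C) (l : C) : Prop :=
  forall eps : R, (0 < eps)%R ->
    exists N, forall n, (N <= n)%nat -> (Cmod (u n - l) <= eps)%R.

Lemma is_series_Clim (a : nat -> C) (l : C) :
  is_series (V := C_NormedModule) a l <-> Clim (csum a) l.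
Proof.
  split.
  - intros H eps Heps.
    (* The balls of [C_UniformSpace] are squares in the two components, so a ball of radius r bounds
       the modulus only by [sqrt 2 * r]. *)
    assert (Hs : (0 < eps / sqrt 2)%R).
    { apply Rdiv_lt_0_compat; [lra|]. apply sqrt_lt_R0. lra. }
    destruct (proj1 (filterlim_locally (F := eventually) (U := C_UniformSpace) _ l) H (mkposreal _ Hs)) as [N HN].
    exists (S N). intros n Hn. destruct n as [|n]; [lia|].
    specialize (HN n ltac:(lia)).
    apply (C_NormedModule_mixin_compat2 l (sum_n (G := C_AbelianMonoid) a n) (mkposreal _ Hs)) in HN.
    rewrite sum_n_csum in HN. simpl pos in HN.
    replace (sqrt 2 * (eps / sqrt 2))%R with eps in HN.
    + apply Rlt_le. exact HN.
    + field. apply Rgt_not_eq, sqrt_lt_R0. lra.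
  - intros H.
    apply (proj2 (filterlim_locally (F := eventually) (U := C_UniformSpace) _ l)).
    intros eps. destruct (H (pos eps / 2)%R) as [N HN]; [destruct eps; simpl; lra|].
    exists N. intros n Hn.
    apply (C_NormedModule_mixin_compat1 l (sum_n (G := C_AbelianMonoid) a n) eps).
    rewrite sum_n_csum. specialize (HN (S n) ltac:(lia)).
    eapply Rle_lt_trans; [exact HN|]. destruct eps; simpl; lra.
Qed.

Lemma Cmod_le_all_eps (x : C) :
  (forall eps : R, (0 < eps)%R -> (Cmod x <= eps)%R) -> x = 0.
Proof.
  intros H. apply Cmod_eq_0. apply Rle_antisym; [|apply Cmod_ge_0].
  apply Rnot_lt_le. intros Hx. specialize (H (Cmod x / 2)%R ltac:(lra)). lra.
Qed.

Lemma Clim_mult_l (u : nat -> C) (a l : C) : Clim u l -> Clim (fun n => a * u n) (a * l).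
Proof.
  intros H eps He. pose proof (Cmod_ge_0 a) as Ha.
  destruct (H (eps / (Cmod a + 1))%R) as [N HN]; [apply Rdiv_lt_0_compat; lra|].
  exists N. intros n Hn. specialize (HN n Hn).
  replace (a * u n - a * l) with (a * (u n - l)) by ring. rewrite Cmod_mult.
  eapply Rle_trans; [apply Rmult_le_compat_l; [lra | exact HN]|].
  apply Rle_trans with ((Cmod a + 1) * (eps / (Cmod a + 1)))%R.
  - apply Rmult_le_compat_r; [|lra]. apply Rlt_le, Rdiv_lt_0_compat; lra.
  - apply Req_le. field. lra.
Qed.

Lemma Clim_re_im (u : nat -> C) (l : C) :
  Clim u l -> is_lim_seq (fun n => Re (u n)) (Re l) /\ is_lim_seq (fun n => Im (u n)) (Im l).
Proof.
  intros H. split; apply is_lim_seq_spec; intros eps;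
    (destruct (H (pos eps / 2)%R) as [N HN]; [destruct eps; simpl; lra|]);
    exists N; intros n Hn; specialize (HN n Hn).
  - change (Re (u n) - Re l)%R with (Re (u n - l)).
    pose proof (re_le_Cmod (u n - l)). destruct eps; simpl in *; lra.
  - change (Im (u n) - Im l)%R with (Im (u n - l)).
    pose proof (im_le_Cmod (u n - l)). destruct eps; simpl in *; lra.
Qed.

Lemma Clim_of_re_im (u : nat -> C) (l : C) :
  is_lim_seq (fun n => Re (u n)) (Re l) -> is_lim_seq (fun n => Im (u n)) (Im l) -> Clim u l.
Proof.
  intros H1 H2 eps He.
  apply is_lim_seq_spec in H1. apply is_lim_seq_spec in H2.
  assert (He2 : (0 < eps / 2)%R) by lra.
  destruct (H1 (mkposreal _ He2)) as [N1 HN1]. destruct (H2 (mkposreal _ He2)) as [N2 HN2].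
  exists (N1 + N2)%nat. intros n Hn.
  specialize (HN1 n ltac:(lia)). specialize (HN2 n ltac:(lia)). simpl in HN1, HN2.
  eapply Rle_trans; [apply Cmod_le_re_im|].
  change (Re (u n - l)) with (Re (u n) - Re l)%R. change (Im (u n - l)) with (Im (u n) - Im l)%R. lra.
Qed.

(** The limit is an explicit pair of [Lim_seq] values, the form in which [zreg] is defined. *)
Lemma Clim_cauchy (u : nat -> C) :
  (forall eps : R, (0 < eps)%R -> exists N, forall n m, (N <= n)%nat -> (N <= m)%nat ->
     (Cmod (u n - u m) <= eps)%R) ->
  Clim u (real (Lim_seq (fun n => Re (u n))), real (Lim_seq (fun n => Im (u n)))).
Proof.
  intros H. apply Clim_of_re_im.
  - apply Lim_seq_correct', ex_lim_seq_cauchy_corr. intros eps.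
    destruct (H (pos eps / 2)%R) as [N HN]; [destruct eps; simpl; lra|].
    exists N. intros n m Hn Hm. specialize (HN n m Hn Hm).
    change (Re (u n) - Re (u m))%R with (Re (u n - u m)).
    pose proof (re_le_Cmod (u n - u m)). destruct eps; simpl in *; lra.
  - apply Lim_seq_correct', ex_lim_seq_cauchy_corr. intros eps.
    destruct (H (pos eps / 2)%R) as [N HN]; [destruct eps; simpl; lra|].
    exists N. intros n m Hn Hm. specialize (HN n m Hn Hm).
    change (Im (u n) - Im (u m))%R with (Im (u n - u m)).
    pose proof (im_le_Cmod (u n - u m)). destruct eps; simpl in *; lra.
Qed.

Lemma Clim_bound (u : nat -> C) (l a : C) (B : R) (N : nat) :
  Clim u l -> (forall n, (N <= n)%nat -> (Cmod (u n - a) <= B)%R) -> (Cmod (l - a) <= B)%R.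
Proof.
  intros H HB. apply le_epsilon. intros eps He.
  destruct (H eps He) as [M HM].
  specialize (HM (N + M)%nat ltac:(lia)). specialize (HB (N + M)%nat ltac:(lia)).
  eapply Rle_trans; [apply (Cmod_minus_triangle _ (u (N + M)%nat))|].
  rewrite Cmod_minus_sym. lra.
Qed.

(** * The complex exponential *)

Lemma derive_nonpos_decr (f f' : R -> R) (a b : R) : (a <= b)%R ->
  (forall t, (a <= t <= b)%R -> is_derive f t (f' t)) ->
  (forall t, (a <= t <= b)%R -> (f' t <= 0)%R) -> (f b <= f a)%R.
Proof.
  intros Hab Hd Hn.
  destruct (MVT_gen f a b f') as [c [Hc E]].
  - rewrite Rmin_left, Rmax_right by easy. intros x Hx. apply Hd. lra.
  - rewrite Rmin_left, Rmax_right by easy. intros x Hx.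
    apply continuity_pt_filterlim. apply (ex_derive_continuous (K := R_AbsRing) (V := R_NormedModule)). exists (f' x). now apply Hd.
  - rewrite Rmin_left, Rmax_right in Hc by easy. specialize (Hn c Hc). nra.
Qed.

Definition is_cderive (f : R -> C) (t : R) (l : C) : Prop :=
  is_derive (fun x => Re (f x)) t (Re l) /\ is_derive (fun x => Im (f x)) t (Im l).

Lemma is_cderive_plus (f g : R -> C) (t : R) (l m : C) :
  is_cderive f t l -> is_cderive g t m -> is_cderive (fun x => f x + g x) t (l + m).
Proof.
  intros [H1 H2] [K1 K2]. split; simpl.
  - exact (is_derive_plus _ _ _ _ _ H1 K1).
  - exact (is_derive_plus _ _ _ _ _ H2 K2).
Qed.

Lemma is_cderive_minus (f g : R -> C) (t : R) (l m : C) :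
  is_cderive f t l -> is_cderive g t m -> is_cderive (fun x => f x - g x) t (l - m).
Proof.
  intros [H1 H2] [K1 K2]. split; simpl.
  - exact (is_derive_minus _ _ _ _ _ H1 K1).
  - exact (is_derive_minus _ _ _ _ _ H2 K2).
Qed.

Lemma is_cderive_scal (g : R -> R) (t l : R) (c : C) :
  is_derive g t l -> is_cderive (fun x => RtoC (g x) * c) t (RtoC l * c).
Proof.
  intros H. assert (E : ex_derive g t) by now exists l.
  split; simpl; (auto_derive; [easy|]); rewrite (is_derive_unique (fun x : R => g x) _ _ H); ring.
Qed.

(* Projecting on the direction of [f b - f a] reduces to the real mean value theorem. *)
Lemma path_bound (f f' : R -> C) (g g' : R -> R) (a b : R) : (a <= b)%R ->
  (forall t, (a <= t <= b)%R -> is_cderive f t (f' t)) ->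
  (forall t, (a <= t <= b)%R -> is_derive g t (g' t)) ->
  (forall t, (a <= t <= b)%R -> (Cmod (f' t) <= g' t)%R) ->
  (Cmod (f b - f a) <= g b - g a)%R.
Proof.
  intros Hab Hf Hg Hle.
  set (u := f b - f a).
  assert (H0 : (- g b <= - g a)%R).
  { apply (derive_nonpos_decr (fun t => - g t)%R (fun t => - g' t)%R); [easy| |].
    - intros t Ht. exact (is_derive_opp _ _ _ (Hg t Ht)).
    - intros t Ht. pose proof (Cmod_ge_0 (f' t)). specialize (Hle t Ht). lra. }
  assert (H1 : (Re u * Re (f b) + Im u * Im (f b) - Cmod u * g b
             <= Re u * Re (f a) + Im u * Im (f a) - Cmod u * g a)%R).
  { apply (derive_nonpos_decr (fun t => Re u * Re (f t) + Im u * Im (f t) - Cmod u * g t)%R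
            (fun t => Re u * Re (f' t) + Im u * Im (f' t) - Cmod u * g' t)%R); [easy| |].
    - intros t Ht. destruct (Hf t Ht) as [A B]. pose proof (Hg t Ht) as D.
      apply (is_derive_minus (V := R_NormedModule)); [apply (is_derive_plus (V := R_NormedModule))|];
        apply is_derive_scal; assumption.
    - intros t Ht. specialize (Hle t Ht).
      assert (Re u * Re (f' t) + Im u * Im (f' t) <= Cmod u * Cmod (f' t))%R.
      { replace (Re u * Re (f' t) + Im u * Im (f' t))%R with (Re (Cconj u * f' t)) by (simpl; unfold Re, Im; ring).
        rewrite <- (Cmod_conj u), <- Cmod_mult.
        eapply Rle_trans; [apply Rle_abs|]. apply re_le_Cmod. }
      pose proof (Cmod_ge_0 u). nra. }
  assert (H2 : (Cmod u ^ 2 = Re u * (Re (f b) - Re (f a)) + Im u * (Im (f b) - Im (f a)))%R).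
  { rewrite Cmod2_alt. unfold u, Cminus, Cplus, Copp, Re, Im; cbn [fst snd]; ring. }
  pose proof (Cmod_ge_0 u). nra.
Qed.

Definition cexp (z : C) : C := (exp (Re z) * cos (Im z), exp (Re z) * sin (Im z))%R.

Lemma cexp_plus (x y : C) : cexp (x + y) = cexp x * cexp y.
Proof.
  unfold cexp, Cmult, Cplus, Re, Im; cbn [fst snd]. rewrite exp_plus, cos_plus, sin_plus. f_equal; ring.
Qed.

Lemma cexp_0 : cexp 0 = 1.
Proof. unfold cexp; simpl. rewrite exp_0, cos_0, sin_0. unfold RtoC. f_equal; ring. Qed.

Lemma Cmod_cexp (z : C) : Cmod (cexp z) = exp (Re z).
Proof.
  unfold Cmod, cexp. cbn [fst snd].
  replace ((exp (Re z) * cos (Im z)) ^ 2 + (exp (Re z) * sin (Im z)) ^ 2)%R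
    with (exp (Re z) ^ 2 * ((sin (Im z))² + (cos (Im z))²))%R by (unfold Rsqr; ring).
  rewrite sin2_cos2, Rmult_1_r. apply sqrt_pow2, Rlt_le, exp_pos.
Qed.

Lemma cexp_pow (z : C) (n : nat) : cexp z ^ n = cexp (RtoC (INR n) * z).
Proof.
  induction n as [|n IH].
  - change (INR 0) with 0%R. rewrite Cmult_0_l, cexp_0. reflexivity.
  - rewrite Cpow_S, IH, <- cexp_plus, S_INR, RtoC_plus. f_equal. ring.
Qed.

Lemma is_derive_pow_fact (n : nat) (t : R) :
  is_derive (fun t => t ^ S n / INR (fact (S n)))%R t (t ^ n / INR (fact n))%R.
Proof.
  assert (E : INR (fact (S n)) = (INR (S n) * INR (fact n))%R) by (rewrite fact_simpl; apply mult_INR).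
  pose proof (INR_fact_neq_0 n). assert (INR (S n) <> 0%R) by (apply not_0_INR; lia).
  revert E. generalize (INR (fact (S n))). intros K E.
  replace (t ^ n / INR (fact n))%R with (/ K * (INR (S n) * 1 * t ^ pred (S n)))%R
    by (rewrite E; change (pred (S n)) with n; field; auto).
  apply (is_derive_ext (fun t => / K * t ^ S n)%R); [intros x; apply Rmult_comm|].
  apply is_derive_scal, is_derive_pow, (is_derive_id t).
Qed.

Definition expT (z : C) (n : nat) (t : R) : C :=
  csum (fun j => RtoC (t ^ j / INR (fact j)) * z ^ j) n.

Lemma is_cderive_expT (z : C) (n : nat) (t : R) :
  is_cderive (expT z (S n)) t (z * expT z n t).
Proof.
  induction n as [|n IH].
  - unfold expT. cbn [csum]. replace (z * 0) with (0 + RtoC 0 * z ^ 0) by ring.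
    apply (is_cderive_plus (fun _ => RtoC 0)).
    + split; simpl; auto_derive; easy.
    + apply is_cderive_scal. simpl. auto_derive; [easy | ring].
  - replace (z * expT z (S n) t) with (z * expT z n t + RtoC (t ^ n / INR (fact n)) * z ^ S n).
    2:{ unfold expT. cbn [csum]. rewrite Cpow_S. ring. }
    apply (is_cderive_plus (expT z (S n)) (fun t => RtoC (t ^ S n / INR (fact (S n))) * z ^ S n)); [exact IH|].
    apply is_cderive_scal, is_derive_pow_fact.
Qed.

Lemma is_cderive_cexp (z : C) (t : R) :
  is_cderive (fun t => cexp (RtoC t * z)) t (z * cexp (RtoC t * z)).
Proof.
  assert (E : forall x : R, cexp (RtoC x * z)
    = (exp (x * Re z) * cos (x * Im z), exp (x * Re z) * sin (x * Im z))%R).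
  { intros x. unfold cexp, Cmult, RtoC, Re, Im; cbn [fst snd].
    rewrite !Rmult_0_l, Rminus_0_r, Rplus_0_r. reflexivity. }
  rewrite E. split.
  - apply (is_derive_ext (fun x => exp (x * Re z) * cos (x * Im z))%R).
    + intros x. now rewrite E.
    + auto_derive; [easy|]. unfold Cmult, Re, Im; cbn [fst snd]. ring.
  - apply (is_derive_ext (fun x => exp (x * Re z) * sin (x * Im z))%R).
    + intros x. now rewrite E.
    + auto_derive; [easy|]. unfold Cmult, Re, Im; cbn [fst snd]. ring.
Qed.

(** Induction on n: as a function of t, the remainder with n + 1 terms vanishes at 0 and has
    derivative z times the remainder with n terms, so [path_bound] integrates the previous estimate.
    The factor [exp (Cmod z)] bounds the exponential itself, which is the case n = 0. *)
Lemma cexp_remainder_path (z : C) (n : nat) (t : R) : (0 <= t <= 1)%R ->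
  (Cmod (cexp (RtoC t * z) - expT z n t)
     <= exp (Cmod z) * Cmod z ^ n * (t ^ n / INR (fact n)))%R.
Proof.
  revert t. induction n as [|n IH]; intros t Ht.
  - unfold expT. cbn [csum]. replace (cexp (t * z) - 0) with (cexp (t * z)) by ring.
    rewrite Cmod_cexp. simpl. replace (1 / 1)%R with 1%R by field. rewrite !Rmult_1_r.
    assert (H : (t * Re z - 0 * Im z <= Cmod z)%R).
    { pose proof (re_le_Cmod z). pose proof (Rle_abs (Re z)). pose proof (Cmod_ge_0 z). nra. }
    destruct H as [H|H]; [apply Rlt_le, exp_increasing; exact H | rewrite <- H; apply Rle_refl].
  - pose proof (path_bound (fun t => cexp (RtoC t * z) - expT z (S n) t)
      (fun t => z * cexp (RtoC t * z) - z * expT z n t)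
      (fun t => exp (Cmod z) * Cmod z ^ S n * (t ^ S n / INR (fact (S n))))%R
      (fun t => exp (Cmod z) * Cmod z ^ S n * (t ^ n / INR (fact n)))%R 0 t) as H.
    cbv beta in H.
    assert (E0 : cexp (RtoC 0 * z) - expT z (S n) 0 = 0).
    { rewrite Cmult_0_l, cexp_0. unfold expT.
      rewrite (csum_single _ _ 0%nat); [|lia|].
      - simpl. replace (1 / 1)%R with 1%R by field. ring.
      - intros i _ Hi. destruct i; [lia|]. simpl pow. unfold Rdiv. rewrite !Rmult_0_l. ring. }
    rewrite E0 in H. replace (0 ^ S n)%R with 0%R in H by (simpl; ring).
    replace (cexp (t * z) - expT z (S n) t - 0) with (cexp (t * z) - expT z (S n) t) in H by ring.
    replace (exp (Cmod z) * Cmod z ^ S n * (0 / INR (fact (S n))))%R with 0%R in H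
      by (unfold Rdiv; ring).
    rewrite Rminus_0_r in H.
    apply H; [lra| | |].
    + intros x Hx. apply is_cderive_minus; [apply is_cderive_cexp | apply is_cderive_expT].
    + intros x Hx. apply is_derive_scal, is_derive_pow_fact.
    + intros x Hx. replace (z * cexp (x * z) - z * expT z n x) with (z * (cexp (x * z) - expT z n x)) by ring.
      rewrite Cmod_mult. specialize (IH x ltac:(lra)). pose proof (Cmod_ge_0 z). simpl pow.
      apply Rmult_le_compat_l with (r := Cmod z) in IH; [|lra]. lra.
Qed.

Lemma cexp_remainder (z : C) (n : nat) :
  (Cmod (cexp z - csum (fun j => RtoC (/ INR (fact j)) * z ^ j)%C n)
     <= exp (Cmod z) * (Cmod z ^ n / INR (fact n)))%R.
Proof.
  pose proof (cexp_remainder_path z n 1 ltac:(lra)) as H.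
  rewrite Cmult_1_l in H. rewrite pow1 in H.
  replace (expT z n 1) with (csum (fun j => RtoC (/ INR (fact j)) * z ^ j) n) in H.
  - eapply Rle_trans; [exact H|]. apply Req_le. field. apply INR_fact_neq_0.
  - apply csum_ext. intros i _. rewrite pow1. unfold Rdiv. now rewrite Rmult_1_l.
Qed.

(** * Complex powers of a positive base *)

Lemma cpow_pos_cexp (x : R) (s : C) : cpow_pos x s = cexp (RtoC (ln x) * s).
Proof.
  unfold cpow_pos, cexp, Cmult, RtoC, Re, Im; cbn [fst snd].
  replace (ln x * fst s - 0 * snd s)%R with (fst s * ln x)%R by ring.
  replace (ln x * snd s + 0 * fst s)%R with (snd s * ln x)%R by ring. reflexivity.
Qed.

Lemma cpow_pos_plus (x : R) (s u : C) : cpow_pos x (s + u) = cpow_pos x s * cpow_pos x u.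
Proof. rewrite !cpow_pos_cexp, <- cexp_plus. f_equal. ring. Qed.

Lemma cpow_pos_mult (x y : R) (s : C) : (0 < x)%R -> (0 < y)%R ->
  cpow_pos (x * y) s = cpow_pos x s * cpow_pos y s.
Proof.
  intros Hx Hy. rewrite !cpow_pos_cexp, ln_mult, RtoC_plus, <- cexp_plus by easy.
  f_equal. ring.
Qed.

Lemma cpow_pos_1_l (s : C) : cpow_pos 1 s = 1.
Proof. rewrite cpow_pos_cexp, ln_1, Cmult_0_l. apply cexp_0. Qed.

Lemma cpow_pos_1_r (x : R) : (0 < x)%R -> cpow_pos x 1 = RtoC x.
Proof.
  intros Hx. unfold cpow_pos; simpl.
  rewrite Rmult_1_l, Rmult_0_l, exp_ln, cos_0, sin_0 by easy. unfold RtoC. f_equal; ring.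
Qed.

Lemma Cmod_cpow_pos (x : R) (s : C) : Cmod (cpow_pos x s) = Rpower x (Re s).
Proof.
  rewrite cpow_pos_cexp, Cmod_cexp. unfold Rpower. f_equal. unfold Cmult, RtoC, Re, Im; cbn [fst snd]. ring.
Qed.

Lemma is_cderive_cpow_pos (a : C) (x : R) : (0 < x)%R ->
  is_cderive (fun x => cpow_pos x a) x (a * cpow_pos x (a - 1)).
Proof.
  intros Hx.
  assert (E : cpow_pos x (a - 1) = RtoC (/ x) * cpow_pos x a).
  { replace a with (a - 1 + 1) at 2 by ring.
    rewrite cpow_pos_plus, cpow_pos_1_r, RtoC_inv by lra. field.
    intros H. apply RtoC_inj in H. lra. }
  rewrite E.
  split; unfold cpow_pos, Cmult, RtoC, Re, Im; cbn [fst snd];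
    (auto_derive; [easy|]); unfold Rdiv; ring.
Qed.

(** * The regularised zeta function *)

Lemma exp_le (x y : R) : (x <= y)%R -> (exp x <= exp y)%R.
Proof. intros [H| ->]; [apply Rlt_le, exp_increasing; exact H | apply Rle_refl]. Qed.

Lemma Rpower_antimono (x y c : R) : (0 < x <= y)%R -> (c <= 0)%R ->
  (Rpower y c <= Rpower x c)%R.
Proof.
  intros Hx Hc. apply exp_le.
  assert (ln x <= ln y)%R by (apply Rcomplements.ln_le; lra). nra.
Qed.

Lemma Rpower_neg_small (c eps : R) : (0 < c)%R -> (0 < eps)%R ->
  exists N : nat, forall n, (N <= n)%nat -> (Rpower (INR (S n)) (- c) <= eps)%R.
Proof.
  intros Hc He. destruct (INR_unbounded (exp (- ln eps / c))) as [N HN].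
  exists N. intros n Hn.
  apply Rle_trans with (exp (ln eps)); [|rewrite exp_ln by easy; lra].
  apply exp_le.
  assert (H : (- ln eps / c <= ln (INR (S n)))%R).
  { rewrite <- (ln_exp (- ln eps / c)). apply Rcomplements.ln_le; [apply exp_pos|].
    apply le_INR in Hn. rewrite S_INR. lra. }
  apply Rmult_le_compat_l with (r := c) in H; [|lra].
  replace (c * (- ln eps / c))%R with (- ln eps)%R in H by (field; lra). lra.
Qed.

Lemma cpow_pos_diff (a : C) (x y : R) : (0 < x <= y)%R -> (Re a <= 1)%R ->
  (Cmod (cpow_pos y a - cpow_pos x a) <= Cmod a * Rpower x (Re a - 1) * (y - x))%R.
Proof.
  intros Hx Ha.
  eapply Rle_trans.
  - apply (path_bound (fun t => cpow_pos t a) (fun t => a * cpow_pos t (a - 1))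
      (fun t => Cmod a * Rpower x (Re a - 1) * t)%R (fun _ => Cmod a * Rpower x (Re a - 1))%R x y); [lra| | |].
    + intros t Ht. apply is_cderive_cpow_pos. lra.
    + intros t Ht. auto_derive; [easy | ring].
    + intros t Ht. rewrite Cmod_mult, Cmod_cpow_pos.
      apply Rmult_le_compat_l; [apply Cmod_ge_0|].
      change (Re (a - 1)) with (Re a - 1)%R.
      apply Rpower_antimono; lra.
  - apply Req_le. ring.
Qed.

(** With x = N + 1 the left side is the increment of [zpartial] from N to N + 1. Once the linear
    term of t^(1-s) at x is subtracted, the derivative is (1 - s)(t^(-s) - x^(-s)), which
    [cpow_pos_diff] makes small on an interval of length 1. The gain of one power of x makes the
    increments summable for [Re s > 0]. *)
Lemma cpow_pos_taylor (s : C) (x : R) : (0 < x)%R -> (0 <= Re s)%R ->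
  (Cmod (cpow_pos (x + 1) (1 - s) - cpow_pos x (1 - s) + (s - 1) * cpow_pos x (- s))
     <= Cmod s * Cmod (s - 1) * Rpower x (- Re s - 1))%R.
Proof.
  intros Hx Hs.
  set (M := (Cmod s * Cmod (s - 1) * Rpower x (- Re s - 1))%R).
  pose proof (path_bound (fun t => cpow_pos t (1 - s) - RtoC t * ((1 - s) * cpow_pos x (- s)))
    (fun t => (1 - s) * cpow_pos t (1 - s - 1) - RtoC 1 * ((1 - s) * cpow_pos x (- s)))
    (fun t => M * t)%R (fun _ => M) x (x + 1)) as H.
  cbv beta in H.
  replace (cpow_pos (x + 1) (1 - s) - RtoC (x + 1) * ((1 - s) * cpow_pos x (- s)) -
      (cpow_pos x (1 - s) - x * ((1 - s) * cpow_pos x (- s))))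
    with (cpow_pos (x + 1) (1 - s) - cpow_pos x (1 - s) + (s - 1) * cpow_pos x (- s)) in H
    by (rewrite RtoC_plus; ring).
  eapply Rle_trans; [apply H|]; [lra| | | |].
  - intros t Ht. apply is_cderive_minus.
    + apply is_cderive_cpow_pos. lra.
    + apply is_cderive_scal. apply (is_derive_id t).
  - intros t Ht. auto_derive; [easy | ring].
  - intros t Ht. replace (1 - s - 1) with (- s) by ring.
    replace ((1 - s) * cpow_pos t (- s) - 1 * ((1 - s) * cpow_pos x (- s)))
      with (- (s - 1) * (cpow_pos t (- s) - cpow_pos x (- s))) by ring.
    rewrite Cmod_mult, Cmod_opp. unfold M.
    assert (Hre : (Re (- s) = - Re s)%R) by reflexivity.
    pose proof (cpow_pos_diff (- s) x t ltac:(lra) ltac:(lra)) as D.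
    rewrite Cmod_opp, Hre in D.
    assert (0 <= Cmod s * Rpower x (- Re s - 1))%R.
    { apply Rmult_le_pos; [apply Cmod_ge_0 | apply Rlt_le, exp_pos]. }
    apply Rle_trans with (Cmod (s - 1) * (Cmod s * Rpower x (- Re s - 1)))%R; [|lra].
    apply Rmult_le_compat_l; [apply Cmod_ge_0|]. nra.
  - lra.
Qed.

(** Comparison of the value of t^(-c-1) at the right end with its integral over [x, x + 1], written
    as a difference so that sums telescope. *)
Lemma Rpower_telescope (c x : R) : (0 < c)%R -> (0 < x)%R ->
  (Rpower (x + 1) (- c - 1) <= / c * (Rpower x (- c) - Rpower (x + 1) (- c)))%R.
Proof.
  intros Hc Hx.
  assert (H : (Rpower (x + 1) (- c) + c * Rpower (x + 1) (- c - 1) * (x + 1)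
             <= Rpower x (- c) + c * Rpower (x + 1) (- c - 1) * x)%R).
  { apply (derive_nonpos_decr (fun t => Rpower t (- c) + c * Rpower (x + 1) (- c - 1) * t)%R
      (fun t => - c * Rpower t (- c - 1) + c * Rpower (x + 1) (- c - 1))%R); [lra| |].
    - intros t Ht. apply (is_derive_plus (V := R_NormedModule)).
      + apply is_derive_Reals, derivable_pt_lim_power. lra.
      + auto_derive; [easy | ring].
    - intros t Ht. pose proof (Rpower_antimono t (x + 1) (- c - 1) ltac:(lra) ltac:(lra)). nra. }
  apply Rmult_le_reg_l with c; [lra|].
  rewrite <- Rmult_assoc, Rinv_r, Rmult_1_l by lra. lra.
Qed.

(** Euler-Maclaurin truncation: zeta(s) is approximated by the sum of n^(-s) over 1 <= n <= N plus
    (N+1)^(1-s)/(s-1). Multiplied by s - 1, this is entire in s, with no singularity at s = 1. *)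
Definition zpartial (s : C) (N : nat) : C :=
  (s - 1) * csum (fun i => cpow_pos (INR (S i)) (- s)) N + cpow_pos (INR (S N)) (1 - s).

(* The regularised zeta function [(s - 1) zeta s], here for [0 < Re s]. *)
Definition zreg (s : C) : C :=
  (real (Lim_seq (fun N => Re (zpartial s N))), real (Lim_seq (fun N => Im (zpartial s N)))).

Lemma zpartial_succ (s : C) (N : nat) : (0 <= Re s)%R ->
  (Cmod (zpartial s (S N) - zpartial s N)
     <= Cmod s * Cmod (s - 1) * Rpower (INR (S N)) (- Re s - 1))%R.
Proof.
  intros Hs.
  assert (HN : (0 < INR (S N))%R) by (apply lt_0_INR; lia).
  pose proof (cpow_pos_taylor s (INR (S N)) HN Hs) as H.
  eapply Rle_trans; [|exact H]. apply Req_le. f_equal.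
  unfold zpartial. cbn [csum]. rewrite (S_INR (S N)). ring.
Qed.

Lemma zpartial_diff (s : C) (N M : nat) : (0 < Re s)%R -> (S N <= M)%nat ->
  (Cmod (zpartial s M - zpartial s (S N))
     <= Cmod s * Cmod (s - 1) / Re s * Rpower (INR (S N)) (- Re s))%R.
Proof.
  intros Hs HM.
  set (B := (Cmod s * Cmod (s - 1) / Re s)%R).
  assert (HB : (0 <= B)%R).
  { apply Rmult_le_pos; [apply Rmult_le_pos; apply Cmod_ge_0 | apply Rlt_le, Rinv_0_lt_compat, Hs]. }
  (* The bound is strengthened to a telescoping difference, which the induction on M preserves. *)
  enough (H : (Cmod (zpartial s M - zpartial s (S N))
     <= B * (Rpower (INR (S N)) (- Re s) - Rpower (INR M) (- Re s)))%R).
  { assert (0 < Rpower (INR M) (- Re s))%R by apply exp_pos. nra. }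
  induction HM as [|M HM IH].
  - replace (zpartial s (S N) - zpartial s (S N)) with (RtoC 0) by ring. rewrite Cmod_0. nra.
  - eapply Rle_trans; [apply (Cmod_minus_triangle _ (zpartial s M))|].
    pose proof (zpartial_succ s M ltac:(lra)) as H1.
    assert (HMp : (0 < INR M)%R) by (apply lt_0_INR; lia).
    pose proof (Rpower_telescope (Re s) (INR M) Hs HMp) as H2.
    rewrite <- S_INR in H2.
    assert (Cmod s * Cmod (s - 1) * Rpower (INR (S M)) (- Re s - 1)
      <= B * (Rpower (INR M) (- Re s) - Rpower (INR (S M)) (- Re s)))%R.
    { unfold B, Rdiv. rewrite (Rmult_assoc (Cmod s * Cmod (s - 1))).
      apply Rmult_le_compat_l; [apply Rmult_le_pos; apply Cmod_ge_0 | exact H2]. }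
    lra.
Qed.

Lemma zpartial_lim (s : C) : (0 < Re s)%R -> Clim (zpartial s) (zreg s).
Proof.
  intros Hs. apply Clim_cauchy. intros eps He.
  set (B := (Cmod s * Cmod (s - 1) / Re s)%R).
  assert (HB : (0 <= B)%R).
  { apply Rmult_le_pos; [apply Rmult_le_pos; apply Cmod_ge_0 | apply Rlt_le, Rinv_0_lt_compat, Hs]. }
  destruct (Rpower_neg_small (Re s) (eps / (2 * (B + 1)))) as [N HN]; [easy| |].
  { apply Rdiv_lt_0_compat; lra. }
  specialize (HN N ltac:(lia)).
  assert (HBN : (B * Rpower (INR (S N)) (- Re s) <= eps / 2)%R).
  { apply Rle_trans with ((B + 1) * (eps / (2 * (B + 1))))%R.
    - apply Rmult_le_compat; [lra | apply Rlt_le, exp_pos | lra | exact HN].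
    - apply Req_le. field. lra. }
  exists (S N). intros n m Hn Hm.
  eapply Rle_trans; [apply (Cmod_minus_triangle _ (zpartial s (S N)))|].
  rewrite (Cmod_minus_sym (zpartial s (S N))).
  pose proof (zpartial_diff s N n Hs Hn). pose proof (zpartial_diff s N m Hs Hm).
  unfold B in HBN. lra.
Qed.

Lemma zreg_zpartial (s : C) (N : nat) : (0 < Re s)%R ->
  (Cmod (zreg s - zpartial s (S N))
     <= Cmod s * Cmod (s - 1) / Re s * Rpower (INR (S N)) (- Re s))%R.
Proof.
  intros Hs. apply (Clim_bound (zpartial s) _ _ _ (S N)); [now apply zpartial_lim|].
  intros n Hn. now apply zpartial_diff.
Qed.

Lemma Rpower_1_l (c : R) : Rpower 1 c = 1%R.
Proof. unfold Rpower. rewrite ln_1, Rmult_0_r. apply exp_0. Qed.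

(** Comparison with [zpartial s 1], that is (s - 1) + 2^(1-s), whose second term has modulus at most
    2. For [Re s] bounded away from 0 the growth is quadratic in s, enough to control F near w =
    -1. *)
Lemma Cmod_zreg_le (s : C) : (0 < Re s)%R ->
  (Cmod (zreg s) <= Cmod (s - 1) + 2 + Cmod s * Cmod (s - 1) / Re s)%R.
Proof.
  intros Hs. pose proof (zreg_zpartial s 0 Hs) as H.
  change (INR 1) with 1%R in H. rewrite Rpower_1_l, Rmult_1_r in H.
  eapply Rle_trans; [apply (Cmod_le_minus _ (zpartial s 1))|].
  apply Rplus_le_compat; [|exact H].
  unfold zpartial. cbn [csum]. change (INR 1) with 1%R. rewrite cpow_pos_1_l.
  eapply Rle_trans; [apply Cmod_triangle|].
  apply Rplus_le_compat.
  - apply Req_le. f_equal. ring.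
  - rewrite Cmod_cpow_pos. change (Re (1 - s)) with (1 - Re s)%R.
    rewrite S_INR. change (INR 1) with 1%R. replace (1 + 1)%R with 2%R by ring.
    rewrite <- (Rpower_1 2) at 2 by lra. apply Rle_Rpower; lra.
Qed.

(** The alternating sum is the full sum minus twice the terms with even base, and these are 2^(-s)
    times a sum of half the length. *)
Lemma eta_even_partial (s : C) (N : nat) :
  csum (eta_term s) (2 * N) = csum (fun i => cpow_pos (INR (S i)) (- s)) (2 * N)
    - 2 * cpow_pos 2 (- s) * csum (fun i => cpow_pos (INR (S i)) (- s)) N.
Proof.
  induction N as [|N IH]; [cbn [csum Nat.mul Nat.add]; ring|].
  replace (2 * S N)%nat with (S (S (2 * N))) by lia. cbn [csum]. rewrite IH.
  unfold eta_term. rewrite pow_1_even, pow_1_odd.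
  replace (INR (S (S (2 * N)))) with (2 * INR (S N))%R by (rewrite !S_INR, mult_INR; simpl; ring).
  rewrite cpow_pos_mult by (try lra; apply lt_0_INR; lia).
  replace (RtoC (-1)) with (- RtoC 1) by (rewrite <- RtoC_opp; f_equal; ring). ring.
Qed.

(** The boundary powers of the two [zpartial] do not quite match: one has base 2N + 1, the other 2(N
    + 1). The last summand corrects this and tends to 0 for [Re s > 0]. *)
Lemma eta_even_zpartial (s : C) (N : nat) :
  (s - 1) * csum (eta_term s) (2 * N)
  = zpartial s (2 * N) - cpow_pos 2 (1 - s) * zpartial s N
    + (cpow_pos (INR (S (S (2 * N)))) (1 - s) - cpow_pos (INR (S (2 * N))) (1 - s)).
Proof.
  rewrite eta_even_partial. unfold zpartial.
  replace (INR (S (S (2 * N)))) with (2 * INR (S N))%R by (rewrite !S_INR, mult_INR; simpl; ring).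
  rewrite cpow_pos_mult by (try lra; apply lt_0_INR; lia).
  replace (cpow_pos 2 (1 - s)) with (2 * cpow_pos 2 (- s)).
  - ring.
  - unfold Cminus. rewrite cpow_pos_plus, cpow_pos_1_r by lra. ring.
Qed.

Lemma eta_partial_lim (s : C) : (0 < Re s)%R ->
  Clim (fun n => (s - 1) * csum (eta_term s) n) ((1 - cpow_pos 2 (1 - s)) * zreg s).
Proof.
  intros Hs eps He.
  (* Budget in units of [eps / B]: even partial sums cost 1 + |q| + |s - 1|, and odd ones a further
     |s - 1| for the extra term. *)
  set (q := cpow_pos 2 (1 - s)). set (B := (1 + Cmod q + 2 * Cmod (s - 1))%R).
  assert (HB : (1 <= B)%R) by (unfold B; pose proof (Cmod_ge_0 q); pose proof (Cmod_ge_0 (s - 1)); lra).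
  assert (He' : (0 < eps / B)%R) by (apply Rdiv_lt_0_compat; lra).
  destruct (zpartial_lim s Hs (eps / B)%R He') as [N1 H1].
  destruct (Rpower_neg_small (Re s) (eps / B)%R Hs He') as [N2 H2].
  exists (2 * (N1 + N2) + 1)%nat. intros n Hn.
  assert (Even : forall N, (N1 + N2 <= N)%nat ->
    (Cmod ((s - 1) * csum (eta_term s) (2 * N) - (1 - q) * zreg s)
       <= (1 + Cmod q + Cmod (s - 1)) * (eps / B))%R).
  { intros N HN. rewrite eta_even_zpartial. fold q.
    set (d := cpow_pos (INR (S (S (2 * N)))) (1 - s) - cpow_pos (INR (S (2 * N))) (1 - s)).
    replace (zpartial s (2 * N) - q * zpartial s N + d - (1 - q) * zreg s)
      with ((zpartial s (2 * N) - zreg s) + - (q * (zpartial s N - zreg s)) + d) by ring.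
    eapply Rle_trans; [apply Cmod_triangle|].
    apply Rle_trans with (Cmod (zpartial s (2 * N) - zreg s) + Cmod q * Cmod (zpartial s N - zreg s) + Cmod d)%R.
    { apply Rplus_le_compat_r. eapply Rle_trans; [apply Cmod_triangle|].
      rewrite Cmod_opp, Cmod_mult. lra. }
    pose proof (H1 (2 * N)%nat ltac:(lia)) as A1. pose proof (H1 N ltac:(lia)) as A2.
    pose proof (H2 (2 * N)%nat ltac:(lia)) as A3.
    assert (Hd : (Cmod d <= Cmod (s - 1) * (eps / B))%R).
    { assert (HI : (0 < INR (S (2 * N)))%R) by (apply lt_0_INR; lia).
      pose proof (cpow_pos_diff (1 - s) (INR (S (2 * N))) (INR (S (S (2 * N))))) as D.
      pose proof (S_INR (S (2 * N))) as HS.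
      change (Re (1 - s)) with (1 - Re s)%R in D.
      specialize (D ltac:(lra) ltac:(lra)). fold d in D.
      replace (1 - Re s - 1)%R with (- Re s)%R in D by ring.
      replace (INR (S (S (2 * N))) - INR (S (2 * N)))%R with 1%R in D by (rewrite HS; ring).
      rewrite (Cmod_minus_sym 1 s), Rmult_1_r in D. eapply Rle_trans; [exact D|].
      apply Rmult_le_compat_l; [apply Cmod_ge_0 | exact A3]. }
    pose proof (Cmod_ge_0 q). nra. }
  assert (Hodd : (Cmod (s - 1) * (eps / B) + (1 + Cmod q + Cmod (s - 1)) * (eps / B) = eps)%R).
  { transitivity (B * (eps / B))%R; [rewrite <- Rmult_plus_distr_r; f_equal; unfold B; ring | field; lra]. }
  assert (0 <= Cmod (s - 1) * (eps / B))%R by (apply Rmult_le_pos; [apply Cmod_ge_0 | lra]).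
  destruct (Nat.Even_or_Odd n) as [[N ->]|[N ->]].
  - specialize (Even N ltac:(lia)). lra.
  - specialize (Even N ltac:(lia)). rewrite Nat.add_1_r. cbn [csum].
    replace ((s - 1) * (csum (eta_term s) (2 * N) + eta_term s (2 * N)) - (1 - q) * zreg s)
      with ((s - 1) * eta_term s (2 * N) + ((s - 1) * csum (eta_term s) (2 * N) - (1 - q) * zreg s)) by ring.
    eapply Rle_trans; [apply Cmod_triangle|]. rewrite Cmod_mult.
    pose proof (H2 (2 * N)%nat ltac:(lia)) as A3.
    assert (Cmod (eta_term s (2 * N)) <= eps / B)%R.
    { unfold eta_term. rewrite Cmod_mult, Cmod_cpow_pos, Cmod_R, pow_1_even, Rabs_R1, Rmult_1_l. exact A3. }
    pose proof (Cmod_ge_0 (s - 1)). nra.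
Qed.

Lemma Re_csum (f : nat -> C) (n : nat) : Re (csum f n) = rsum (fun i => Re (f i)) n.
Proof. induction n as [|n IH]; simpl; [easy|]. rewrite <- IH. reflexivity. Qed.

Lemma Im_csum (f : nat -> C) (n : nat) : Im (csum f n) = rsum (fun i => Im (f i)) n.
Proof. induction n as [|n IH]; simpl; [easy|]. rewrite <- IH. reflexivity. Qed.

Lemma is_series_rsum (f : nat -> R) (l : R) : is_lim_seq (rsum f) l -> is_series f l.
Proof.
  intros H. apply is_lim_seq_incr_1 in H.
  apply (is_lim_seq_ext _ (sum_n f)) in H; [exact H|].
  intros n. induction n as [|n IH].
  - rewrite sum_O. simpl. ring.
  - rewrite sum_Sn, <- IH. reflexivity.
Qed.

Lemma eta_zreg (s : C) : (0 < Re s)%R -> s <> 1 ->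
  eta s = (1 - cpow_pos 2 (1 - s)) * zreg s / (s - 1).
Proof.
  intros Hs H1.
  assert (Hn : s - 1 <> 0).
  { intros E. apply H1. replace s with (s - 1 + 1) by ring. rewrite E. ring. }
  assert (L : Clim (csum (eta_term s)) ((1 - cpow_pos 2 (1 - s)) * zreg s / (s - 1))).
  { pose proof (Clim_mult_l _ (/ (s - 1)) _ (eta_partial_lim s Hs)) as L.
    replace ((1 - cpow_pos 2 (1 - s)) * zreg s / (s - 1))
      with (/ (s - 1) * ((1 - cpow_pos 2 (1 - s)) * zreg s)) by (field; auto).
    intros eps He. destruct (L eps He) as [N HN]. exists N. intros n Hn'.
    specialize (HN n Hn').
    replace (/ (s - 1) * ((s - 1) * csum (eta_term s) n)) with (csum (eta_term s) n) in HN by (field; auto).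
    exact HN. }
  set (l := (1 - cpow_pos 2 (1 - s)) * zreg s / (s - 1)) in *.
  destruct (Clim_re_im _ _ L) as [L1 L2].
  unfold eta. rewrite (surjective_pairing l). f_equal.
  - apply is_series_unique, is_series_rsum.
    apply (is_lim_seq_ext (fun n => Re (csum (eta_term s) n))); [intros; apply Re_csum | exact L1].
  - apply is_series_unique, is_series_rsum.
    apply (is_lim_seq_ext (fun n => Im (csum (eta_term s) n))); [intros; apply Im_csum | exact L2].
Qed.

Lemma zeta_zreg (s : C) : (0 < Re s)%R -> s <> 1 -> 1 - cpow_pos 2 (1 - s) <> 0 ->
  zeta s = zreg s / (s - 1).
Proof.
  intros Hs H1 H2. unfold zeta. rewrite eta_zreg by easy. field.
  split; [|easy]. intros E. apply H1. replace s with (s - 1 + 1) by ring. rewrite E. ring.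
Qed.

(** Taking moduli in 2^(1-s) = 1 forces [Re s = 1], and the imaginary part then gives sin (y ln 2) =
    0 with y = [Im s]. But 0 < |y| < 1 and ln 2 < 1 keep |y ln 2| strictly between 0 and pi. *)
Lemma zeta_factor_neq0_disc (s : C) : (0 < Cmod (s - 1) < 1)%R -> 1 - cpow_pos 2 (1 - s) <> 0.
Proof.
  intros [H0 H1] E.
  assert (E' : cpow_pos 2 (1 - s) = 1) by (replace (RtoC 1) with (1 - cpow_pos 2 (1 - s) + cpow_pos 2 (1 - s)) at 2 by ring; rewrite E; ring).
  pose proof ln_lt_2 as L2.
  assert (L1 : (ln 2 < 1)%R).
  { rewrite <- (ln_exp 1). apply ln_increasing; [lra|]. pose proof (exp_ineq1 1). lra. }
  assert (Hre : Re s = 1%R).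
  { pose proof (f_equal Cmod E') as M. rewrite Cmod_cpow_pos, Cmod_1 in M.
    change (exp ((1 - Re s) * ln 2) = 1)%R in M.
    rewrite <- exp_0 in M. apply exp_inv in M. rewrite ?exp_0 in M. nra. }
  set (y := Im s).
  assert (Hs : s - 1 = (0, y)%R).
  { apply injective_projections; simpl; unfold Re, y, Im in *; [rewrite Hre|]; ring. }
  assert (Hy : Cmod (s - 1) = Rabs y).
  { rewrite Hs. unfold Cmod; cbn [fst snd]. replace (0 ^ 2 + y ^ 2)%R with (Rsqr y) by (unfold Rsqr; ring).
    apply sqrt_Rsqr_abs. }
  rewrite Hy in H0, H1.
  assert (Hsin : (sin (y * ln 2) = 0)%R).
  { pose proof (f_equal Im E') as M. unfold cpow_pos in M. simpl in M.
    unfold Re in Hre. rewrite Hre in M.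
    replace ((1 + - (1)) * ln 2)%R with 0%R in M by ring. rewrite exp_0, Rmult_1_l in M.
    replace ((0 + - snd s) * ln 2)%R with (- (y * ln 2))%R in M by (unfold y, Im; ring).
    rewrite sin_neg in M. lra. }
  pose proof PI2_1 as HPI. unfold PI2 in HPI.
  destruct (Rcase_abs y) as [Hneg|Hpos].
  - rewrite Rabs_left in H0, H1 by easy.
    assert (0 < sin (- (y * ln 2)))%R by (apply sin_gt_0; nra). rewrite sin_neg in H. lra.
  - rewrite Rabs_right in H0, H1 by easy.
    assert (0 < sin (y * ln 2))%R by (apply sin_gt_0; nra). lra.
Qed.

Lemma zeta_factor_neq0_line (s : C) : (Re s <> 1)%R -> 1 - cpow_pos 2 (1 - s) <> 0.
Proof.
  intros Hs E.
  assert (E' : cpow_pos 2 (1 - s) = 1) by (replace (RtoC 1) with (1 - cpow_pos 2 (1 - s) + cpow_pos 2 (1 - s)) at 2 by ring; rewrite E; ring).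
  pose proof (f_equal Cmod E') as M. rewrite Cmod_cpow_pos, Cmod_1 in M.
  change (exp ((1 - Re s) * ln 2) = 1)%R in M.
  rewrite <- exp_0 in M. apply exp_inv in M. rewrite ?exp_0 in M. pose proof ln_lt_2. apply Hs. nra.
Qed.

(** * Uniform polynomial approximation *)

(** A predicate on functions instead of coefficient lists, so that sums, products and compositions
    need no bookkeeping. Coefficients are recovered once, in [poly_has_coeffs]. *)
Inductive poly : (C -> C) -> Prop :=
| poly_const (c : C) : poly (fun _ => c)
| poly_id : poly (fun z => z)
| poly_plus (f g : C -> C) : poly f -> poly g -> poly (fun z => f z + g z)
| poly_mult (f g : C -> C) : poly f -> poly g -> poly (fun z => f z * g z).

Definition bounded (K : C -> Prop) : Prop := exists B : R, forall z, K z -> (Cmod z <= B)%R.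

Definition UA (K : C -> Prop) (f : C -> C) : Prop :=
  forall eps : R, (0 < eps)%R -> exists p, poly p /\ forall z, K z -> (Cmod (f z - p z) <= eps)%R.

Lemma poly_bounded (K : C -> Prop) (p : C -> C) : bounded K -> poly p ->
  exists B : R, (0 <= B)%R /\ forall z, K z -> (Cmod (p z) <= B)%R.
Proof.
  intros [B HB]. induction 1 as [c| |f g _ [B1 [P1 H1]] _ [B2 [P2 H2]]|f g _ [B1 [P1 H1]] _ [B2 [P2 H2]]].
  - exists (Cmod c). split; [apply Cmod_ge_0|]. intros; apply Rle_refl.
  - exists (Rmax 0 B). split; [apply Rmax_l|]. intros z Hz.
    eapply Rle_trans; [apply HB, Hz | apply Rmax_r].
  - exists (B1 + B2)%R. split; [lra|]. intros z Hz.
    eapply Rle_trans; [apply Cmod_triangle|]. apply Rplus_le_compat; auto.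
  - exists (B1 * B2)%R. split; [apply Rmult_le_pos; lra|]. intros z Hz. rewrite Cmod_mult.
    apply Rmult_le_compat; auto using Cmod_ge_0.
Qed.

Lemma UA_bounded (K : C -> Prop) (f : C -> C) : bounded K -> UA K f ->
  exists B : R, (0 <= B)%R /\ forall z, K z -> (Cmod (f z) <= B)%R.
Proof.
  intros HK Hf. destruct (Hf 1%R ltac:(lra)) as [p [Hp H]].
  destruct (poly_bounded K p HK Hp) as [B [HB0 HB]].
  exists (B + 1)%R. split; [lra|]. intros z Hz.
  eapply Rle_trans; [apply (Cmod_le_minus _ (p z))|]. specialize (H z Hz). specialize (HB z Hz). lra.
Qed.

Lemma UA_poly (K : C -> Prop) (p : C -> C) : poly p -> UA K p.
Proof.
  intros Hp eps He. exists p. split; [easy|]. intros z _.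
  replace (p z - p z) with (RtoC 0) by ring. rewrite Cmod_0. lra.
Qed.

Lemma UA_const (K : C -> Prop) (c : C) : UA K (fun _ => c).
Proof. apply UA_poly, poly_const. Qed.

Lemma UA_id (K : C -> Prop) : UA K (fun z => z).
Proof. apply UA_poly, poly_id. Qed.

Lemma UA_ext (K : C -> Prop) (f g : C -> C) : (forall z, K z -> f z = g z) -> UA K f -> UA K g.
Proof.
  intros E H eps He. destruct (H eps He) as [p [Hp Hd]]. exists p. split; [easy|].
  intros z Hz. rewrite <- E by easy. auto.
Qed.

Lemma UA_plus (K : C -> Prop) (f g : C -> C) : UA K f -> UA K g -> UA K (fun z => f z + g z).
Proof.
  intros Hf Hg eps He.
  destruct (Hf (eps / 2)%R ltac:(lra)) as [p [Hp Hd]].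
  destruct (Hg (eps / 2)%R ltac:(lra)) as [q [Hq Hd']].
  exists (fun z => p z + q z). split; [now apply poly_plus|]. intros z Hz.
  replace (f z + g z - (p z + q z)) with ((f z - p z) + (g z - q z)) by ring.
  eapply Rle_trans; [apply Cmod_triangle|]. specialize (Hd z Hz). specialize (Hd' z Hz). lra.
Qed.

Lemma UA_mult (K : C -> Prop) (f g : C -> C) : bounded K ->
  UA K f -> UA K g -> UA K (fun z => f z * g z).
Proof.
  intros HK Hf Hg eps He.
  destruct (UA_bounded K f HK Hf) as [A [HA0 HA]]. destruct (UA_bounded K g HK Hg) as [B [HB0 HB]].
  set (e := Rmin 1 (eps / (A + B + 1))).
  assert (He0 : (0 < e)%R) by (apply Rmin_pos; [lra | apply Rdiv_lt_0_compat; lra]).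
  assert (He1 : (e <= 1)%R) by apply Rmin_l.
  assert (He2 : (e * (A + B + 1) <= eps)%R).
  { apply Rle_trans with (eps / (A + B + 1) * (A + B + 1))%R.
    - apply Rmult_le_compat_r; [lra | apply Rmin_r].
    - apply Req_le. field. lra. }
  destruct (Hf e He0) as [p [Hp Hd]]. destruct (Hg e He0) as [q [Hq Hd']].
  exists (fun z => p z * q z). split; [now apply poly_mult|]. intros z Hz.
  replace (f z * g z - p z * q z) with (f z * (g z - q z) + (f z - p z) * q z) by ring.
  eapply Rle_trans; [apply Cmod_triangle|]. rewrite !Cmod_mult.
  specialize (Hd z Hz). specialize (Hd' z Hz). specialize (HA z Hz). specialize (HB z Hz).
  assert (Hqz : (Cmod (q z) <= B + 1)%R).
  { eapply Rle_trans; [apply (Cmod_le_minus _ (g z))|]. rewrite Cmod_minus_sym. lra. }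
  pose proof (Cmod_ge_0 (f z)). pose proof (Cmod_ge_0 (q z)).
  pose proof (Cmod_ge_0 (f z - p z)). pose proof (Cmod_ge_0 (g z - q z)).
  apply Rle_trans with (A * e + e * (B + 1))%R; [|lra].
  apply Rplus_le_compat; apply Rmult_le_compat; lra.
Qed.

Lemma UA_minus (K : C -> Prop) (f g : C -> C) : bounded K ->
  UA K f -> UA K g -> UA K (fun z => f z - g z).
Proof.
  intros HK Hf Hg. apply (UA_ext K (fun z => f z + (-1)%R * g z)).
  - intros z _. replace (RtoC (-1)) with (- RtoC 1) by (rewrite <- RtoC_opp; f_equal; ring). ring.
  - apply UA_plus; [easy|]. apply UA_mult; auto using UA_const.
Qed.

Lemma UA_pow (K : C -> Prop) (f : C -> C) (n : nat) : bounded K ->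
  UA K f -> UA K (fun z => f z ^ n).
Proof.
  intros HK Hf. induction n as [|n IH].
  - apply (UA_const K 1).
  - apply (UA_mult K f (fun z => f z ^ n)); auto.
Qed.

Lemma UA_csum (K : C -> Prop) (f : nat -> C -> C) (n : nat) :
  (forall i, UA K (f i)) -> UA K (fun z => csum (fun i => f i z) n).
Proof.
  intros Hf. induction n as [|n IH]; cbn [csum].
  - apply UA_const.
  - now apply UA_plus.
Qed.

Lemma UA_limit (K : C -> Prop) (f : C -> C) :
  (forall eps : R, (0 < eps)%R -> exists g, UA K g /\ forall z, K z -> (Cmod (f z - g z) <= eps)%R) ->
  UA K f.
Proof.
  intros H eps He. destruct (H (eps / 2)%R ltac:(lra)) as [g [Hg Hd]].
  destruct (Hg (eps / 2)%R ltac:(lra)) as [p [Hp Hd']].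
  exists p. split; [easy|]. intros z Hz.
  eapply Rle_trans; [apply (Cmod_minus_triangle _ (g z))|].
  specialize (Hd z Hz). specialize (Hd' z Hz). lra.
Qed.

Lemma UA_comp (K K' : C -> Prop) (f g : C -> C) : bounded K ->
  UA K' f -> UA K g -> (forall z, K z -> K' (g z)) -> UA K (fun z => f (g z)).
Proof.
  intros HK Hf Hg Hm. apply UA_limit. intros eps He.
  destruct (Hf eps He) as [p [Hp Hd]]. exists (fun z => p (g z)). split; [|auto].
  clear Hd. induction Hp; [apply UA_const | easy | now apply UA_plus | now apply UA_mult].
Qed.

Lemma UA_inv (B c : R) : (0 < c)%R ->
  UA (fun u => (Cmod u <= B)%R /\ (c <= Re u)%R) (fun u => / u).
Proof.
  intros Hc. apply UA_limit. intros eps He.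
  set (b := Rmax 1 B).
  assert (Hb : (1 <= b)%R) by apply Rmax_l. assert (HB : (B <= b)%R) by apply Rmax_r.
  (* With [A] large the region lies in a disc [|A - u| <= q A], [q < 1]. *)
  set (A := (b * b / c)%R).
  assert (HA : (0 < A)%R) by (apply Rdiv_lt_0_compat; nra).
  assert (HAc : (A * c = b * b)%R) by (unfold A; field; apply Rgt_not_eq, Hc).
  (* [A] is chosen so that |A - u|^2 = A^2 - 2 A Re u + |u|^2 is at most A^2 - 2 A c + b^2 = A^2 - A
     c. The approximants are partial sums of the geometric series 1/u = (1/A) sum (1 - u/A)^i. *)
  set (q := sqrt (1 - c / A)).
  assert (HcA : (0 < c / A)%R) by (apply Rdiv_lt_0_compat; lra).
  assert (Hq : (0 <= q < 1)%R).
  { split; [apply sqrt_pos|]. unfold q.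
    destruct (Rle_dec 0 (1 - c / A)) as [H|H].
    - apply Rlt_le_trans with (sqrt 1); [apply sqrt_lt_1; lra | rewrite sqrt_1; lra].
    (* Here [sqrt] takes its default value 0; this happens only for c > b, when the region is
       empty. *)
    - rewrite sqrt_neg_0; lra. }
  destruct (pow_lt_1_zero q ltac:(rewrite Rabs_pos_eq; lra) (eps * c)%R ltac:(nra)) as [n Hn].
  specialize (Hn n (Nat.le_refl n)). rewrite Rabs_pos_eq in Hn by (apply pow_le; lra).
  set (x := fun u : C => RtoC (/ A) * (RtoC A - u)).
  exists (fun u => RtoC (/ A) * csum (fun i => x u ^ i) n). split.
  - assert (HK : bounded (fun u => (Cmod u <= B)%R /\ (c <= Re u)%R)) by (exists B; tauto).
    apply UA_mult; [easy | apply UA_const|]. apply UA_csum. intros i. apply UA_pow; [easy|].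
    apply UA_mult; [easy | apply UA_const|]. apply UA_minus; auto using UA_const, UA_id.
  - intros u [Hu1 Hu2].
    assert (Hu0 : (c <= Cmod u)%R).
    { eapply Rle_trans; [exact Hu2|]. eapply Rle_trans; [apply Rle_abs | apply re_le_Cmod]. }
    assert (Hun : u <> 0) by (apply Cmod_gt_0; lra).
    assert (HAn : RtoC A <> 0) by (intros E; apply RtoC_inj in E; lra).
    assert (Hx : 1 - x u = RtoC (/ A) * u) by (unfold x; rewrite RtoC_inv by lra; field; auto).
    assert (E : / u - RtoC (/ A) * csum (fun i => x u ^ i) n = x u ^ n / u).
    { pose proof (csum_geom (x u) n) as G. rewrite Hx in G.
      replace (RtoC (/ A) * csum (fun i => x u ^ i) n)
        with ((RtoC (/ A) * u * csum (fun i => x u ^ i) n) / u) by (field; auto).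
      rewrite G. field. auto. }
    rewrite E, Cmod_div, Cmod_pow by easy.
    assert (Hxq : (Cmod (x u) <= q)%R).
    { unfold q. rewrite <- (sqrt_pow2 (Cmod (x u))) by apply Cmod_ge_0. apply sqrt_le_1_alt.
      unfold x. rewrite Cmod_mult, Cmod_RtoC_pos by (apply Rlt_le, Rinv_0_lt_compat; lra).
      rewrite Rpow_mult_distr, Cmod2_alt.
      change (Re (RtoC A - u)) with (A - Re u)%R. change (Im (RtoC A - u)) with (0 - Im u)%R.
      assert (Hm : (Re u ^ 2 + Im u ^ 2 <= b * b)%R).
      { rewrite <- Cmod2_alt. pose proof (Cmod_ge_0 u). nra. }
      apply Rmult_le_reg_l with (A ^ 2)%R; [nra|].
      replace (A ^ 2 * ((/ A) ^ 2 * ((A - Re u) ^ 2 + (0 - Im u) ^ 2)))%R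
        with (A ^ 2 - 2 * A * Re u + (Re u ^ 2 + Im u ^ 2))%R by (field; lra).
      replace (A ^ 2 * (1 - c / A))%R with (A ^ 2 - A * c)%R by (field; lra).
      nra. }
    assert (Hxn : (Cmod (x u) ^ n <= q ^ n)%R) by (apply pow_incr; split; [apply Cmod_ge_0 | easy]).
    apply Rmult_le_reg_r with (Cmod u); [lra|].
    unfold Rdiv. rewrite Rmult_assoc, Rinv_l, Rmult_1_r by lra. nra.
Qed.

Lemma UA_cexp (K : C -> Prop) : bounded K -> UA K cexp.
Proof.
  intros HK. pose proof HK as [B HB]. apply UA_limit. intros eps He.
  set (b := Rmax 0 B).
  assert (Hb : (0 <= b)%R) by apply Rmax_l. assert (HbB : (B <= b)%R) by apply Rmax_r.
  destruct (cv_speed_pow_fact b (eps / exp b)%R) as [n Hn].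
  { apply Rdiv_lt_0_compat; [easy | apply exp_pos]. }
  specialize (Hn n (Nat.le_refl n)). unfold Rdist in Hn. rewrite Rminus_0_r in Hn.
  exists (fun z => csum (fun j => RtoC (/ INR (fact j)) * z ^ j) n). split.
  - apply UA_csum. intros i. apply UA_mult; [easy | apply UA_const | apply UA_pow; auto using UA_id].
  - intros z Hz. eapply Rle_trans; [apply cexp_remainder|].
    specialize (HB z Hz).
    apply Rle_trans with (exp b * (b ^ n / INR (fact n)))%R.
    + apply Rmult_le_compat.
      * apply Rlt_le, exp_pos.
      * apply Rmult_le_pos; [apply pow_le, Cmod_ge_0 | apply Rlt_le, Rinv_0_lt_compat, INR_fact_lt_0].
      * apply exp_le. lra.
      * apply Rmult_le_compat_r; [apply Rlt_le, Rinv_0_lt_compat, INR_fact_lt_0|].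
        apply pow_incr. split; [apply Cmod_ge_0 | lra].
    + pose proof (Rle_abs (b ^ n / INR (fact n))) as Ha.
      apply Rle_trans with (exp b * (eps / exp b))%R.
      * apply Rmult_le_compat_l; [apply Rlt_le, exp_pos | lra].
      * apply Req_le. field. apply Rgt_not_eq, exp_pos.
Qed.

Lemma UA_cpow_pos (K : C -> Prop) (x : R) (f : C -> C) : bounded K -> UA K f ->
  UA K (fun z => cpow_pos x (f z)).
Proof.
  intros HK Hf.
  apply (UA_ext K (fun z => cexp (RtoC (ln x) * f z))); [intros; symmetry; apply cpow_pos_cexp|].
  assert (Hg : UA K (fun z => RtoC (ln x) * f z)) by (apply UA_mult; auto using UA_const).
  destruct (UA_bounded K _ HK Hg) as [B [_ HB]].
  apply (UA_comp K (fun z => (Cmod z <= B)%R)); [easy | apply UA_cexp; now exists B | easy | easy].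
Qed.

(** Each [zpartial] is a finite combination of exponentials, and the error in [zreg_zpartial] is
    uniform on the region, where |s| is bounded and [Re s] is bounded below. *)
Lemma UA_zreg (B c : R) : (0 < c)%R ->
  UA (fun s => (Cmod s <= B)%R /\ (c <= Re s)%R) zreg.
Proof.
  intros Hc. set (K := fun s : C => (Cmod s <= B)%R /\ (c <= Re s)%R).
  assert (HK : bounded K) by (exists B; intros z [H _]; exact H).
  apply UA_limit. intros eps He.
  set (b := Rmax 0 B).
  assert (Hb : (0 <= b)%R) by apply Rmax_l. assert (HbB : (B <= b)%R) by apply Rmax_r.
  set (M := (b * (b + 1) / c)%R).
  assert (HM : (0 <= M)%R) by (apply Rmult_le_pos; [nra | apply Rlt_le, Rinv_0_lt_compat; lra]).
  destruct (Rpower_neg_small c (eps / (M + 1))%R Hc) as [N HN]; [apply Rdiv_lt_0_compat; lra|].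
  specialize (HN N (Nat.le_refl N)).
  exists (fun s => zpartial s (S N)). split.
  - unfold zpartial. apply UA_plus; [apply UA_mult; [easy| |]|].
    + apply UA_minus; auto using UA_id, UA_const.
    + apply (UA_csum K (fun i s => cpow_pos (INR (S i)) (- s))). intros i. apply UA_cpow_pos; [easy|].
      apply (UA_ext K (fun z => 0 - z)); [intros; ring|]. apply UA_minus; auto using UA_id, UA_const.
    + apply UA_cpow_pos; [easy|]. apply UA_minus; auto using UA_id, UA_const.
  - intros s [Hs1 Hs2]. eapply Rle_trans; [apply zreg_zpartial; lra|].
    assert (Cmod (s - 1) <= b + 1)%R.
    { eapply Rle_trans; [apply Cmod_triangle|]. rewrite Cmod_opp, Cmod_1. lra. }
    pose proof (Cmod_ge_0 s). pose proof (Cmod_ge_0 (s - 1)).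
    apply Rle_trans with ((M + 1) * (eps / (M + 1)))%R; [|apply Req_le; field; lra].
    apply Rmult_le_compat.
    + apply Rmult_le_pos; [nra | apply Rlt_le, Rinv_0_lt_compat; lra].
    + apply Rlt_le, exp_pos.
    + apply Rle_trans with M; [|lra]. unfold M, Rdiv. apply Rmult_le_compat; [nra| |nra|].
      * apply Rlt_le, Rinv_0_lt_compat; lra.
      * apply Rinv_le_contravar; lra.
    + eapply Rle_trans; [|exact HN]. apply exp_le.
      assert (0 <= ln (INR (S N)))%R.
      { rewrite <- ln_1. apply Rcomplements.ln_le; [lra|]. rewrite S_INR. pose proof (pos_INR N). lra. }
      nra.
Qed.

(* [s = 1 / (1 + w)] maps the unit disc onto the half plane [Re s > 1/2], and
   [- zP w] is then [w * zeta s]. *)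
Definition zP (w : C) : C := (1 + w) * zreg (/ (1 + w)).

Lemma Re_inv (u : C) : Re (/ u) = (Re u / (Cmod u) ^ 2)%R.
Proof. rewrite Cmod2_alt. reflexivity. Qed.

Lemma UA_inv_comp (K : C -> Prop) (f : C -> C) (c : R) : bounded K -> (0 < c)%R ->
  UA K f -> (forall z, K z -> (c <= Re (f z))%R) -> UA K (fun z => / f z).
Proof.
  intros HK Hc Hf H. destruct (UA_bounded K f HK Hf) as [B [_ HB]].
  apply (UA_comp K _ _ f HK (UA_inv B c Hc) Hf). auto.
Qed.

Lemma UA_zP (K : C -> Prop) (f : C -> C) (c : R) : bounded K -> (0 < c)%R ->
  UA K f -> (forall z, K z -> (c - 1 <= Re (f z))%R) -> UA K (fun z => zP (f z)).
Proof.
  intros HK Hc Hf H. unfold zP.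
  assert (H1 : UA K (fun z => 1 + f z)) by (apply UA_plus; auto using UA_const).
  destruct (UA_bounded K _ HK H1) as [B [_ HB]].
  assert (Hre : forall z, K z -> (c <= Re (1 + f z))%R).
  { intros z Hz. specialize (H z Hz). change (Re (1 + f z)) with (1 + Re (f z))%R. lra. }
  assert (Hge : forall z, K z -> (c <= Cmod (1 + f z))%R).
  { intros z Hz. eapply Rle_trans; [apply Hre, Hz|]. eapply Rle_trans; [apply Rle_abs | apply re_le_Cmod]. }
  apply UA_mult; [easy | easy |].
  assert (HB1 : (0 < Rmax 1 B)%R) by (pose proof (Rmax_l 1 B); lra).
  (* Re (1/u) = Re u / |u|^2 is at least this number, so 1/(1 + w) stays in a region covered by
     [UA_zreg]. *)
  assert (Hc2 : (0 < c / Rmax 1 B ^ 2)%R) by (apply Rdiv_lt_0_compat; [easy | nra]).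
  apply (UA_comp K _ zreg _ HK (UA_zreg (/ c) (c / Rmax 1 B ^ 2) Hc2)).
  - apply (UA_inv_comp K _ c); auto.
  - intros z Hz. specialize (Hre z Hz). specialize (Hge z Hz). specialize (HB z Hz). split.
    + rewrite Cmod_inv by (apply Cmod_gt_0; lra). apply Rinv_le_contravar; lra.
    + rewrite Re_inv. unfold Rdiv. pose proof (Rmax_r 1 B).
      apply Rmult_le_compat; [lra | apply Rlt_le, Rinv_0_lt_compat; nra | easy |].
      apply Rinv_le_contravar; [nra|]. apply pow_incr. lra.
Qed.

(** * Power series of uniform limits of polynomials *)

Definition evalp (q : nat -> C) (n : nat) (h : C) : C := csum (fun j => q j * h ^ j) n.

Definition vanish (q : nat -> C) (n : nat) : Prop := forall j, (n <= j)%nat -> q j = 0.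

Lemma evalp_extend (q : nat -> C) (n m : nat) (h : C) :
  vanish q n -> (n <= m)%nat -> evalp q m h = evalp q n h.
Proof.
  intros Hq Hm. apply csum_extend; [easy|]. intros i Hi. rewrite Hq by easy. ring.
Qed.

Definition has_coeffs (f : C -> C) : Prop :=
  exists q n, vanish q n /\ forall h, f h = evalp q n h.

Lemma has_coeffs_plus (f g : C -> C) :
  has_coeffs f -> has_coeffs g -> has_coeffs (fun h => f h + g h).
Proof.
  intros [q [n [Hq Ef]]] [r [m [Hr Eg]]].
  exists (fun j => q j + r j), (n + m)%nat. split.
  - intros j Hj. rewrite Hq, Hr by lia. ring.
  - intros h. rewrite Ef, Eg.
    rewrite <- (evalp_extend q n (n + m)), <- (evalp_extend r m (n + m)) by (auto; lia).
    unfold evalp. rewrite <- csum_plus. apply csum_ext. intros; ring.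
Qed.

Lemma has_coeffs_monomial (f : C -> C) (c : C) (k : nat) :
  has_coeffs f -> has_coeffs (fun h => c * h ^ k * f h).
Proof.
  intros [q [n [Hq Ef]]].
  exists (fun j => if (j <? k)%nat then RtoC 0 else c * q (j - k)%nat), (k + n)%nat. split.
  - intros j Hj. destruct (Nat.ltb_spec j k); [easy|]. rewrite Hq by lia. ring.
  - intros h. rewrite Ef. unfold evalp. rewrite csum_app.
    rewrite (csum_zero (fun j => (if (j <? k)%nat then RtoC 0 else c * q (j - k)%nat) * h ^ j) k).
    + rewrite Cplus_0_l, <- csum_mult_l. apply csum_ext. intros i Hi.
      destruct (Nat.ltb_spec (k + i) k); [lia|].
      replace (k + i - k)%nat with i by lia. rewrite Cpow_add_r. ring.
    + intros i Hi. destruct (Nat.ltb_spec i k); [ring | lia].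
Qed.

Lemma has_coeffs_ext (f g : C -> C) : (forall h, f h = g h) -> has_coeffs f -> has_coeffs g.
Proof. intros E [q [n [Hq Ef]]]. exists q, n. split; [easy|]. intros; now rewrite <- E. Qed.

Lemma has_coeffs_const (c : C) : has_coeffs (fun _ => c).
Proof.
  exists (fun j => match j with O => c | _ => RtoC 0 end), 1%nat. split.
  - intros [|j] Hj; [lia | easy].
  - intros h. unfold evalp. cbn [csum Cpow]. ring.
Qed.

Lemma has_coeffs_mult (f g : C -> C) :
  has_coeffs f -> has_coeffs g -> has_coeffs (fun h => f h * g h).
Proof.
  intros [q [n [_ Ef]]] Hg.
  apply (has_coeffs_ext (fun h => evalp q n h * g h)); [intros; now rewrite Ef|].
  clear f Ef. unfold evalp. induction n as [|n IH]; cbn [csum].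
  - apply (has_coeffs_ext (fun _ => RtoC 0)); [intros; ring | apply has_coeffs_const].
  - apply (has_coeffs_ext (fun h => csum (fun j => q j * h ^ j) n * g h + q n * h ^ n * g h)); [intros; ring|].
    apply has_coeffs_plus; [easy | now apply has_coeffs_monomial].
Qed.

Lemma poly_has_coeffs (p : C -> C) : poly p -> has_coeffs p.
Proof.
  induction 1.
  - apply has_coeffs_const.
  - apply (has_coeffs_ext (fun h => 1 * h ^ 1 * 1)); [intros; cbn [Cpow]; ring|].
    apply has_coeffs_monomial, has_coeffs_const.
  - now apply has_coeffs_plus.
  - now apply has_coeffs_mult.
Qed.

(** * Roots of unity, the Cauchy estimate and Parseval's identity *)

Definition root1 (N : nat) : C := cexp (0, 2 * PI / INR N)%R.

Lemma Cmod_root1 (N m : nat) : Cmod (root1 N ^ m) = 1%R.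
Proof. unfold root1. rewrite Cmod_pow, Cmod_cexp. simpl. rewrite exp_0. apply pow1. Qed.

Lemma cexp_2PI : cexp (0, 2 * PI)%R = 1.
Proof. unfold cexp; simpl. rewrite exp_0, cos_2PI, sin_2PI. unfold RtoC. f_equal; ring. Qed.

Lemma root1_pow_N (N : nat) : (0 < N)%nat -> root1 N ^ N = 1.
Proof.
  intros HN. unfold root1. rewrite cexp_pow, <- cexp_2PI. f_equal.
  assert (INR N <> 0%R) by (apply not_0_INR; lia).
  apply injective_projections; simpl; field; easy.
Qed.

Lemma cexp_i_neq_1 (x : R) : (0 < Rabs x < 2 * PI)%R -> cexp (0, x)%R <> 1.
Proof.
  intros Hx E. pose proof (f_equal Re E) as M. unfold cexp in M. simpl in M.
  rewrite exp_0, Rmult_1_l in M.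
  replace x with (2 * (x / 2))%R in M by field. rewrite cos_2a_sin in M.
  assert (Hs : (sin (x / 2) = 0)%R) by nra.
  destruct (Rcase_abs x) as [Hn|Hp].
  - rewrite Rabs_left in Hx by easy.
    assert (0 < sin (- (x / 2)))%R by (apply sin_gt_0; lra). rewrite sin_neg in H. lra.
  - rewrite Rabs_right in Hx by easy.
    assert (0 < sin (x / 2))%R by (apply sin_gt_0; lra). lra.
Qed.

Lemma Cconj_cexp (z : C) : Cconj (cexp z) = cexp (Cconj z).
Proof.
  unfold Cconj, cexp, Re, Im; cbn [fst snd]. rewrite cos_neg, sin_neg. f_equal. ring.
Qed.

(** A geometric sum whose ratio x is the (a - b)-th power of [root1 N], the conjugate serving as
    inverse. Its N-th power is 1, and x itself is 1 only for a = b because |a - b| < N. *)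
Lemma root1_orthogonal (N a b : nat) : (a < N)%nat -> (b < N)%nat ->
  csum (fun m => (root1 N ^ m) ^ a * Cconj ((root1 N ^ m) ^ b)) N
  = if Nat.eq_dec a b then RtoC (INR N) else 0.
Proof.
  intros Ha Hb.
  set (x := root1 N ^ a * Cconj (root1 N ^ b)).
  assert (Ex : forall m, (root1 N ^ m) ^ a * Cconj ((root1 N ^ m) ^ b) = x ^ m).
  { intros m. unfold x. rewrite Cpow_mult_l, <- Cpow_conj, <- !Cpow_mult_r.
    rewrite (Nat.mul_comm m a), (Nat.mul_comm m b). reflexivity. }
  rewrite (csum_ext _ (fun m => x ^ m)) by (intros; apply Ex).
  assert (HNr : (0 < INR N)%R) by (apply lt_0_INR; lia).
  destruct (Nat.eq_dec a b) as [->|Hab].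
  - assert (Hx : x = 1).
    { unfold x. rewrite <- Cmod2_conj, Cmod_root1. f_equal. ring. }
    rewrite (csum_ext _ (fun _ => RtoC 1)) by (intros; rewrite Hx; apply Cpow_1_l).
    rewrite csum_const. ring.
  - assert (Hx1 : x <> 1).
    { assert (E : x = cexp (0, (INR a - INR b) * (2 * PI / INR N))%R).
      { unfold x, root1. rewrite !cexp_pow, Cconj_cexp, <- cexp_plus. f_equal.
        apply injective_projections; simpl; field; lra. }
      rewrite E. apply cexp_i_neq_1. pose proof PI_RGT_0 as HPI.
      rewrite Rabs_mult, (Rabs_pos_eq (2 * PI / INR N)) by (apply Rlt_le, Rdiv_lt_0_compat; lra).
      assert (Hab' : (0 < Rabs (INR a - INR b) < INR N)%R).
      { apply lt_INR in Ha, Hb. pose proof (pos_INR a). pose proof (pos_INR b).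
        split; [apply Rabs_pos_lt; intros E0; apply Hab, INR_eq; lra | apply Rabs_def1; lra]. }
      split.
      - apply Rmult_lt_0_compat; [lra | apply Rdiv_lt_0_compat; lra].
      - replace (2 * PI)%R with (INR N * (2 * PI / INR N))%R at 2 by (field; lra).
        apply Rmult_lt_compat_r; [apply Rdiv_lt_0_compat; lra | lra]. }
    assert (HxN : x ^ N = 1).
    { unfold x. rewrite Cpow_mult_l, <- (Cpow_conj (root1 N ^ b)), <- !Cpow_mult_r.
      rewrite (Nat.mul_comm a N), (Nat.mul_comm b N), !Cpow_mult_r, root1_pow_N by lia.
      rewrite !Cpow_1_l. unfold Cconj, RtoC, Cmult; simpl. f_equal; ring. }
    pose proof (csum_geom x N) as G. rewrite HxN in G.
    assert (Hd : 1 - x <> 0).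
    { intros E. apply Hx1. replace x with (1 - (1 - x)) by ring. rewrite E. ring. }
    replace (csum (fun m => x ^ m) N) with (((1 - x) * csum (fun i => x ^ i) N) / (1 - x)) by (field; auto).
    rewrite G. field. auto.
Qed.

(** Discrete Cauchy formula: averaging against a conjugate power isolates one coefficient. With
    [n <= N] distinct exponents below n stay distinct modulo N. *)
Lemma root1_coeff (q : nat -> C) (n N j : nat) (r : R) : (j < n)%nat -> (n <= N)%nat ->
  csum (fun m => evalp q n (RtoC r * root1 N ^ m) * Cconj ((root1 N ^ m) ^ j)) N
  = RtoC (INR N) * (q j * RtoC r ^ j).
Proof.
  intros Hj Hn. unfold evalp.
  rewrite (csum_ext _ (fun m => csum (fun i => q i * RtoC r ^ i
     * ((root1 N ^ m) ^ i * Cconj ((root1 N ^ m) ^ j))) n)).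
  - rewrite csum_swap.
    rewrite (csum_ext _ (fun i => q i * RtoC r ^ i * if Nat.eq_dec i j then RtoC (INR N) else 0)).
    + rewrite (csum_single _ _ j Hj).
      * destruct (Nat.eq_dec j j); [ring | easy].
      * intros i _ Hi. destruct (Nat.eq_dec i j); [easy | ring].
    + intros i Hi. rewrite csum_mult_l, root1_orthogonal by lia. reflexivity.
  - intros m _. rewrite Cmult_comm, <- csum_mult_l. apply csum_ext. intros i _.
    rewrite Cpow_mult_l. ring.
Qed.

Lemma cauchy_estimate (q : nat -> C) (n j : nat) (r M : R) : (0 <= r)%R -> (j < n)%nat ->
  (forall z, Cmod z = r -> (Cmod (evalp q n z) <= M)%R) -> (Cmod (q j) * r ^ j <= M)%R.
Proof.
  intros Hr Hj HM.
  assert (Hn : (0 < INR n)%R) by (apply lt_0_INR; lia).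
  pose proof (root1_coeff q n n j r Hj (Nat.le_refl n)) as E.
  assert (H : (Cmod (RtoC (INR n) * (q j * RtoC r ^ j)) <= INR n * M)%R).
  { rewrite <- E, <- rsum_const. apply Cmod_csum_le. intros m _.
    rewrite Cmod_mult, Cmod_conj, Cmod_pow, Cmod_root1, pow1, Rmult_1_r.
    apply HM. rewrite Cmod_mult, Cmod_root1, Cmod_RtoC_pos by easy. ring. }
  rewrite !Cmod_mult, Cmod_pow, !Cmod_RtoC_pos in H by lra.
  apply Rmult_le_reg_l in H; auto.
Qed.

Lemma RtoC_rsum (f : nat -> R) (n : nat) : RtoC (rsum f n) = csum (fun i => RtoC (f i)) n.
Proof. induction n as [|n IH]; simpl; [easy|]. rewrite <- IH. apply RtoC_plus. Qed.

Lemma Cconj_csum (f : nat -> C) (n : nat) : Cconj (csum f n) = csum (fun i => Cconj (f i)) n.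
Proof.
  induction n as [|n IH]; cbn [csum].
  - unfold Cconj, RtoC; simpl. f_equal. ring.
  - rewrite <- IH. apply Cplus_conj.
Qed.

(** Only the conjugate factor of |p|^2 is expanded; each of its terms then meets the whole
    polynomial in [root1_coeff] with radius 1. *)
Lemma parseval (q : nat -> C) (n N : nat) : (n <= N)%nat ->
  rsum (fun m => Cmod (evalp q n (root1 N ^ m)) ^ 2)%R N
  = (INR N * rsum (fun j => Cmod (q j) ^ 2) n)%R.
Proof.
  intros Hn. apply RtoC_inj. rewrite RtoC_mult, !RtoC_rsum.
  rewrite (csum_ext _ (fun m => csum (fun j => Cconj (q j) *
     (evalp q n (RtoC 1 * root1 N ^ m) * Cconj ((root1 N ^ m) ^ j))) n)).
  - rewrite csum_swap, <- csum_mult_l. apply csum_ext. intros j Hj.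
    rewrite csum_mult_l, root1_coeff, Cmod2_conj, Cpow_1_l by easy. ring.
  - intros m _. rewrite Cmult_1_l, Cmod2_conj. unfold evalp at 2.
    rewrite Cconj_csum, <- csum_mult_l. apply csum_ext. intros j _.
    rewrite Cmult_conj. ring.
Qed.

(** * Coefficients obtained from polynomial approximants *)

Definition close_on (r eps : R) (f : C -> C) (q : nat -> C) (n : nat) : Prop :=
  vanish q n /\ forall h, (Cmod h <= r)%R -> (Cmod (f h - evalp q n h) <= eps)%R.

Lemma UA_close_on (f : C -> C) (r eps : R) : (0 < eps)%R ->
  UA (fun h => (Cmod h <= r)%R) f -> exists q n, close_on r eps f q n.
Proof.
  intros He Hf. destruct (Hf eps He) as [p [Hp H]].
  destruct (poly_has_coeffs p Hp) as [q [n [Hq E]]]. exists q, n. split; [easy|].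
  intros h Hh. rewrite <- E. auto.
Qed.

Lemma close_on_coeff (f : C -> C) (r e1 e2 : R) (q1 q2 : nat -> C) (n1 n2 j : nat) : (0 <= r)%R ->
  close_on r e1 f q1 n1 -> close_on r e2 f q2 n2 ->
  (Cmod (q1 j - q2 j) * r ^ j <= e1 + e2)%R.
Proof.
  intros Hr [V1 H1] [V2 H2].
  (* Padding by [S j] puts the index j in range even when both approximants are shorter. *)
  apply (cauchy_estimate (fun j => q1 j - q2 j) (n1 + n2 + S j)); [easy | lia|].
  intros z Hz.
  replace (evalp (fun j => q1 j - q2 j) (n1 + n2 + S j) z) with (evalp q1 n1 z - evalp q2 n2 z).
  - specialize (H1 z ltac:(lra)). specialize (H2 z ltac:(lra)).
    eapply Rle_trans; [apply (Cmod_minus_triangle _ (f z))|]. rewrite Cmod_minus_sym. lra.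
  - rewrite <- (evalp_extend q1 n1 (n1 + n2 + S j)), <- (evalp_extend q2 n2 (n1 + n2 + S j)) by (auto; lia).
    unfold evalp. rewrite <- csum_minus. apply csum_ext. intros; ring.
Qed.

(** The maximum principle at the centre of a disc, from the Cauchy estimate for the constant
    coefficient of an approximating polynomial. *)
Lemma UA_center (f : C -> C) (r M : R) : (0 <= r)%R ->
  UA (fun h => (Cmod h <= r)%R) f -> (forall h, Cmod h = r -> (Cmod (f h) <= M)%R) ->
  (Cmod (f 0) <= M)%R.
Proof.
  intros Hr Hf HM. apply le_epsilon. intros eps He.
  destruct (UA_close_on f r (eps / 2) ltac:(lra) Hf) as [q [n [V H]]].
  assert (E0 : evalp q (S n) 0 = q 0%nat).
  { unfold evalp. rewrite (csum_single _ _ 0%nat); [cbn [Cpow]; ring | lia|].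
    intros i _ Hi. destruct i; [lia|]. rewrite Cpow_S. ring. }
  assert (H0 : (Cmod (q 0%nat) * r ^ 0 <= M + eps / 2)%R).
  { apply (cauchy_estimate q (S n)); [easy | lia|]. intros z Hz.
    rewrite (evalp_extend q n (S n)) by (auto; lia).
    eapply Rle_trans; [apply (Cmod_le_minus _ (f z))|]. rewrite Cmod_minus_sym.
    apply Rplus_le_compat; [auto | apply H; lra]. }
  simpl in H0. rewrite Rmult_1_r in H0.
  specialize (H 0 ltac:(rewrite Cmod_0; lra)).
  rewrite <- (evalp_extend q n (S n)), E0 in H by (auto; lia).
  eapply Rle_trans; [apply (Cmod_le_minus _ (q 0%nat))|]. lra.
Qed.

Lemma Rinv_INR_small (eps : R) : (0 < eps)%R ->
  exists N : nat, forall n, (N <= n)%nat -> (/ INR (S n) <= eps)%R.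
Proof.
  intros He. destruct (INR_unbounded (/ eps)) as [N HN]. exists N. intros n Hn.
  rewrite <- (Rinv_inv eps). apply Rinv_le_contravar; [now apply Rinv_0_lt_compat|].
  apply le_INR in Hn. rewrite S_INR. lra.
Qed.

Lemma functional_choice {A B : Type} (P : A -> B -> Prop) :
  (forall x, exists y, P x y) -> exists f : A -> B, forall x, P x (f x).
Proof.
  intros H. exists (fun x => proj1_sig (constructive_indefinite_description _ (H x))).
  intros x. exact (proj2_sig (constructive_indefinite_description _ (H x))).
Qed.

(** The coefficient is the limit of the j-th coefficients of approximants on the disc of radius 1/2.
    That one number serves every radius r follows by comparison with an approximant on the larger of
    the two discs. *)
Lemma UA_coeff_exists (f : C -> C) (j : nat) :
  (forall r, (0 < r < 1)%R -> UA (fun h => (Cmod h <= r)%R) f) ->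
  exists c : C, forall r eps q n, (0 < r < 1)%R ->
    close_on r eps f q n -> (Cmod (c - q j) * r ^ j <= eps)%R.
Proof.
  intros Hf.
  assert (Hpos : forall k, (0 < / INR (S k))%R) by (intros; apply Rinv_0_lt_compat, lt_0_INR; lia).
  destruct (functional_choice (fun (k : nat) (qn : (nat -> C) * nat) =>
      close_on (1 / 2) (/ INR (S k)) f (fst qn) (snd qn))) as [u Hu].
  { intros k. destruct (UA_close_on f (1 / 2) (/ INR (S k)) (Hpos k) (Hf (1 / 2)%R ltac:(lra))) as [q [n H]].
    now exists (q, n). }
  assert (Hh : (0 < (1 / 2) ^ j)%R) by (apply pow_lt; lra).
  pose proof (Clim_cauchy (fun k => fst (u k) j)) as L.
  set (c := (real (Lim_seq (fun n => Re (fst (u n) j))), real (Lim_seq (fun n => Im (fst (u n) j))))) in L.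
  assert (Lc : Clim (fun k => fst (u k) j) c).
  { apply L. intros eps He.
    destruct (Rinv_INR_small (eps / 2 * (1 / 2) ^ j)) as [N HN]; [apply Rmult_lt_0_compat; lra|].
    exists N. intros n m Hn Hm.
    pose proof (close_on_coeff f (1 / 2) _ _ _ _ _ _ j ltac:(lra) (Hu n) (Hu m)) as H.
    pose proof (HN n Hn). pose proof (HN m Hm).
    apply Rmult_le_reg_r with ((1 / 2) ^ j)%R; [easy|]. lra. }
  exists c. intros r eps q n Hr Hq.
  apply le_epsilon. intros e He.
  (* Chosen so that the errors d, from radius r, and d 2^j, from radius 1/2, add up to e. *)
  set (d := (e * (/ (1 + / (1 / 2) ^ j)))%R).
  assert (Hi : (0 < / (1 / 2) ^ j)%R) by (apply Rinv_0_lt_compat; easy).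
  assert (Hd : (0 < d)%R) by (apply Rmult_lt_0_compat; [easy | apply Rinv_0_lt_compat; lra]).
  assert (Hd2 : (d * (1 + / (1 / 2) ^ j) = e)%R).
  { unfold d. rewrite Rmult_assoc, Rinv_l by lra. ring. }
  pose proof (Rmax_l r (1 / 2)) as Hr1. pose proof (Rmax_r r (1 / 2)) as Hr2.
  assert (Hr3 : (Rmax r (1 / 2) < 1)%R) by (apply Rmax_lub_lt; lra).
  destruct (UA_close_on f (Rmax r (1 / 2)) d Hd (Hf (Rmax r (1 / 2)) ltac:(lra))) as [q' [n' [V' H']]].
  assert (C1 : close_on r d f q' n') by (split; [easy | intros; apply H'; lra]).
  assert (C2 : close_on (1 / 2) d f q' n') by (split; [easy | intros; apply H'; lra]).
  pose proof (close_on_coeff f r _ _ _ _ _ _ j ltac:(lra) C1 Hq) as A1.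
  assert (A2 : (Cmod (c - q' j) * (1 / 2) ^ j <= d)%R).
  { apply le_epsilon. intros e' He'.
    destruct (Rinv_INR_small e' He') as [N HN].
    apply Rmult_le_reg_r with (/ (1 / 2) ^ j)%R; [easy|].
    rewrite Rmult_assoc, Rinv_r, Rmult_1_r by lra.
    apply (Clim_bound _ _ _ _ N Lc). intros k Hk.
    pose proof (close_on_coeff f (1 / 2) _ _ _ _ _ _ j ltac:(lra) (Hu k) C2) as H.
    apply Rmult_le_reg_r with ((1 / 2) ^ j)%R; [easy|].
    rewrite Rmult_assoc, Rinv_l, Rmult_1_r by lra. specialize (HN k Hk). lra. }
  assert (A3 : (Cmod (c - q' j) * r ^ j <= d * / (1 / 2) ^ j)%R).
  { assert (r ^ j <= 1)%R by (rewrite <- (pow1 j); apply pow_incr; lra).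
    apply Rle_trans with (Cmod (c - q' j)).
    - pose proof (Cmod_ge_0 (c - q' j)). nra.
    - apply Rmult_le_reg_r with ((1 / 2) ^ j)%R; [easy|].
      rewrite Rmult_assoc, Rinv_l, Rmult_1_r by lra. exact A2. }
  assert (0 < r ^ j)%R by (apply pow_lt; lra).
  pose proof (Cmod_minus_triangle c (q' j) (q j)). nra.
Qed.

(** At a radius r between |h| and 1 an approximant has coefficient errors of at most d r^(-j);
    against |h|^j they sum to a geometric series. The first conclusion is exported because it later
    transfers bounds from approximants to coefficients. *)
Lemma UA_power_series (f : C -> C) :
  (forall r, (0 < r < 1)%R -> UA (fun h => (Cmod h <= r)%R) f) ->
  exists c : nat -> C,
    (forall r eps q n j, (0 < r < 1)%R -> close_on r eps f q n -> (Cmod (c j - q j) * r ^ j <= eps)%R)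
    /\ forall h, (Cmod h < 1)%R -> Clim (fun n => evalp c n h) (f h).
Proof.
  intros Hf.
  destruct (functional_choice (fun (j : nat) (c : C) => forall r eps q n, (0 < r < 1)%R ->
    close_on r eps f q n -> (Cmod (c - q j) * r ^ j <= eps)%R)) as [c Hc].
  { intros j. now apply UA_coeff_exists. }
  exists c. split; [intros; eapply Hc; eauto|].
  intros h Hh eps He. pose proof (Cmod_ge_0 h) as Hh0.
  set (r := ((1 + Cmod h) / 2)%R). assert (Hr : (0 < r < 1)%R) by (unfold r; lra).
  assert (Hhr : (Cmod h < r)%R) by (unfold r; lra).
  set (x := (Cmod h / r)%R).
  assert (Hx : (0 <= x < 1)%R).
  { unfold x. split; [apply Rmult_le_pos; [easy | apply Rlt_le, Rinv_0_lt_compat; lra]|].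
    apply Rmult_lt_reg_r with r; [lra|]. unfold Rdiv. rewrite Rmult_assoc, Rinv_l by lra. lra. }
  assert (Hi : (0 < / (1 - x))%R) by (apply Rinv_0_lt_compat; lra).
  set (d := (eps * / (1 + / (1 - x)))%R).
  assert (Hd : (0 < d)%R) by (apply Rmult_lt_0_compat; [easy | apply Rinv_0_lt_compat; lra]).
  assert (Hd2 : (d * (1 + / (1 - x)) = eps)%R) by (unfold d; rewrite Rmult_assoc, Rinv_l by lra; ring).
  destruct (UA_close_on f r d Hd (Hf r Hr)) as [q [n Hq]].
  exists n. intros N HN. destruct (Hq) as [V H]. specialize (H h ltac:(lra)).
  rewrite <- (evalp_extend q n N) in H by auto.
  eapply Rle_trans; [apply (Cmod_minus_triangle _ (evalp q N h))|].
  rewrite (Cmod_minus_sym (evalp q N h)).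
  assert (Cmod (evalp c N h - evalp q N h) <= d * / (1 - x))%R.
  { unfold evalp. rewrite <- csum_minus.
    apply Rle_trans with (rsum (fun j => d * x ^ j)%R N).
    - apply Cmod_csum_le. intros j _.
      replace (c j * h ^ j - q j * h ^ j) with ((c j - q j) * h ^ j) by ring.
      rewrite Cmod_mult, Cmod_pow.
      replace (Cmod h) with (r * x)%R by (unfold x; field; lra).
      rewrite Rpow_mult_distr, <- Rmult_assoc.
      apply Rmult_le_compat_r; [apply pow_le; lra|]. eapply Hc; eauto.
    - rewrite rsum_mult_l. apply Rmult_le_compat_l; [lra|]. now apply rsum_geom_le. }
  lra.
Qed.

(** * The Fatou-Riesz theorem *)

Definition tends0 (a : nat -> C) : Prop :=
  forall eps : R, (0 < eps)%R -> exists N, forall n, (N <= n)%nat -> (Cmod (a n) <= eps)%R.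

Lemma evalp_app (a : nat -> C) (n m : nat) (v : C) :
  evalp a (n + m) v = evalp a n v + csum (fun i => a (n + i)%nat * v ^ (n + i)) m.
Proof. unfold evalp. apply csum_app. Qed.

(* On the circle [|h| = d], [h^2 + d^2 (1 + h) = (|1 + h|^2 - 1) h]: the multiplier
   vanishes exactly where the circle crosses the unit circle. *)
Lemma riesz_multiplier (h : C) (d : R) : Cmod h = d ->
  Cmod (h ^ 2 + RtoC (d ^ 2) * (1 + h)) = (d * Rabs (Cmod (1 + h) ^ 2 - 1))%R.
Proof.
  intros <-.
  replace (h ^ 2 + RtoC (Cmod h ^ 2) * (1 + h)) with (RtoC (Cmod (1 + h) ^ 2 - 1) * h).
  - rewrite Cmod_mult, Cmod_R. ring.
  - rewrite !Cmod2_alt. destruct h as [x y]. apply injective_projections; simpl; ring.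
Qed.

(** Bernoulli's inequality x^n >= 1 + n(x - 1). It turns a fixed bound M outside the unit disc into
    a contribution of order M/n. *)
Lemma bernoulli_quotient (x : R) (n : nat) : (1 < x)%R -> (0 < n)%nat ->
  ((x - 1) / x ^ n <= / INR n)%R.
Proof.
  intros Hx Hn. assert (Hn' : (0 < INR n)%R) by now apply lt_0_INR.
  pose proof (Rfunctions.poly n (x - 1) ltac:(lra)) as H.
  replace (1 + (x - 1))%R with x in H by ring.
  assert (Hp : (0 < x ^ n)%R) by (apply pow_lt; lra).
  apply Rmult_le_reg_r with (x ^ n)%R; [easy|].
  unfold Rdiv. rewrite Rmult_assoc, Rinv_l, Rmult_1_r by lra.
  apply Rmult_le_reg_l with (INR n); [easy|].
  rewrite <- Rmult_assoc, Rinv_r by lra. lra.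
Qed.

Lemma riesz_inside (f : C -> C) (a : nat -> C) (v : C) (n : nat) (e : R) :
  Clim (fun n => evalp a n v) (f v) -> (Cmod v < 1)%R ->
  (forall j, (n <= j)%nat -> (Cmod (a j) <= e)%R) ->
  (Cmod (f v - evalp a n v) <= e * Cmod v ^ n / (1 - Cmod v))%R.
Proof.
  intros Hf Hv Ha. pose proof (Cmod_ge_0 v) as Hv0.
  assert (He : (0 <= e)%R) by (eapply Rle_trans; [apply Cmod_ge_0 | apply (Ha n); lia]).
  apply (Clim_bound _ _ _ _ n Hf). intros N HN.
  replace N with (n + (N - n))%nat by lia. rewrite evalp_app.
  replace (evalp a n v + csum (fun i => a (n + i)%nat * v ^ (n + i)) (N - n) - evalp a n v)
    with (csum (fun i => a (n + i)%nat * v ^ (n + i)) (N - n)) by ring.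
  eapply Rle_trans; [apply (Cmod_csum_le _ (fun i => e * Cmod v ^ n * Cmod v ^ i)%R)|].
  - intros i _. rewrite Cmod_mult, Cmod_pow, pow_add, Rmult_assoc.
    apply Rmult_le_compat_r; [apply Rmult_le_pos; apply pow_le; easy | apply Ha; lia].
  - rewrite rsum_mult_l. apply Rmult_le_compat_l; [|apply rsum_geom_le; lra].
    apply Rmult_le_pos; [easy | apply pow_le; easy].
Qed.

(** Outside the unit disc the series need not converge, so the remainder at the fixed index [n0] is
    merely bounded; the terms from [n0] to n are dominated by a geometric sum of ratio above 1,
    hence by its upper end. *)
Lemma riesz_outside (f : C -> C) (a : nat -> C) (v : C) (n0 n : nat) (e M : R) : (1 < Cmod v)%R -> (n0 <= n)%nat ->
  (forall j, (n0 <= j)%nat -> (Cmod (a j) <= e)%R) -> (Cmod (f v - evalp a n0 v) <= M)%R ->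
  (Cmod (f v - evalp a n v) <= M + e * Cmod v ^ n / (Cmod v - 1))%R.
Proof.
  intros Hv Hn Ha HM.
  assert (He : (0 <= e)%R) by (eapply Rle_trans; [apply Cmod_ge_0 | apply (Ha n); lia]).
  eapply Rle_trans; [apply (Cmod_minus_triangle _ (evalp a n0 v))|].
  apply Rplus_le_compat; [easy|]. rewrite Cmod_minus_sym.
  replace n with (n0 + (n - n0))%nat at 1 by lia. rewrite evalp_app.
  replace (evalp a n0 v + csum (fun i => a (n0 + i)%nat * v ^ (n0 + i)) (n - n0) - evalp a n0 v)
    with (csum (fun i => a (n0 + i)%nat * v ^ (n0 + i)) (n - n0)) by ring.
  eapply Rle_trans; [apply (Cmod_csum_le _ (fun i => e * Cmod v ^ n0 * Cmod v ^ i)%R)|].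
  - intros i _. rewrite Cmod_mult, Cmod_pow, pow_add, Rmult_assoc.
    apply Rmult_le_compat_r; [apply Rmult_le_pos; apply pow_le; lra | apply Ha; lia].
  - rewrite rsum_mult_l.
    replace n with (n0 + (n - n0))%nat at 2 by lia. rewrite pow_add.
    apply Rle_trans with (e * Cmod v ^ n0 * (Cmod v ^ (n - n0) / (Cmod v - 1)))%R.
    + apply Rmult_le_compat_l; [|now apply rsum_geom_le_gt1].
      apply Rmult_le_pos; [easy | apply pow_le; lra].
    + apply Req_le. unfold Rdiv. ring.
Qed.

(** The maximum principle on the circle |h| = d for the remainder divided by v^n, where v = 1 + h.
    That quotient is at most e/|1 - |v|| inside the unit disc, and the same plus M/|v|^n outside.
    The multiplier cancels the singularity at the points where the circle crosses the unit circle,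
    and equals d^2 at the centre. *)
Lemma fatou_riesz_at_1 (f : C -> C) (a : nat -> C) (d : R) : (0 < d <= 1 / 2)%R ->
  (forall v, (Cmod v < 1)%R -> Clim (fun n => evalp a n v) (f v)) ->
  UA (fun h => (Cmod h <= d)%R) (fun h => f (1 + h)) ->
  tends0 a -> Clim (fun n => evalp a n 1) (f 1).
Proof.
  intros Hd Hf HUA Ha eps Heps.
  set (K := fun h : C => (Cmod h <= d)%R).
  assert (HK : bounded K) by (exists d; easy).
  (* On the circle |v| <= 3/2, so the outer part is at most d (|v| + 1) 2e <= 5 d e. Division by d^2
     at the centre leaves 5 e / d = eps. *)
  set (e := (eps * d / 5)%R).
  assert (He : (0 < e)%R) by (unfold e; nra).
  destruct (Ha e He) as [n0 Hn0].
  assert (UAe : forall n, UA K (fun h => evalp a n (1 + h))).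
  { intros n. apply (UA_csum K (fun j h => a j * (1 + h) ^ j)). intros j.
    apply UA_mult; [easy | apply UA_const | apply UA_pow; [easy|]].
    apply UA_plus; [apply UA_const | apply UA_id]. }
  destruct (UA_bounded K (fun h => f (1 + h) - evalp a n0 (1 + h)) HK) as [M [HM0 HM]].
  { apply UA_minus; auto. }
  destruct (Rinv_INR_small (e / (M + 1))%R) as [n1 Hn1]; [apply Rdiv_lt_0_compat; lra|].
  exists (n0 + n1 + 1)%nat. intros n Hn.
  assert (HMn : (M * / INR n <= e)%R).
  { destruct n as [|n]; [lia|]. specialize (Hn1 n ltac:(lia)).
    apply Rle_trans with ((M + 1) * (e / (M + 1)))%R; [|apply Req_le; field; lra].
    apply Rmult_le_compat; [lra | apply Rlt_le, Rinv_0_lt_compat, lt_0_INR; lia | lra | easy]. }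
  set (Phi := fun h => (h ^ 2 + RtoC (d ^ 2) * (1 + h)) * ((f (1 + h) - evalp a n (1 + h)) * (/ (1 + h)) ^ n)).
  assert (Hcenter : (Cmod (Phi 0) <= 5 * d * e)%R).
  { apply (UA_center Phi d); [lra| |].
    - unfold Phi. apply UA_mult; [easy| |apply UA_mult; [easy| |]].
      + apply UA_plus; [apply UA_pow; auto using UA_id|].
        apply UA_mult; [easy | apply UA_const | apply UA_plus; auto using UA_id, UA_const].
      + apply UA_minus; auto.
      + apply UA_pow; [easy|]. apply (UA_inv_comp K _ (1 / 2)); [easy | lra | |].
        * apply UA_plus; auto using UA_id, UA_const.
        * intros z Hz. change (Re (1 + z)) with (1 + Re z)%R.
          pose proof (re_le_Cmod z).
          assert (- Cmod z <= Re z)%R.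
          { pose proof (Rle_abs (- Re z)) as Hq. rewrite Rabs_Ropp in Hq. lra. }
          unfold K in Hz. lra.
    - intros h Hh. unfold Phi. set (v := 1 + h). set (x := Cmod v).
      assert (Hx1 : (1 - d <= x)%R).
      { pose proof (Cmod_le_minus 1 v) as H. rewrite Cmod_1 in H.
        replace (1 - v) with (- h) in H by (unfold v; ring). rewrite Cmod_opp in H. unfold x. lra. }
      assert (Hx2 : (x <= 1 + d)%R).
      { unfold x, v. eapply Rle_trans; [apply Cmod_triangle|]. rewrite Cmod_1. lra. }
      assert (Hv : v <> 0) by (apply Cmod_gt_0; unfold x in Hx1; lra).
      assert (Hxn : (0 < x ^ n)%R) by (apply pow_lt; lra).
      rewrite !Cmod_mult, Cmod_pow, Cmod_inv, pow_inv by easy.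
      unfold v at 1. rewrite riesz_multiplier by easy. fold v. fold x.
      destruct (Rtotal_order x 1) as [H|[H|H]].
      + pose proof (riesz_inside f a v n e (Hf v H) H ltac:(intros; apply Hn0; lia)) as B. fold x in B.
        assert (Hsq : (x ^ 2 - 1 < 0)%R) by nra.
        rewrite Rabs_left by easy.
        apply Rle_trans with (d * - (x ^ 2 - 1) * ((e * x ^ n / (1 - x)) * / x ^ n))%R.
        * apply Rmult_le_compat_l; [apply Rmult_le_pos; lra|]. apply Rmult_le_compat_r; [apply Rlt_le, Rinv_0_lt_compat; lra | easy].
        * replace (d * - (x ^ 2 - 1) * (e * x ^ n / (1 - x) * / x ^ n))%R with (d * e * (1 + x))%R.
          -- assert (0 <= d * e)%R by nra. nra.
          -- field. split; lra.
      + rewrite H. replace (1 ^ 2 - 1)%R with 0%R by ring. rewrite Rabs_R0. nra.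
      + assert (HMv : (Cmod (f v - evalp a n0 v) <= M)%R) by (apply HM; unfold K; lra).
        pose proof (riesz_outside f a v n0 n e M H ltac:(lia) Hn0 HMv) as B. fold x in B.
        pose proof (bernoulli_quotient x n H ltac:(lia)) as Bq.
        assert (Hsq : (0 <= x ^ 2 - 1)%R) by nra.
        rewrite Rabs_pos_eq by easy.
        apply Rle_trans with (d * (x ^ 2 - 1) * ((M + e * x ^ n / (x - 1)) * / x ^ n))%R.
        * apply Rmult_le_compat_l; [apply Rmult_le_pos; lra|]. apply Rmult_le_compat_r; [apply Rlt_le, Rinv_0_lt_compat; lra | easy].
        * replace (d * (x ^ 2 - 1) * ((M + e * x ^ n / (x - 1)) * / x ^ n))%R
            with (d * (x + 1) * (M * ((x - 1) / x ^ n) + e))%R by (field; split; lra).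
          apply Rle_trans with (d * (x + 1) * (e + e))%R.
          -- apply Rmult_le_compat_l; [nra|]. apply Rplus_le_compat_r.
             eapply Rle_trans; [apply Rmult_le_compat_l; [easy | exact Bq] | easy].
          -- assert (0 <= d * e)%R by nra. nra. }
  assert (E : Phi 0 = RtoC (d ^ 2) * (f 1 - evalp a n 1)).
  { unfold Phi. rewrite Cplus_0_r. replace (/ 1) with (RtoC 1) by (field; apply RtoC_neq; lra). rewrite Cpow_1_l. ring. }
  rewrite E, Cmod_mult, Cmod_RtoC_pos in Hcenter by nra.
  rewrite Cmod_minus_sym.
  apply Rmult_le_reg_l with (d ^ 2)%R; [nra|].
  eapply Rle_trans; [exact Hcenter|]. apply Req_le. unfold e. field.
Qed.
(** Rotation: the coefficients a_j w0^j have the same moduli and move the boundary point to 1. *)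
Lemma fatou_riesz (f : C -> C) (a : nat -> C) (d : R) (w0 : C) : (0 < d <= 1 / 2)%R ->
  Cmod w0 = 1%R ->
  (forall w, (Cmod w < 1)%R -> Clim (fun n => evalp a n w) (f w)) ->
  UA (fun h => (Cmod h <= d)%R) (fun h => f (w0 * (1 + h))) ->
  tends0 a -> Clim (fun n => evalp a n w0) (f w0).
Proof.
  intros Hd Hw Hf HUA Ha.
  assert (E : forall n v, evalp (fun j => a j * w0 ^ j) n v = evalp a n (w0 * v)).
  { intros n v. apply csum_ext. intros i _. rewrite Cpow_mult_l. ring. }
  pose proof (fatou_riesz_at_1 (fun v => f (w0 * v)) (fun j => a j * w0 ^ j) d Hd) as H.
  cbv beta in H. rewrite Cmult_1_r in H.
  assert (H' : Clim (fun n => evalp (fun j => a j * w0 ^ j) n 1) (f w0)).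
  { apply H; [|easy|].
    - intros v Hv eps He. destruct (Hf (w0 * v)) with (eps := eps) as [N HN]; [|easy|].
      + rewrite Cmod_mult, Hw. lra.
      + exists N. intros n Hn. rewrite E. auto.
    - intros eps He. destruct (Ha eps He) as [N HN]. exists N. intros n Hn.
      rewrite Cmod_mult, Cmod_pow, Hw, pow1, Rmult_1_r. auto. }
  intros eps He. destruct (H' eps He) as [N HN]. exists N. intros n Hn.
  specialize (HN n Hn). rewrite E, Cmult_1_r in HN. exact HN.
Qed.

(** * Expansions at the origin *)

(* [w = 0] is excluded because [Gk] has a junk value at [s = 1]. *)
Definition asy (N : nat) (f : C -> C) (al : nat -> C) : Prop :=
  exists M d : R, (0 < d)%R /\ forall w, (0 < Cmod w <= d)%R ->
    (Cmod (f w - evalp al N w) <= M * Cmod w ^ N)%R.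

Lemma asy_ext (N : nat) (f g : C -> C) (al be : nat -> C) (d : R) : (0 < d)%R ->
  (forall w, (0 < Cmod w <= d)%R -> f w = g w) ->
  (forall i, (i < N)%nat -> al i = be i) -> asy N f al -> asy N g be.
Proof.
  intros Hd Ef Ea [M [r [Hr H]]]. exists M, (Rmin d r). split; [now apply Rmin_pos|].
  intros w Hw. pose proof (Rmin_l d r). pose proof (Rmin_r d r).
  rewrite <- Ef by lra. replace (evalp be N w) with (evalp al N w); [apply H; lra|].
  apply csum_ext. intros i Hi. now rewrite Ea.
Qed.

Lemma asy_plus (N : nat) (f g : C -> C) (al be : nat -> C) :
  asy N f al -> asy N g be -> asy N (fun w => f w + g w) (fun i => al i + be i).
Proof.
  intros [M [d [Hd H]]] [M' [d' [Hd' H']]]. exists (M + M')%R, (Rmin d d'). split; [now apply Rmin_pos|].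
  intros w Hw. pose proof (Rmin_l d d'). pose proof (Rmin_r d d').
  replace (evalp (fun i => al i + be i) N w) with (evalp al N w + evalp be N w).
  - replace (f w + g w - (evalp al N w + evalp be N w))
      with ((f w - evalp al N w) + (g w - evalp be N w)) by ring.
    eapply Rle_trans; [apply Cmod_triangle|].
    specialize (H w ltac:(lra)). specialize (H' w ltac:(lra)). lra.
  - unfold evalp. rewrite <- csum_plus. apply csum_ext. intros; ring.
Qed.

Lemma asy_scal (N : nat) (f : C -> C) (al : nat -> C) (c : C) :
  asy N f al -> asy N (fun w => c * f w) (fun i => c * al i).
Proof.
  intros [M [d [Hd H]]]. exists (Cmod c * M)%R, d. split; [easy|]. intros w Hw.
  replace (evalp (fun i => c * al i) N w) with (c * evalp al N w).
  - replace (c * f w - c * evalp al N w) with (c * (f w - evalp al N w)) by ring.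
    rewrite Cmod_mult, Rmult_assoc. apply Rmult_le_compat_l; [apply Cmod_ge_0 | auto].
  - unfold evalp. rewrite <- csum_mult_l. apply csum_ext. intros; ring.
Qed.

Definition sh (al : nat -> C) (i : nat) : C := match i with O => 0 | S i => al i end.

Lemma evalp_sh (al : nat -> C) (N : nat) (w : C) :
  w * evalp al N w = evalp (sh al) N w + sh al N * w ^ N.
Proof.
  unfold evalp. induction N as [|N IH]; cbn [csum sh]; [ring|].
  rewrite Cmult_plus_distr_l, IH, Cpow_S. ring.
Qed.

Lemma asy_sh (N : nat) (f : C -> C) (al : nat -> C) :
  asy N f al -> asy N (fun w => w * f w) (sh al).
Proof.
  (* [asy] leaves the sign of M open, hence [Rabs M]. *)
  intros [M [d [Hd H]]]. exists (Rabs M + Cmod (sh al N))%R, (Rmin 1 d).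
  split; [apply Rmin_pos; lra|]. intros w Hw. pose proof (Rmin_l 1 d). pose proof (Rmin_r 1 d).
  replace (w * f w - evalp (sh al) N w) with (w * (f w - evalp al N w) + sh al N * w ^ N)
    by (pose proof (evalp_sh al N w) as E; replace (evalp (sh al) N w) with (w * evalp al N w - sh al N * w ^ N) by (rewrite E; ring); ring).
  eapply Rle_trans; [apply Cmod_triangle|]. rewrite !Cmod_mult, Cmod_pow, Rmult_plus_distr_r.
  apply Rplus_le_compat_r. specialize (H w ltac:(lra)).
  pose proof (Cmod_ge_0 (f w - evalp al N w)). pose proof (Rle_abs M).
  assert (0 < Cmod w ^ N)%R by (apply pow_lt; lra).
  apply Rle_trans with (M * Cmod w ^ N)%R; nra.
Qed.

(** The hypothesis says that (1 + w) times the series of [be] is the series of [al]; the quotient is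
    thus verified rather than computed. *)
Lemma asy_div1p (N : nat) (f : C -> C) (al be : nat -> C) :
  (forall i, (i < N)%nat -> al i = be i + sh be i) ->
  asy N f al -> asy N (fun w => / (1 + w) * f w) be.
Proof.
  intros Hab [M [d [Hd H]]]. exists (2 * (Rabs M + Cmod (sh be N)))%R, (Rmin (1 / 2) d).
  split; [apply Rmin_pos; lra|]. intros w Hw. pose proof (Rmin_l (1 / 2) d). pose proof (Rmin_r (1 / 2) d).
  assert (Hw1 : (1 / 2 <= Cmod (1 + w))%R).
  { pose proof (Cmod_le_minus 1 (1 + w)) as Hm. rewrite Cmod_1 in Hm.
    replace (1 - (1 + w)) with (- w) in Hm by ring. rewrite Cmod_opp in Hm. lra. }
  assert (Hn : 1 + w <> 0) by (apply Cmod_gt_0; lra).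
  assert (E : (1 + w) * evalp be N w = evalp al N w + sh be N * w ^ N).
  { replace ((1 + w) * evalp be N w) with (evalp be N w + w * evalp be N w) by ring.
    rewrite evalp_sh. replace (evalp al N w) with (evalp be N w + evalp (sh be) N w); [ring|].
    unfold evalp. rewrite <- csum_plus. apply csum_ext. intros i Hi. rewrite Hab by easy. ring. }
  replace (/ (1 + w) * f w - evalp be N w)
    with (/ (1 + w) * ((f w - evalp al N w) - sh be N * w ^ N)).
  - rewrite Cmod_mult, Cmod_inv by easy.
    assert (Hi : (/ Cmod (1 + w) <= 2)%R).
    { rewrite <- (Rinv_inv 2). apply Rinv_le_contravar; lra. }
    assert (Hi0 : (0 < / Cmod (1 + w))%R) by (apply Rinv_0_lt_compat; lra).
    assert (0 < Cmod w ^ N)%R by (apply pow_lt; lra). pose proof (Rle_abs M).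
    specialize (H w ltac:(lra)).
    assert (Hsum : (Cmod (f w - evalp al N w - sh be N * w ^ N) <= (Rabs M + Cmod (sh be N)) * Cmod w ^ N)%R).
    { eapply Rle_trans; [apply Cmod_triangle|]. rewrite Cmod_opp, Cmod_mult, Cmod_pow. nra. }
    rewrite Rmult_assoc. apply Rmult_le_compat; [lra | apply Cmod_ge_0 | easy | easy].
  - replace (evalp al N w) with ((1 + w) * evalp be N w - sh be N * w ^ N) by (rewrite E; ring).
    field. easy.
Qed.

(** Strong induction: if the coefficients below n agree, then at small real x the expansions of
    order n + 1 differ by exactly (a_n - b_n) x^n, which must be O(x^(n+1)). *)
Lemma asy_unique (f : C -> C) (a b : nat -> C) :
  (forall N, asy N f a) -> (forall N, asy N f b) -> forall n, a n = b n.
Proof.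
  intros Ha Hb n. induction n as [n IH] using (well_founded_induction lt_wf).
  assert (E : a n - b n = 0).
  { apply Cmod_le_all_eps. intros eps He.
    destruct (Ha (S n)) as [M [d [Hd H]]]. destruct (Hb (S n)) as [M' [d' [Hd' H']]].
    set (M2 := (Rabs M + Rabs M' + 1)%R).
    assert (HM2 : (0 < M2)%R) by (unfold M2; pose proof (Rabs_pos M); pose proof (Rabs_pos M'); lra).
    set (x := Rmin (eps / M2) (Rmin d d')).
    assert (Hx : (0 < x)%R) by (apply Rmin_pos; [apply Rdiv_lt_0_compat; lra | now apply Rmin_pos]).
    assert (Hx1 : (x <= eps / M2)%R) by apply Rmin_l.
    assert (Hx2 : (x <= Rmin d d')%R) by apply Rmin_r.
    pose proof (Rmin_l d d'). pose proof (Rmin_r d d').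
    assert (Hc : Cmod (RtoC x) = x) by (apply Cmod_RtoC_pos; lra).
    specialize (H (RtoC x) ltac:(lra)). specialize (H' (RtoC x) ltac:(lra)).
    assert (Ed : evalp a (S n) x - evalp b (S n) x = (a n - b n) * RtoC x ^ n).
    { unfold evalp. rewrite <- csum_minus, (csum_single _ _ n); [ring | lia|].
      intros i Hi Hin. rewrite (IH i) by lia. ring. }
    assert (Hle : (Cmod ((a n - b n) * RtoC x ^ n) <= M2 * x ^ S n)%R).
    { rewrite <- Ed. eapply Rle_trans; [apply (Cmod_minus_triangle _ (f x))|].
      rewrite (Cmod_minus_sym (evalp a (S n) x)), Hc in *.
      assert (0 < x ^ S n)%R by (apply pow_lt; lra).
      pose proof (Rle_abs M). pose proof (Rle_abs M'). unfold M2. nra. }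
    rewrite Cmod_mult, Cmod_pow, Hc in Hle.
    assert (Hp : (0 < x ^ n)%R) by (apply pow_lt; lra).
    apply Rle_trans with (M2 * x)%R.
    - apply Rmult_le_reg_r with (x ^ n)%R; [easy|]. eapply Rle_trans; [exact Hle|]. apply Req_le. simpl. ring.
    - apply Rle_trans with (M2 * (eps / M2))%R; [apply Rmult_le_compat_l; lra | apply Req_le; field; lra]. }
  replace (a n) with (a n - b n + b n) by ring. rewrite E. ring.
Qed.

(** Convergence at h = 1/2 gives |c_j| <= 2 * 2^j, but only from some index [n0] on. Hence the tail
    is estimated from L = N + n0, and the terms between N and L go into the constant. *)
Lemma power_series_asy (f : C -> C) (c : nat -> C) (N : nat) :
  (forall h, (0 < Cmod h < 1)%R -> Clim (fun n => evalp c n h) (f h)) -> asy N f c.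
Proof.
  intros Hf.
  assert (Hhalf : (0 < Cmod (RtoC (1 / 2)) < 1)%R) by (rewrite Cmod_RtoC_pos by lra; lra).
  destruct (Hf _ Hhalf 1%R ltac:(lra)) as [n0 Hn0].
  assert (Hb : forall j, (n0 <= j)%nat -> (Cmod (c j) * (1 / 2) ^ j <= 2)%R).
  { intros j Hj. replace (Cmod (c j) * (1 / 2) ^ j)%R
      with (Cmod (evalp c (S j) (RtoC (1 / 2)) - evalp c j (RtoC (1 / 2)))).
    - eapply Rle_trans; [apply (Cmod_minus_triangle _ (f (RtoC (1 / 2))))|].
      rewrite (Cmod_minus_sym (f _)). pose proof (Hn0 j Hj). pose proof (Hn0 (S j) ltac:(lia)). lra.
    - replace (evalp c (S j) (RtoC (1 / 2)) - evalp c j (RtoC (1 / 2))) with (c j * RtoC (1 / 2) ^ j)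
        by (unfold evalp; cbn [csum]; ring).
      rewrite Cmod_mult, Cmod_pow, Cmod_RtoC_pos by lra. reflexivity. }
  set (L := (N + n0)%nat).
  assert (HL : forall h, (0 < Cmod h <= 1 / 4)%R -> (Cmod (f h - evalp c L h) <= 4 * (2 * Cmod h) ^ L)%R).
  { intros h Hh. apply (Clim_bound _ _ _ _ L (Hf h ltac:(lra))). intros m Hm.
    replace m with (L + (m - L))%nat by lia. rewrite evalp_app.
    replace (evalp c L h + csum (fun i => c (L + i)%nat * h ^ (L + i)) (m - L) - evalp c L h)
      with (csum (fun i => c (L + i)%nat * h ^ (L + i)) (m - L)) by ring.
    eapply Rle_trans; [apply (Cmod_csum_le _ (fun i => 2 * (2 * Cmod h) ^ L * (1 / 2) ^ i)%R)|].
    - intros i _. rewrite Cmod_mult, Cmod_pow.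
      replace (Cmod h ^ (L + i))%R with ((1 / 2) ^ (L + i) * (2 * Cmod h) ^ (L + i))%R
        by (rewrite <- Rpow_mult_distr; f_equal; field).
      rewrite <- Rmult_assoc.
      assert (0 < (2 * Cmod h) ^ L)%R by (apply pow_lt; lra).
      rewrite Rmult_assoc.
      apply Rle_trans with (2 * (2 * Cmod h) ^ (L + i))%R.
      + rewrite <- Rmult_assoc. apply Rmult_le_compat_r; [apply pow_le; lra|]. apply Hb. unfold L. lia.
      + rewrite pow_add, <- Rmult_assoc. apply Rmult_le_compat_l; [lra|].
        apply pow_incr. lra.
    - rewrite rsum_mult_l.
      assert (0 < (2 * Cmod h) ^ L)%R by (apply pow_lt; lra).
      pose proof (rsum_geom_le (1 / 2) (m - L) ltac:(lra)) as G.
      replace (/ (1 - 1 / 2))%R with 2%R in G by field.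
      apply Rle_trans with (2 * (2 * Cmod h) ^ L * 2)%R; [apply Rmult_le_compat_l; [lra | exact G] | lra]. }
  exists (4 * 2 ^ L + rsum (fun i => Cmod (c (N + i)%nat)) n0)%R, (1 / 4)%R. split; [lra|].
  intros h Hh. specialize (HL h Hh).
  eapply Rle_trans; [apply (Cmod_minus_triangle _ (evalp c L h))|].
  rewrite Rmult_plus_distr_r. apply Rplus_le_compat.
  - eapply Rle_trans; [exact HL|]. rewrite Rpow_mult_distr, <- Rmult_assoc.
    apply Rmult_le_compat_l; [pose proof (pow_lt 2 L ltac:(lra)); lra|].
    unfold L. rewrite pow_add. assert (0 < Cmod h ^ N)%R by (apply pow_lt; lra).
    assert (Cmod h ^ n0 <= 1)%R by (rewrite <- (pow1 n0); apply pow_incr; lra). nra.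
  - unfold L. rewrite evalp_app.
    replace (evalp c N h + csum (fun i => c (N + i)%nat * h ^ (N + i)) n0 - evalp c N h)
      with (csum (fun i => c (N + i)%nat * h ^ (N + i)) n0) by ring.
    rewrite Rmult_comm, <- rsum_mult_l. apply Cmod_csum_le. intros i _.
    rewrite Cmod_mult, Cmod_pow, pow_add.
    assert (0 < Cmod h ^ N)%R by (apply pow_lt; lra).
    assert (Cmod h ^ i <= 1)%R by (rewrite <- (pow1 i); apply pow_incr; lra).
    pose proof (Cmod_ge_0 (c (N + i)%nat)). 
    assert (Cmod (c (N + i)%nat) * Cmod h ^ i <= Cmod (c (N + i)%nat))%R by nra. nra.
Qed.

(** Binomial coefficients with value 0 for i > n, where [Binomial.C], through truncated subtraction,
    is nonzero. Pascal's rule holds by computation. *)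
Fixpoint binn (n i : nat) : R :=
  match i, n with
  | O, _ => 1%R
  | S _, O => 0%R
  | S i', S n' => (binn n' i' + binn n' i)%R
  end.

Lemma binn_gt (n i : nat) : (n < i)%nat -> binn n i = 0%R.
Proof.
  revert i. induction n as [|n IH]; intros [|i] Hi; simpl; try lia; [easy|].
  rewrite !IH by lia. ring.
Qed.

Lemma binn_C (n i : nat) : (i <= n)%nat -> binn n i = Binomial.C n i.
Proof.
  revert i. induction n as [|n IH]; intros [|i] Hi.
  - simpl. symmetry. unfold Binomial.C. simpl. field.
  - lia.
  - simpl. symmetry. unfold Binomial.C. rewrite Nat.sub_0_r. simpl (fact 0).
    change (INR 1) with 1%R. field. apply INR_fact_neq_0.
  - cbn [binn]. destruct (Nat.eq_dec i n) as [->|Hin].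
    + rewrite (binn_gt n (S n)), IH by lia. unfold Binomial.C. rewrite !Nat.sub_diag. simpl (fact 0).
      change (INR 1) with 1%R. field. split; apply INR_fact_neq_0.
    + rewrite !IH by lia. apply pascal. lia.
Qed.

(* Coefficients of [(1 + w)^(k - j)], the exponent being possibly negative. *)
Definition gbin (k j i : nat) : R :=
  if (j <=? k)%nat then binn (k - j) i else ((-1) ^ i * binn (j - k - 1 + i) i)%R.

Definition gpow (k j : nat) (w : C) : C :=
  if (j <=? k)%nat then (1 + w) ^ (k - j) else (/ (1 + w)) ^ (j - k).

Lemma asy_one (N : nat) : asy N (fun _ => 1) (fun i => RtoC (binn 0 i)).
Proof.
  exists 1%R, 1%R. split; [lra|]. intros w Hw. destruct N as [|N].
  - unfold evalp. cbn [csum]. replace (1 - 0) with (RtoC 1) by ring. rewrite Cmod_1. simpl. lra.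
  - unfold evalp. rewrite (csum_single _ _ 0%nat).
    + cbn [binn Cpow]. replace (1 - 1 * 1) with (RtoC 0) by ring. rewrite Cmod_0, Rmult_1_l. apply pow_le. lra.
    + lia.
    + intros i _ Hi. destruct i; [lia|]. cbn [binn]. ring.
Qed.

Lemma asy_pow1p (N n : nat) : asy N (fun w => (1 + w) ^ n) (fun i => RtoC (binn n i)).
Proof.
  induction n as [|n IH]; [apply asy_one|].
  apply (asy_ext N (fun w => (1 + w) ^ n + w * (1 + w) ^ n) _
    (fun i => RtoC (binn n i) + sh (fun i => RtoC (binn n i)) i) _ 1%R); [lra| | |].
  - intros w _. rewrite Cpow_S. ring.
  - intros [|i] _; cbn [sh binn].
    + destruct n; cbn [binn]; ring.
    + rewrite RtoC_plus. ring.
  - apply asy_plus; [easy | now apply asy_sh].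
Qed.

(** The negative binomial series; through [asy_div1p] the step from p to p + 1 amounts to Pascal's
    rule. *)
Lemma asy_invpow1p (N p : nat) :
  asy N (fun w => (/ (1 + w)) ^ S p) (fun i => RtoC ((-1) ^ i * binn (p + i) i)).
Proof.
  induction p as [|p IH].
  - apply (asy_ext N (fun w => / (1 + w) * 1) _ (fun i => RtoC ((-1) ^ i * binn (0 + i) i)) _ 1%R);
      [lra | intros w _; rewrite Cpow_S; cbn [Cpow]; ring | easy |].
    apply (asy_div1p N _ (fun i => RtoC (binn 0 i))); [|apply asy_one].
    intros [|i] _; cbn [sh].
    + cbn [binn Nat.add pow]. rewrite Rmult_1_l. ring.
    + rewrite <- RtoC_plus. f_equal. cbn [Nat.add binn pow].
      rewrite (binn_gt i (S i)) by lia. ring.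
  - apply (asy_ext N (fun w => / (1 + w) * (/ (1 + w)) ^ S p) _ (fun i => RtoC ((-1) ^ i * binn (S p + i) i)) _ 1%R);
      [lra | intros w _; rewrite (Cpow_S _ (S p)); ring | easy |].
    apply (asy_div1p N _ (fun i => RtoC ((-1) ^ i * binn (p + i) i))); [|exact IH].
    intros [|i] _; cbn [sh].
    + destruct p; cbn [binn Nat.add pow]; rewrite Rmult_1_l; ring.
    + rewrite <- RtoC_plus. f_equal. rewrite Nat.add_succ_r. cbn [Nat.add binn pow].
      rewrite Nat.add_succ_r. cbn [binn]. ring.
Qed.

Lemma asy_gpow (N k j : nat) : asy N (gpow k j) (fun i => RtoC (gbin k j i)).
Proof.
  unfold gpow, gbin. destruct (Nat.leb_spec j k).
  - apply asy_pow1p.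
  - pose proof (asy_invpow1p N (j - k - 1)) as A.
    replace (S (j - k - 1)) with (j - k)%nat in A by lia. exact A.
Qed.

Definition shn (j : nat) (al : nat -> C) (m : nat) : C :=
  if (m <? j)%nat then 0 else al (m - j)%nat.

Lemma asy_shn (N j : nat) (f : C -> C) (al : nat -> C) :
  asy N f al -> asy N (fun w => w ^ j * f w) (shn j al).
Proof.
  intros H. induction j as [|j IH].
  - apply (asy_ext N f _ al _ 1%R); [lra | intros; cbn [Cpow]; ring | | easy].
    intros i _. unfold shn. simpl. now rewrite Nat.sub_0_r.
  - apply (asy_ext N (fun w => w * (w ^ j * f w)) _ (sh (shn j al)) _ 1%R);
      [lra | intros; rewrite Cpow_S; ring | | now apply asy_sh].
    intros [|i] _; [easy|]. reflexivity.
Qed.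

Lemma asy_csum (N n : nat) (f : nat -> C -> C) (al : nat -> nat -> C) :
  (forall j, asy N (f j) (al j)) ->
  asy N (fun w => csum (fun j => f j w) n) (fun i => csum (fun j => al j i) n).
Proof.
  intros H. induction n as [|n IH]; cbn [csum].
  - apply (asy_ext N (fun w => 0 * 1) _ (fun i => 0 * RtoC (binn 0 i)) _ 1%R);
      [lra | intros; ring | intros; ring |]. apply asy_scal, asy_one.
  - now apply asy_plus.
Qed.

(** * The expansion under vanishing coefficients *)

Lemma Re_ge_neg_Cmod (z : C) : (- Cmod z <= Re z)%R.
Proof.
  pose proof (re_le_Cmod z). pose proof (Rle_abs (- Re z)) as H0. rewrite Rabs_Ropp in H0. lra.
Qed.

Lemma zeta_zreg_disc (s : C) : (0 < Cmod (s - 1) < 1)%R -> (s - 1) * zeta s = zreg s.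
Proof.
  intros Hs.
  assert (Hn : s - 1 <> 0) by (apply Cmod_gt_0; lra).
  rewrite zeta_zreg.
  - field. auto.
  - pose proof (Re_ge_neg_Cmod (s - 1)) as H. change (Re (s - 1)) with (Re s - 1)%R in H. lra.
  - intros ->. apply Hn. ring.
  - now apply zeta_factor_neq0_disc.
Qed.

(** Gives content to the [epsilon] in [lam_over_fact]. The function zreg^k replaces [Gk], being
    approximable on every disc |s - 1| <= r < 1 including its centre. *)
Lemma taylor_coef_exists (k : nat) : exists c, is_taylor_coef k c.
Proof.
  destruct (UA_power_series (fun h => zreg (1 + h) ^ k)) as [c [_ Hc]].
  - intros r Hr. set (K := fun h : C => (Cmod h <= r)%R).
    assert (HK : bounded K) by (exists r; easy).
    apply UA_pow; [easy|].
    apply (UA_comp K _ zreg (fun h => 1 + h) HK (UA_zreg 2 (1 - r) ltac:(lra))).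
    + apply UA_plus; auto using UA_const, UA_id.
    + intros z Hz. unfold K in Hz. split.
      * eapply Rle_trans; [apply Cmod_triangle|]. rewrite Cmod_1. lra.
      * pose proof (Re_ge_neg_Cmod z). change (Re (1 + z)) with (1 + Re z)%R. lra.
  - exists c. intros s Hs. apply is_series_Clim.
    unfold Gk. rewrite zeta_zreg_disc by easy.
    specialize (Hc (s - 1) ltac:(lra)). replace (1 + (s - 1)) with s in Hc by ring. exact Hc.
Qed.

Lemma lam_over_fact_series (k : nat) (s : C) : (0 < Cmod (s - 1) < 1)%R ->
  Clim (fun n => evalp (lam_over_fact k) n (s - 1)) (zreg s ^ k).
Proof.
  intros Hs. rewrite <- zeta_zreg_disc by easy. apply (is_series_Clim (fun j => lam_over_fact k j * (s - 1) ^ j)).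
  apply (epsilon_spec (inhabits (fun _ => RtoC 0)) (is_taylor_coef k) (taylor_coef_exists k) s Hs).
Qed.

Lemma lam_div_fact (j k : nat) : lam j k / RtoC (INR (fact j)) = lam_over_fact k j.
Proof.
  unfold lam. field. intros E. apply RtoC_inj in E. now apply (INR_fact_neq_0 j).
Qed.

(** * The numbers [ell] as Taylor coefficients in w *)

Definition acoef (k m : nat) : C := ell (Z.of_nat m - Z.of_nat k) k.

Lemma Rpow_m1_twice (n : nat) : ((-1) ^ n * (-1) ^ n = 1)%R.
Proof. rewrite <- Rpow_mult_distr. replace (-1 * -1)%R with 1%R by ring. apply pow1. Qed.

(** Both cases of [ell] are the coefficient of w^m in (-1)^k times the sum over j of (-1)^j c_j w^j
    (1 + w)^(k-j), with c_j = [lam_over_fact k j]; terms with j > m contribute nothing. Here every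
    remaining exponent k - j is nonnegative, and C(k-j, k-m) = C(k-j, m-j). *)
Lemma acoef_low (k m N : nat) : (m <= k)%nat -> (m < N)%nat ->
  acoef k m = RtoC ((-1) ^ k) * csum (fun j => RtoC ((-1) ^ j) * lam_over_fact k j
     * shn j (fun i => RtoC (gbin k j i)) m) N.
Proof.
  intros Hm HN. unfold acoef, ell.
  destruct (Z.ltb_spec 0 (Z.of_nat m - Z.of_nat k)); [lia|].
  destruct (Z.leb_spec (- Z.of_nat k) (Z.of_nat m - Z.of_nat k)); [|lia].
  replace (Z.to_nat (- (Z.of_nat m - Z.of_nat k))) with (k - m)%nat by lia.
  cbv zeta. rewrite sum_n_csum. f_equal.
  replace (S (k - (k - m))) with (S m) by lia.
  replace N with (S m + (N - S m))%nat by lia. rewrite csum_app.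
  rewrite (csum_zero (fun i => RtoC ((-1) ^ (S m + i)) * _ * _)), Cplus_0_r.
  - apply csum_ext. intros j Hj. rewrite lam_div_fact. unfold shn, gbin.
    destruct (Nat.ltb_spec m j); [lia|]. destruct (Nat.leb_spec j k); [|lia].
    rewrite binn_C, (pascal_step1 (k - j) (m - j)) by lia.
    replace (k - j - (m - j))%nat with (k - m)%nat by lia. ring.
  - intros i _. unfold shn. destruct (Nat.ltb_spec m (S m + i)); [ring | lia].
Qed.

(** For j <= k the polynomial w^j (1 + w)^(k-j) has degree k < m and contributes nothing. For k < j
    <= m the exponent is negative, and C(m-k-1, m-j) is the symmetric form of the binomial in
    [ell]. *)
Lemma acoef_high (k m N : nat) : (k < m)%nat -> (m < N)%nat ->
  acoef k m = RtoC ((-1) ^ k) * csum (fun j => RtoC ((-1) ^ j) * lam_over_fact k j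
     * shn j (fun i => RtoC (gbin k j i)) m) N.
Proof.
  intros Hm HN. unfold acoef, ell.
  destruct (Z.ltb_spec 0 (Z.of_nat m - Z.of_nat k)); [|lia].
  replace (Z.to_nat (Z.of_nat m - Z.of_nat k)) with (m - k)%nat by lia.
  cbv zeta. rewrite sum_n_csum.
  set (n := (m - k - 1)%nat).
  replace N with (S k + (S n + (N - S m)))%nat by (unfold n; lia).
  rewrite csum_app, csum_app.
  rewrite (csum_zero (fun j => RtoC ((-1) ^ j) * lam_over_fact k j * shn j (fun i => RtoC (gbin k j i)) m)).
  rewrite (csum_zero (fun i => RtoC ((-1) ^ (S k + (S n + i))) * _ * _)), Cplus_0_l, Cplus_0_r.
  - rewrite <- !csum_mult_l. apply csum_ext. intros i Hi. rewrite lam_div_fact. unfold shn, gbin.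
    destruct (Nat.ltb_spec m (S k + i)); [lia|]. destruct (Nat.leb_spec (S k + i) k); [lia|].
    replace (S k + i - k - 1 + (m - (S k + i)))%nat with n by (unfold n; lia).
    rewrite binn_C, (pascal_step1 n (m - (S k + i))) by (unfold n; lia).
    replace (n - (m - (S k + i)))%nat with i by (unfold n; lia).
    replace (S i + k)%nat with (S k + i)%nat by lia.
    (* With j = [S k + i], the exponents k + j + (m - j) and m - k have the same parity. *)
    replace (RtoC ((-1) ^ (m - k))) with (RtoC ((-1) ^ k) * RtoC ((-1) ^ (S k + i)) * RtoC ((-1) ^ (m - (S k + i)))).
    + rewrite RtoC_mult. ring.
    + rewrite <- !RtoC_mult. f_equal. rewrite <- !pow_add.
      replace (k + (S k + i) + (m - (S k + i)))%nat with (k + k + (m - k))%nat by lia.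
      rewrite pow_add, (pow_add (-1) k k), Rpow_m1_twice. ring.
  - intros i _. unfold shn. destruct (Nat.ltb_spec m (S k + (S n + i))); [ring | unfold n in *; lia].
  - intros j Hj. unfold shn, gbin. destruct (Nat.ltb_spec m j); [ring|].
    destruct (Nat.leb_spec j k); [|lia]. rewrite binn_gt by lia. ring.
Qed.

Lemma acoef_gbin (k m N : nat) : (m < N)%nat ->
  acoef k m = RtoC ((-1) ^ k) * csum (fun j => RtoC ((-1) ^ j) * lam_over_fact k j
     * shn j (fun i => RtoC (gbin k j i)) m) N.
Proof. intros HN. destruct (Nat.le_gt_cases m k); [now apply acoef_low | now apply acoef_high]. Qed.

Definition zF (k : nat) (w : C) : C := (- zP w) ^ k.

Lemma gpow_split (k j : nat) (w : C) : 1 + w <> 0 -> gpow k j w = (1 + w) ^ k * (/ (1 + w)) ^ j.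
Proof.
  intros Hw. unfold gpow.
  assert (E : forall n, (1 + w) ^ n * (/ (1 + w)) ^ n = 1).
  { intros n. rewrite <- Cpow_mult_l, Cinv_r by easy. apply Cpow_1_l. }
  destruct (Nat.leb_spec j k).
  - replace ((1 + w) ^ k) with ((1 + w) ^ (k - j) * (1 + w) ^ j) by (rewrite <- Cpow_add_r; f_equal; lia).
    rewrite <- Cmult_assoc, E. ring.
  - replace ((/ (1 + w)) ^ j) with ((/ (1 + w)) ^ k * (/ (1 + w)) ^ (j - k)) by (rewrite <- Cpow_add_r; f_equal; lia).
    rewrite Cmult_assoc, E. ring.
Qed.

Lemma Cpow_opp_l (z : C) (n : nat) : (- z) ^ n = RtoC ((-1) ^ n) * z ^ n.
Proof.
  replace (- z) with (RtoC (-1) * z)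
    by (replace (RtoC (-1)) with (- RtoC 1) by (rewrite <- RtoC_opp; f_equal; ring); ring).
  now rewrite Cpow_mult_l, RtoC_pow.
Qed.

(** With s = 1/(1 + w), [zF k w] is (-(1 + w))^k zreg(s)^k and s - 1 = -w/(1 + w). Truncating the
    series at s = 1 after N terms gives [G], a combination of the w^j (1 + w)^(k-j); [D] carries the
    remainder, which is O(w^N) because |s - 1| <= 2|w|. *)
Lemma zF_asy (k N : nat) : asy N (zF k) (acoef k).
Proof.
  set (c := lam_over_fact k).
  set (G := fun w => RtoC ((-1) ^ k) * csum (fun j => RtoC ((-1) ^ j) * c j * (w ^ j * gpow k j w)) N).
  set (D := fun w => (- (1 + w)) ^ k * (zreg (/ (1 + w)) ^ k - evalp c N (/ (1 + w) - 1))).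
  assert (HG : asy N G (fun m => RtoC ((-1) ^ k) * csum (fun j => RtoC ((-1) ^ j) * c j
     * shn j (fun i => RtoC (gbin k j i)) m) N)).
  { apply asy_scal. apply (asy_csum N N (fun j w => RtoC ((-1) ^ j) * c j * (w ^ j * gpow k j w))
      (fun j m => RtoC ((-1) ^ j) * c j * shn j (fun i => RtoC (gbin k j i)) m)).
    intros j. apply (asy_scal N (fun w => w ^ j * gpow k j w) (shn j (fun i => RtoC (gbin k j i)))).
    apply asy_shn, asy_gpow. }
  assert (Hsmall : forall w, (0 < Cmod w <= 1 / 4)%R -> (1 / 2 <= Cmod (1 + w) <= 2)%R /\ 1 + w <> 0
     /\ (0 < Cmod (/ (1 + w) - 1) <= 2 * Cmod w)%R).
  { intros w Hw.
    assert (H1 : (1 / 2 <= Cmod (1 + w))%R).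
    { pose proof (Cmod_le_minus 1 (1 + w)) as Hm. rewrite Cmod_1 in Hm.
      replace (1 - (1 + w)) with (- w) in Hm by ring. rewrite Cmod_opp in Hm. lra. }
    assert (H2 : (Cmod (1 + w) <= 2)%R).
    { eapply Rle_trans; [apply Cmod_triangle|]. rewrite Cmod_1. lra. }
    assert (H3 : 1 + w <> 0) by (apply Cmod_gt_0; lra).
    repeat split; try easy.
    - replace (/ (1 + w) - 1) with (- w / (1 + w)) by (field; auto).
      rewrite Cmod_div, Cmod_opp by easy. apply Rdiv_lt_0_compat; lra.
    - replace (/ (1 + w) - 1) with (- w / (1 + w)) by (field; auto).
      rewrite Cmod_div, Cmod_opp by easy.
      apply Rmult_le_reg_r with (Cmod (1 + w)); [lra|]. unfold Rdiv.
      rewrite Rmult_assoc, Rinv_l, Rmult_1_r by lra. nra. }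
  assert (HD : asy N D (fun _ => 0)).
  { destruct (power_series_asy (fun h => zreg (1 + h) ^ k) c N) as [M [d [Hd H]]].
    { intros h Hh. pose proof (lam_over_fact_series k (1 + h)) as L.
      replace (1 + h - 1) with h in L by ring. apply L. lra. }
    exists (2 ^ k * (Rabs M * 2 ^ N))%R, (Rmin (1 / 4) (d / 2)). split; [apply Rmin_pos; lra|].
    intros w Hw. pose proof (Rmin_l (1 / 4) (d / 2)) as R1. pose proof (Rmin_r (1 / 4) (d / 2)) as R2.
    destruct (Hsmall w ltac:(lra)) as [H1 [H2 H3]].
    replace (evalp (fun _ => 0) N w) with (RtoC 0)
      by (unfold evalp; rewrite csum_zero; [easy | intros; ring]).
    replace (D w - 0) with (D w) by ring. unfold D. rewrite Cmod_mult, Cmod_pow, Cmod_opp.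
    specialize (H (/ (1 + w) - 1) ltac:(lra)). cbv beta in H.
    replace (1 + (/ (1 + w) - 1)) with (/ (1 + w)) in H by ring.
    rewrite Rmult_assoc. apply Rmult_le_compat; [apply pow_le; lra | apply Cmod_ge_0 | apply pow_incr; lra |].
    eapply Rle_trans; [exact H|].
    apply Rle_trans with (Rabs M * Cmod (/ (1 + w) - 1) ^ N)%R.
    - apply Rmult_le_compat_r; [apply pow_le, Cmod_ge_0 | apply Rle_abs].
    - rewrite Rmult_assoc, <- Rpow_mult_distr.
      apply Rmult_le_compat_l; [apply Rabs_pos|]. apply pow_incr. lra. }
  apply (asy_ext N (fun w => G w + D w) _ (fun m => RtoC ((-1) ^ k) * csum (fun j => RtoC ((-1) ^ j) * c j
     * shn j (fun i => RtoC (gbin k j i)) m) N + 0) _ (1 / 4)); [lra| | |now apply asy_plus].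
  - intros w Hw. destruct (Hsmall w Hw) as [_ [Hn _]].
    assert (E : G w = (- (1 + w)) ^ k * evalp c N (/ (1 + w) - 1)).
    { unfold G, evalp. rewrite <- !csum_mult_l. apply csum_ext. intros j _.
      rewrite gpow_split by easy.
      replace (/ (1 + w) - 1) with (- (w * / (1 + w))) by (field; auto).
      rewrite !Cpow_opp_l, Cpow_mult_l. ring. }
    rewrite E. unfold D, zF, zP.
    replace (- ((1 + w) * zreg (/ (1 + w)))) with (- (1 + w) * zreg (/ (1 + w))) by ring.
    rewrite Cpow_mult_l. ring.
  - intros m Hm. rewrite (acoef_gbin k m N Hm). fold c. ring.
Qed.

Lemma UA_zF (K : C -> Prop) (f : C -> C) (k : nat) (c : R) : bounded K -> (0 < c)%R ->
  UA K f -> (forall z, K z -> (c - 1 <= Re (f z))%R) -> UA K (fun z => zF k (f z)).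
Proof.
  intros HK Hc Hf H. unfold zF. apply UA_pow; [easy|].
  apply (UA_ext K (fun z => 0 - zP (f z))); [intros; ring|].
  apply UA_minus; [easy | apply UA_const | now apply (UA_zP K f c)].
Qed.

Lemma UA_zF_disc (k : nat) (r : R) : (0 < r < 1)%R -> UA (fun w => (Cmod w <= r)%R) (zF k).
Proof.
  intros Hr. apply (UA_zF _ (fun w => w) k (1 - r)); [now exists r | lra | apply UA_id|].
  intros z Hz. pose proof (Re_ge_neg_Cmod z). lra.
Qed.

(** Some power series converges to [zF k] on the whole disc; agreement to all orders at 0 identifies
    its coefficients. *)
Lemma zF_series (k : nat) (w : C) : (Cmod w < 1)%R ->
  Clim (fun n => evalp (acoef k) n w) (zF k w).
Proof.
  intros Hw. destruct (UA_power_series (zF k)) as [b [_ Hb]]; [intros; now apply UA_zF_disc|].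
  assert (E : forall n, b n = acoef k n).
  { apply (asy_unique (zF k)); intros N; [|apply zF_asy].
    apply power_series_asy. intros h Hh. apply Hb. lra. }
  intros eps He. destruct (Hb w Hw eps He) as [N HN]. exists N. intros n Hn.
  replace (evalp (acoef k) n w) with (evalp b n w); [auto|].
  apply csum_ext. intros i _. now rewrite E.
Qed.

Lemma zF_boundary (k : nat) (w0 : C) : Cmod w0 = 1%R -> (0 < 1 + Re w0)%R ->
  tends0 (acoef k) -> Clim (fun n => evalp (acoef k) n w0) (zF k w0).
Proof.
  intros Hw Hre Ha.
  (* Half the distance from [w0] to the line Re w = -1, so that w0 (1 + h) keeps a positive distance
     from that line; 1/2 is the limit set by [fatou_riesz]. *)
  set (d := Rmin (1 / 2) ((1 + Re w0) / 2)).
  pose proof (Rmin_l (1 / 2) ((1 + Re w0) / 2)) as D1. pose proof (Rmin_r (1 / 2) ((1 + Re w0) / 2)) as D2.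
  fold d in D1, D2.
  assert (D0 : (0 < d)%R) by (apply Rmin_pos; lra).
  apply (fatou_riesz (zF k) (acoef k) d w0); [lra | easy | intros; now apply zF_series | | easy].
  set (K := fun h : C => (Cmod h <= d)%R). assert (HK : bounded K) by (exists d; easy).
  apply (UA_zF K (fun h => w0 * (1 + h)) k ((1 + Re w0) / 2)); [easy | lra | |].
  - apply UA_mult; [easy | apply UA_const | apply UA_plus; auto using UA_const, UA_id].
  - intros h Hh. unfold K in Hh. replace (w0 * (1 + h)) with (w0 + w0 * h) by ring.
    change (Re (w0 + w0 * h)) with (Re w0 + Re (w0 * h))%R.
    pose proof (Re_ge_neg_Cmod (w0 * h)) as H. rewrite Cmod_mult, Hw in H. lra.
Qed.

(** * The critical line as the unit circle without -1 *)

Definition line_w (t : R) : C := (1 / 2, - t)%R / (1 / 2, t)%R.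

Lemma half_line_neq0 (t : R) : ((1 / 2, t)%R : C) <> 0.
Proof. intros E. apply (f_equal Re) in E. simpl in E. lra. Qed.

Lemma Cmod_line_w (t : R) : Cmod (line_w t) = 1%R.
Proof.
  unfold line_w. rewrite Cmod_div by apply half_line_neq0.
  replace (Cmod (1 / 2, - t)%R) with (Cmod (1 / 2, t)%R).
  - field. apply Rgt_not_eq. apply Cmod_gt_0, half_line_neq0.
  - unfold Cmod; cbn [fst snd]. f_equal. ring.
Qed.

Lemma line_w_1p (t : R) : 1 + line_w t = / (1 / 2, t)%R.
Proof.
  unfold line_w.
  replace ((1 / 2, - t)%R : C) with (1 - (1 / 2, t)%R) by (apply injective_projections; simpl; field).
  field. apply half_line_neq0.
Qed.

Lemma Re_line_w (t : R) : (0 < 1 + Re (line_w t))%R.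
Proof.
  change (1 + Re (line_w t))%R with (Re (1 + line_w t)). rewrite line_w_1p, Re_inv.
  apply Rdiv_lt_0_compat; [simpl; lra|].
  apply pow_lt, Cmod_gt_0, half_line_neq0.
Qed.

Lemma zeta_line (t : R) : zreg (1 / 2, t)%R = ((1 / 2, t)%R - 1) * zeta (1 / 2, t)%R.
Proof.
  assert (H1 : ((1 / 2, t)%R : C) <> 1) by (intros E; apply (f_equal Re) in E; simpl in E; lra).
  assert (H2 : (1 / 2, t)%R - 1 <> 0) by (intros E; apply (f_equal Re) in E; simpl in E; lra).
  rewrite zeta_zreg; [field; auto | simpl; lra | easy |].
  apply zeta_factor_neq0_line. simpl. lra.
Qed.

Lemma zF_line (k : nat) (t : R) : zF k (line_w t) = line_w t ^ k * zeta (1 / 2, t)%R ^ k.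
Proof.
  unfold zF, zP. rewrite <- Cpow_mult_l. f_equal.
  pose proof (half_line_neq0 t) as Hn. set (s := ((1 / 2, t)%R : C)) in *.
  assert (Hw : line_w t = / s - 1).
  { replace (line_w t) with (1 + line_w t - 1) by ring. rewrite line_w_1p. reflexivity. }
  rewrite Hw. replace (1 + (/ s - 1)) with (/ s) by ring. replace (/ / s) with s by (field; auto).
  unfold s at 2. rewrite zeta_line. fold s. field. easy.
Qed.

Lemma CpowZ_sub (w : C) (m k : nat) : w <> 0 ->
  CpowZ w (Z.of_nat m - Z.of_nat k) = / w ^ k * w ^ m.
Proof.
  intros Hw. unfold CpowZ. pose proof (Cpow_nz w k Hw).
  destruct (Z.leb_spec 0 (Z.of_nat m - Z.of_nat k)).
  - replace (Z.to_nat (Z.of_nat m - Z.of_nat k)) with (m - k)%nat by lia.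
    replace (w ^ m) with (w ^ (m - k) * w ^ k) by (rewrite <- Cpow_add_r; f_equal; lia). field. auto.
  - replace (Z.to_nat (- (Z.of_nat m - Z.of_nat k))) with (k - m)%nat by lia.
    pose proof (Cpow_nz w m Hw). pose proof (Cpow_nz w (k - m) Hw).
    replace (w ^ k) with (w ^ (k - m) * w ^ m) by (rewrite <- Cpow_add_r; f_equal; lia). field. auto.
Qed.

Lemma expansion_of_tends0 (k : nat) (t : R) : tends0 (acoef k) -> expansion_holds k t.
Proof.
  intros Ha. unfold expansion_holds. cbv zeta. fold (line_w t).
  pose proof (zF_boundary k (line_w t) (Cmod_line_w t) (Re_line_w t) Ha) as H.
  assert (Hw : line_w t <> 0) by (apply Cmod_gt_0; rewrite Cmod_line_w; lra).
  pose proof (Cpow_nz _ k Hw) as Hwk.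
  apply (Clim_mult_l _ (/ line_w t ^ k)) in H. rewrite zF_line in H.
  replace (/ line_w t ^ k * (line_w t ^ k * zeta (1 / 2, t)%R ^ k)) with (zeta (1 / 2, t)%R ^ k) in H by (field; auto).
  apply is_series_Clim. intros eps He. destruct (H eps He) as [N HN]. exists N. intros n Hn.
  specialize (HN n Hn). unfold evalp in HN. rewrite <- csum_mult_l in HN.
  eapply Rle_trans; [|exact HN]. apply Req_le. f_equal. f_equal. apply csum_ext. intros m _.
  rewrite CpowZ_sub by easy. unfold acoef. ring.
Qed.

(** * Consequences of the Lindelof Hypothesis *)

Lemma zF_coeff_close (k : nat) (r eps : R) (q : nat -> C) (n j : nat) : (0 < r < 1)%R ->
  close_on r eps (zF k) q n -> (Cmod (acoef k j - q j) * r ^ j <= eps)%R.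
Proof.
  intros Hr Hq. destruct (UA_power_series (zF k)) as [b [Hc Hb]]; [intros; now apply UA_zF_disc|].
  rewrite <- (asy_unique (zF k) b (acoef k)).
  - now apply (Hc r eps q n j).
  - intros N. apply power_series_asy. intros h Hh. apply Hb. lra.
  - apply zF_asy.
Qed.

(** For w <> -1 this says Re (1/(1 + w)) >= 1/2: the closed disc corresponds to the closed half
    plane. *)
Lemma disc_Re_1p (w : C) : (Cmod w <= 1)%R -> (Cmod (1 + w) ^ 2 <= 2 * Re (1 + w))%R.
Proof.
  intros Hw. pose proof (Cmod_ge_0 w). assert (H2 : (Cmod w ^ 2 <= 1)%R) by nra.
  rewrite Cmod2_alt in H2. rewrite Cmod2_alt.
  change (Re (1 + w)) with (1 + Re w)%R. change (Im (1 + w)) with (0 + Im w)%R. nra.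
Qed.

Lemma zF_disc_bound (k : nat) (w : C) : (Cmod w <= 1)%R -> 1 + w <> 0 ->
  (Cmod (zF k w) <= (12 / Cmod (1 + w)) ^ k)%R.
Proof.
  intros Hw Hn. unfold zF. rewrite Cmod_pow, Cmod_opp. apply pow_incr. split; [apply Cmod_ge_0|].
  unfold zP. set (s := / (1 + w)).
  assert (Hu : (0 < Cmod (1 + w))%R) by now apply Cmod_gt_0.
  assert (Hs : Cmod s = (/ Cmod (1 + w))%R) by now apply Cmod_inv.
  assert (Hu2 : (Cmod (1 + w) <= 2)%R) by (eapply Rle_trans; [apply Cmod_triangle|]; rewrite Cmod_1; lra).
  assert (Hs2 : (1 / 2 <= Cmod s)%R).
  { rewrite Hs. replace (1 / 2)%R with (/ 2)%R by field. apply Rinv_le_contravar; lra. }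
  assert (Hre : (1 / 2 <= Re s)%R).
  { unfold s. rewrite Re_inv. apply Rmult_le_reg_r with (Cmod (1 + w) ^ 2)%R; [nra|].
    unfold Rdiv. rewrite !Rmult_assoc, Rinv_l, Rmult_1_r by nra.
    pose proof (disc_Re_1p w Hw). lra. }
  assert (Hs1 : (Cmod (s - 1) <= Cmod s)%R).
  { replace (s - 1) with (- w * s) by (unfold s; field; auto).
    rewrite Cmod_mult, Cmod_opp. pose proof (Cmod_ge_0 s). nra. }
  pose proof (Cmod_zreg_le s ltac:(lra)) as Hz.
  assert (Hd : (Cmod s * Cmod (s - 1) / Re s <= 2 * Cmod s ^ 2)%R).
  { apply Rmult_le_reg_r with (Re s); [lra|]. unfold Rdiv. rewrite Rmult_assoc, Rinv_l, Rmult_1_r by lra.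
    pose proof (Cmod_ge_0 (s - 1)). nra. }
  (* Since |s| >= 1/2, the terms |s - 1| <= |s| and 2 are at most 2|s|^2 and 8|s|^2; the third is at
     most 2|s|^2, in total 12|s|^2. *)
  assert (Hz2 : (Cmod (zreg s) <= 12 * Cmod s ^ 2)%R) by nra.
  rewrite Cmod_mult.
  apply Rle_trans with (Cmod (1 + w) * (12 * Cmod s ^ 2))%R.
  - apply Rmult_le_compat_l; lra.
  - rewrite Hs. apply Req_le. field. lra.
Qed.

Lemma line_w_surj (w : C) : Cmod w = 1%R -> 1 + w <> 0 -> exists t : R, w = line_w t.
Proof.
  intros Hw Hn. exists (Im (/ (1 + w))).
  assert (Hre : Re (/ (1 + w)) = (1 / 2)%R).
  { rewrite Re_inv, Cmod2_alt.
    assert (Hp : (0 < Re (1 + w) ^ 2 + Im (1 + w) ^ 2)%R).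
    { rewrite <- Cmod2_alt. apply pow_lt, Cmod_gt_0, Hn. }
    assert (H1 : (Re w ^ 2 + Im w ^ 2 = 1)%R) by (rewrite <- Cmod2_alt, Hw; ring).
    change (Re (1 + w)) with (1 + Re w)%R in *. change (Im (1 + w)) with (0 + Im w)%R in *.
    replace ((1 + Re w) ^ 2 + (0 + Im w) ^ 2)%R with (2 * (1 + Re w))%R in * by nra.
    field. lra. }
  assert (E : / (1 + w) = (1 / 2, Im (/ (1 + w)))%R).
  { rewrite <- Hre at 1. apply surjective_pairing. }
  replace (line_w (Im (/ (1 + w)))) with (1 + line_w (Im (/ (1 + w))) - 1) by ring.
  rewrite line_w_1p, <- E. field. auto.
Qed.

Lemma Rpower_pow_l (x y : R) (n : nat) : (Rpower x y ^ n = Rpower x (y * INR n))%R.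
Proof. rewrite <- Rpower_pow by apply exp_pos. apply Rpower_mult. Qed.

Lemma lindelof_boundary (k : nat) : (1 <= k)%nat -> Lindelof ->
  exists B : R, (0 <= B)%R /\ forall w, Cmod w = 1%R -> 1 + w <> 0 ->
    (Cmod (zF k w) ^ 2 <= B * sqrt (/ Cmod (1 + w)))%R.
Proof.
  intros Hk HL. assert (Hk' : (0 < INR k)%R) by (apply lt_0_INR; lia).
  (* With this exponent |zeta|^(2k) is O(|t|^(1/2)), and |t| <= |s| = 1/|1 + w|. *)
  destruct (HL (/ (4 * INR k))%R) as [M [T [HT H]]]; [apply Rinv_0_lt_compat; lra|].
  (* For |t| < T, |s| <= 1/2 + T bounds [zF] through [zF_disc_bound]; the factor 2 compensates for
     sqrt |s| >= 1/2. *)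
  set (B2 := (2 * ((12 * (1 / 2 + T)) ^ k) ^ 2)%R).
  assert (HB1 : (0 <= (Rabs M ^ k) ^ 2)%R) by apply pow2_ge_0.
  assert (HB2 : (0 <= B2)%R) by (unfold B2; pose proof (pow2_ge_0 ((12 * (1 / 2 + T)) ^ k)); lra).
  exists ((Rabs M ^ k) ^ 2 + B2)%R. split; [lra|].
  intros w Hw Hn. destruct (line_w_surj w Hw Hn) as [t Et].
  pose proof (half_line_neq0 t) as Hs0. set (s := ((1 / 2, t)%R : C)) in *.
  assert (Hs : (0 < Cmod s)%R) by now apply Cmod_gt_0.
  assert (Hus : 1 + w = / s) by (rewrite Et; apply line_w_1p).
  assert (Hinv : (/ Cmod (1 + w) = Cmod s)%R) by (rewrite Hus, Cmod_inv, Rinv_inv by easy; reflexivity).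
  assert (Hre : (1 / 2 <= Cmod s)%R).
  { pose proof (re_le_Cmod s) as R0. change (Re s) with (1 / 2)%R in R0. rewrite Rabs_pos_eq in R0; lra. }
  pose proof (im_le_Cmod s) as Him. change (Im s) with t in Him.
  rewrite Hinv. pose proof (sqrt_pos (Cmod s)) as Hsq.
  destruct (Rle_lt_dec T (Rabs t)) as [Ht|Ht].
  - assert (E : Cmod (zF k w) = (Cmod (zeta s) ^ k)%R).
    { rewrite Et, zF_line, Cmod_mult, !Cmod_pow, Cmod_line_w, pow1. fold s. ring. }
    specialize (H t Ht). fold s in H.
    assert (Hle : (Cmod (zeta s) <= Rabs M * Rpower (Rabs t) (/ (4 * INR k)))%R).
    { eapply Rle_trans; [exact H|]. apply Rmult_le_compat_r; [apply Rlt_le, exp_pos | apply Rle_abs]. }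
    apply Rle_trans with ((Rabs M ^ k) ^ 2 * sqrt (Cmod s))%R; [|apply Rmult_le_compat_r; lra].
    rewrite E.
    apply Rle_trans with (((Rabs M * Rpower (Rabs t) (/ (4 * INR k))) ^ k) ^ 2)%R.
    + apply pow_incr. split; [apply pow_le, Cmod_ge_0|]. apply pow_incr. split; [apply Cmod_ge_0 | easy].
    + rewrite !Rpow_mult_distr. apply Rmult_le_compat_l; [easy|].
      rewrite !Rpower_pow_l.
      replace (/ (4 * INR k) * INR k * INR 2)%R with (/ 2)%R by (simpl; field; lra).
      rewrite Rpower_sqrt by lra. apply sqrt_le_1_alt. easy.
  - apply Rle_trans with (B2 * sqrt (Cmod s))%R; [|apply Rmult_le_compat_r; lra].
    assert (Hb : (Cmod (zF k w) <= (12 * (1 / 2 + T)) ^ k)%R).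
    { eapply Rle_trans; [apply zF_disc_bound; [lra | easy]|]. apply pow_incr.
      unfold Rdiv. rewrite Hinv. split; [lra|]. apply Rmult_le_compat_l; [lra|].
      eapply Rle_trans; [apply Cmod_le_re_im|]. change (Re s) with (1 / 2)%R. change (Im s) with t.
      rewrite (Rabs_pos_eq (1 / 2)) by lra. lra. }
    assert (Hh : (1 / 2 <= sqrt (Cmod s))%R).
    { rewrite <- (sqrt_pow2 (1 / 2)) by lra. apply sqrt_le_1_alt. lra. }
    assert (Hsq2 : (Cmod (zF k w) ^ 2 <= ((12 * (1 / 2 + T)) ^ k) ^ 2)%R).
    { apply pow_incr. split; [apply Cmod_ge_0 | easy]. }
    unfold B2. pose proof (pow2_ge_0 ((12 * (1 / 2 + T)) ^ k)). nra.
Qed.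

(* A sum of Poisson-type kernels, one for each dyadic scale, dominating [|u|^(-1/2)]. *)
Definition dyadic (I : nat) (u : C) : R :=
  (25 * rsum (fun i => (1 / 2) ^ i * Re (/ (u + RtoC ((1 / 4) ^ i)))) (S I))%R.

Lemma dyadic_scale (I : nat) (x : R) : ((1 / 4) ^ I <= x <= 4)%R ->
  exists i, (i <= I)%nat /\ ((1 / 4) ^ i <= x <= 4 * (1 / 4) ^ i)%R.
Proof.
  induction I as [|I IH]; intros Hx.
  - exists 0%nat. simpl in *. split; [lia | lra].
  - destruct (Rle_lt_dec ((1 / 4) ^ I) x) as [H|H].
    + destruct (IH ltac:(lra)) as [i [Hi Hxi]]. exists i. split; [lia | easy].
    + exists (S I). split; [lia|]. simpl in *. lra.
Qed.

Lemma Re_inv_shift_nonneg (u : C) (e : R) : (0 <= Re u)%R -> (0 < e)%R -> (0 <= Re (/ (u + RtoC e)))%R.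
Proof.
  intros Hu He. rewrite Re_inv. change (Re (u + RtoC e)) with (Re u + e)%R.
  apply Rmult_le_pos; [lra|]. apply Rlt_le, Rinv_0_lt_compat, pow_lt.
  eapply Rlt_le_trans; [|apply re_le_Cmod]. change (Re (u + RtoC e)) with (Re u + e)%R.
  rewrite Rabs_pos_eq; lra.
Qed.

Lemma dyadic_nonneg (I : nat) (u : C) : (0 <= Re u)%R -> (0 <= dyadic I u)%R.
Proof.
  intros Hu. unfold dyadic. apply Rmult_le_pos; [lra|]. apply rsum_nonneg. intros i.
  apply Rmult_le_pos; [apply pow_le; lra|]. apply Re_inv_shift_nonneg; [easy | apply pow_lt; lra].
Qed.

Lemma rsum_ge_term (f : nat -> R) (n i : nat) : (forall j, (0 <= f j)%R) -> (i < n)%nat ->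
  (f i <= rsum f n)%R.
Proof.
  intros Hf Hi. eapply Rle_trans; [|apply (rsum_mono f (S i) n Hf); lia].
  simpl. pose proof (rsum_nonneg f i Hf). lra.
Qed.

(** One term suffices, at the scale e = 4^(-i) with e <= |u| <= 4e. There |u + e| <= 5e and Re (u +
    e) >= e, so the kernel is at least 1/(25 e); with the weight 2^(-i) = sqrt e and the prefactor
    25 it exceeds 1/sqrt e >= |u|^(-1/2). *)
Lemma dyadic_dominates (I : nat) (u : C) : (0 <= Re u)%R -> ((1 / 4) ^ I <= Cmod u <= 4)%R ->
  (sqrt (/ Cmod u) <= dyadic I u)%R.
Proof.
  intros Hu Hx. destruct (dyadic_scale I (Cmod u) Hx) as [i [Hi Hs]].
  set (e := ((1 / 4) ^ i)%R) in *. assert (He : (0 < e)%R) by (apply pow_lt; lra).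
  assert (Hh : (0 < (1 / 2) ^ i)%R) by (apply pow_lt; lra).
  assert (Ee : e = ((1 / 2) ^ i * (1 / 2) ^ i)%R).
  { unfold e. rewrite <- Rpow_mult_distr. f_equal. field. }
  assert (H1 : (sqrt (/ Cmod u) <= / (1 / 2) ^ i)%R).
  { rewrite <- (sqrt_pow2 (/ (1 / 2) ^ i)) by (apply Rlt_le, Rinv_0_lt_compat; easy).
    apply sqrt_le_1_alt. rewrite pow_inv. replace (((1 / 2) ^ i) ^ 2)%R with e by (rewrite Ee; ring).
    apply Rinv_le_contravar; lra. }
  assert (H2 : (/ (25 * e) <= Re (/ (u + RtoC e)))%R).
  { rewrite Re_inv. change (Re (u + RtoC e)) with (Re u + e)%R.
    assert (Hm : (Cmod (u + RtoC e) <= 5 * e)%R).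
    { eapply Rle_trans; [apply Cmod_triangle|]. rewrite Cmod_RtoC_pos; lra. }
    assert (Hm0 : (e <= Cmod (u + RtoC e))%R).
    { eapply Rle_trans; [|apply re_le_Cmod]. change (Re (u + RtoC e)) with (Re u + e)%R.
      rewrite Rabs_pos_eq; lra. }
    apply Rle_trans with (e / (5 * e) ^ 2)%R; [apply Req_le; field; lra|].
    unfold Rdiv. apply Rmult_le_compat; [lra | apply Rlt_le, Rinv_0_lt_compat; nra | lra |].
    apply Rinv_le_contravar; [nra | apply pow_incr; lra]. }
  eapply Rle_trans; [exact H1|]. unfold dyadic.
  apply Rle_trans with (25 * ((1 / 2) ^ i * Re (/ (u + RtoC e))))%R.
  - apply Rle_trans with (25 * ((1 / 2) ^ i * / (25 * e)))%R.
    + apply Req_le. rewrite Ee. field. lra.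
    + apply Rmult_le_compat_l; [lra|]. apply Rmult_le_compat_l; lra.
  - apply Rmult_le_compat_l; [lra|]. unfold e.
    apply (rsum_ge_term (fun i => (1 / 2) ^ i * Re (/ (u + RtoC ((1 / 4) ^ i))))%R); [|lia].
    intros j. apply Rmult_le_pos; [apply pow_le; lra|]. apply Re_inv_shift_nonneg; [easy | apply pow_lt; lra].
Qed.

(** Since v^N = 1, 1/(u + v) is exactly 1/(u(1 - q)) times the sum of (-v/u)^l over l < N, with q =
    (-1/u)^N. Averaging over v keeps only l = 0, and |1 - q| >= 1/2. *)
Lemma root1_mean_inv (u : R) (N : nat) : (1 < u)%R -> (0 < N)%nat -> ((/ u) ^ N <= 1 / 2)%R ->
  (Cmod (csum (fun m => / (RtoC u + root1 N ^ m))%C N) <= 2 * INR N)%R.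
Proof.
  intros Hu HN Hs. assert (HNr : (0 < INR N)%R) by now apply lt_0_INR.
  set (x := RtoC (- / u)). set (q := x ^ N).
  assert (Hui : (0 < / u < 1)%R) by (split; [apply Rinv_0_lt_compat; lra | rewrite <- Rinv_1; apply Rinv_lt_contravar; lra]).
  assert (Hx : Cmod x = (/ u)%R) by (unfold x; rewrite Cmod_R, Rabs_Ropp, Rabs_pos_eq; lra).
  assert (Hq : (Cmod q <= 1 / 2)%R) by (unfold q; rewrite Cmod_pow, Hx; easy).
  assert (Hq1 : (1 / 2 <= Cmod (1 - q))%R).
  { pose proof (Cmod_le_minus 1 (1 - q)) as H. rewrite Cmod_1 in H.
    replace (1 - (1 - q)) with q in H by ring. lra. }
  assert (Hqn : 1 - q <> 0) by (apply Cmod_gt_0; lra).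
  assert (Hun : RtoC u <> 0) by (intros E; apply RtoC_inj in E; lra).
  assert (Hvn : forall m, RtoC u + root1 N ^ m <> 0).
  { intros m E. pose proof (Cmod_le_minus (RtoC u) (- root1 N ^ m)) as H.
    replace (RtoC u - - root1 N ^ m) with (RtoC u + root1 N ^ m) in H by ring.
    rewrite E, Cmod_0, Cmod_opp, Cmod_root1, Cmod_RtoC_pos in H by lra. lra. }
  assert (E : csum (fun m => / (RtoC u + root1 N ^ m)) N = RtoC (INR N) * (/ RtoC u * / (1 - q))).
  { rewrite (csum_ext _ (fun m => / RtoC u * / (1 - q) * csum (fun l => x ^ l * ((root1 N ^ m) ^ l * Cconj ((root1 N ^ m) ^ 0))) N)).
    - rewrite csum_mult_l, csum_swap, (csum_single _ _ 0%nat HN).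
      + rewrite csum_mult_l, root1_orthogonal by lia. simpl (Nat.eq_dec 0 0). cbn [Cpow]. cbv iota. ring.
      + intros l Hl Hl0. rewrite csum_mult_l, root1_orthogonal by lia.
        destruct (Nat.eq_dec l 0); [easy | ring].
    - intros m _. set (v := root1 N ^ m).
      assert (Hv : v ^ N = 1).
      { unfold v. rewrite <- Cpow_mult_r, Nat.mul_comm, Cpow_mult_r, root1_pow_N by easy. apply Cpow_1_l. }
      pose proof (csum_geom (x * v) N) as G.
      rewrite Cpow_mult_l, Hv, Cmult_1_r in G. fold q in G.
      rewrite (csum_ext _ (fun l => (x * v) ^ l)).
      + specialize (Hvn m). fold v in Hvn.
        assert (Hxv : 1 - x * v = (RtoC u + v) / RtoC u).
        { unfold x. rewrite RtoC_opp, RtoC_inv by lra. field. easy. }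
        rewrite Hxv in G. rewrite <- G.
        assert (Hsn : csum (fun i => (x * v) ^ i) N <> 0).
        { intros E0. rewrite E0 in G. apply Hqn. rewrite <- G. ring. }
        field. auto.
      + intros l _. rewrite Cpow_mult_l. cbn [Cpow].
        replace (Cconj 1) with (RtoC 1) by (unfold Cconj, RtoC; simpl; f_equal; ring). ring. }
  rewrite E, !Cmod_mult, !Cmod_inv, !Cmod_RtoC_pos by (try easy; lra).
  rewrite Rmult_comm. apply Rmult_le_compat_r; [lra|].
  assert (/ Cmod (1 - q) <= 2)%R by (rewrite <- (Rinv_inv 2); apply Rinv_le_contravar; lra).
  assert (0 < / Cmod (1 - q))%R by (apply Rinv_0_lt_compat; lra). nra.
Qed.

(** Once N is large for the smallest scale, every kernel has mean at most 2; the weights 2^(-i) sum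
    to at most 2, hence 25 * 2 * 2. Only [N0] depends on [I]. *)
Lemma dyadic_mean (I : nat) : exists N0, forall N, (N0 <= N)%nat -> (0 < N)%nat ->
  (rsum (fun m => dyadic I (1 + root1 N ^ m)) N <= 100 * INR N)%R.
Proof.
  set (e := ((1 / 4) ^ I)%R). assert (He : (0 < e)%R) by (apply pow_lt; lra).
  assert (Hi : (0 < / (1 + e) < 1)%R).
  { split; [apply Rinv_0_lt_compat; lra|].
    apply Rlt_le_trans with (/ 1)%R; [apply Rinv_lt_contravar; lra | rewrite Rinv_1; lra]. }
  destruct (pow_lt_1_zero (/ (1 + e)) ltac:(rewrite Rabs_pos_eq; lra) (1 / 2)%R ltac:(lra)) as [N0 HN0].
  exists N0. intros N HN HNp. specialize (HN0 N HN). rewrite Rabs_pos_eq in HN0 by (apply pow_le; lra).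
  unfold dyadic. rewrite rsum_mult_l, rsum_swap.
  apply Rle_trans with (25 * rsum (fun i => 2 * INR N * (1 / 2) ^ i) (S I))%R.
  - apply Rmult_le_compat_l; [lra|]. apply rsum_le. intros i Hi'. rewrite rsum_mult_l, Rmult_comm.
    apply Rmult_le_compat_r; [apply pow_le; lra|].
    rewrite (rsum_ext _ (fun m => Re (/ (RtoC (1 + (1 / 4) ^ i) + root1 N ^ m)))).
    + rewrite <- (Re_csum (fun m => / (RtoC (1 + (1 / 4) ^ i) + root1 N ^ m))).
      eapply Rle_trans; [apply Rle_abs|]. eapply Rle_trans; [apply re_le_Cmod|].
      assert (0 < (1 / 4) ^ i)%R by (apply pow_lt; lra).
      apply root1_mean_inv; [lra | easy |].
      eapply Rle_trans; [|apply Rlt_le; exact HN0]. apply pow_incr. split.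
      * apply Rlt_le, Rinv_0_lt_compat; lra.
      * apply Rinv_le_contravar; [lra|]. apply Rplus_le_compat_l. unfold e.
        replace I with (i + (I - i))%nat by lia. rewrite pow_add.
        assert ((1 / 4) ^ (I - i) <= 1)%R by (apply Rle_trans with (1 ^ (I - i))%R; [apply pow_incr; lra | rewrite pow1; lra]).
        nra.
    + intros m _. f_equal. f_equal. rewrite RtoC_plus. ring.
  - rewrite rsum_mult_l.
    pose proof (rsum_geom_le (1 / 2) (S I) ltac:(lra)) as G.
    replace (/ (1 - 1 / 2))%R with 2%R in G by field.
    assert (HNr : (0 < INR N)%R) by now apply lt_0_INR.
    apply Rle_trans with (25 * (2 * INR N * 2))%R; [|lra].
    apply Rmult_le_compat_l; [lra|]. apply Rmult_le_compat_l; [lra | exact G].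
Qed.

(** On the closed disc the base of the power has modulus at most 1. As [zF] is O(|1 + w|^(-k)) near
    -1, k copies of it make the product bounded there and one more makes it tend to 0. *)
Definition zE (k : nat) (e : R) (w : C) : C := zF k w * ((1 + w) * / (1 + w + RtoC e)) ^ S k.

Lemma Cmod_shift_ge (u : C) (e : R) : (0 <= Re u)%R -> (0 < e)%R ->
  (e <= Cmod (u + RtoC e))%R /\ (Cmod u <= Cmod (u + RtoC e))%R /\ u + RtoC e <> 0.
Proof.
  intros Hu He.
  assert (H1 : (e <= Cmod (u + RtoC e))%R).
  { eapply Rle_trans; [|apply re_le_Cmod]. change (Re (u + RtoC e)) with (Re u + e)%R.
    rewrite Rabs_pos_eq; lra. }
  split; [easy|]. split; [|apply Cmod_gt_0; lra].
  apply Rsqr_incr_0_var; [|apply Cmod_ge_0]. rewrite !Rsqr_pow2, !Cmod2_alt.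
  change (Re (u + RtoC e)) with (Re u + e)%R. change (Im (u + RtoC e)) with (Im u + 0)%R. nra.
Qed.

Lemma disc_Re_1p_nonneg (w : C) : (Cmod w <= 1)%R -> (0 <= Re (1 + w))%R.
Proof. intros Hw. pose proof (Re_ge_neg_Cmod w). change (Re (1 + w)) with (1 + Re w)%R. lra. Qed.

(** The value 0 comes from the factor 1 + w of [zP], whatever the default value of the inverse of 0;
    the estimate of [zE] thus extends to w = -1. *)
Lemma zF_m1 (k : nat) (w : C) : (1 <= k)%nat -> 1 + w = 0 -> zF k w = 0.
Proof.
  intros Hk Hw. unfold zF, zP. rewrite Hw. destruct k; [lia|]. rewrite Cpow_S. ring.
Qed.

Lemma Cmod_ratio (u : C) (e : R) : (0 <= Re u)%R -> (0 < e)%R ->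
  (Cmod (u * / (u + RtoC e)) <= 1)%R /\ (Cmod (u * / (u + RtoC e)) <= Cmod u / e)%R.
Proof.
  intros Hu He. destruct (Cmod_shift_ge u e Hu He) as [H1 [H2 H3]].
  rewrite Cmod_mult, Cmod_inv by easy. split.
  - apply Rmult_le_reg_r with (Cmod (u + RtoC e)); [lra|]. rewrite Rmult_assoc, Rinv_l by lra. lra.
  - apply Rmult_le_compat_l; [apply Cmod_ge_0|]. apply Rinv_le_contravar; lra.
Qed.

Lemma zE_le_zF (k : nat) (e : R) (w : C) : (0 < e)%R -> (Cmod w <= 1)%R ->
  (Cmod (zE k e w) <= Cmod (zF k w))%R.
Proof.
  intros He Hw. destruct (Cmod_ratio (1 + w) e (disc_Re_1p_nonneg w Hw) He) as [H _].
  unfold zE. rewrite Cmod_mult, Cmod_pow.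
  assert (Hp : (Cmod ((1 + w) * / (1 + w + RtoC e)) ^ S k <= 1)%R).
  { apply Rle_trans with (1 ^ S k)%R; [|rewrite pow1; lra]. apply pow_incr. split; [apply Cmod_ge_0 | easy]. }
  pose proof (Cmod_ge_0 (zF k w)). nra.
Qed.

Lemma zE_near_m1 (k : nat) (e : R) (w : C) : (1 <= k)%nat -> (0 < e)%R -> (Cmod w <= 1)%R ->
  (Cmod (zE k e w) <= 12 ^ k * / e ^ S k * Cmod (1 + w))%R.
Proof.
  intros Hk He Hw.
  assert (Hep : (0 < / e ^ S k)%R) by (apply Rinv_0_lt_compat, pow_lt, He).
  assert (H12 : (0 < 12 ^ k)%R) by (apply pow_lt; lra).
  destruct (Ceq_dec (1 + w) 0) as [H0|H0].
  - unfold zE. rewrite zF_m1, Cmult_0_l, Cmod_0 by easy.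
    apply Rmult_le_pos; [nra | apply Cmod_ge_0].
  - destruct (Cmod_ratio (1 + w) e (disc_Re_1p_nonneg w Hw) He) as [_ H].
    assert (Hu : (0 < Cmod (1 + w))%R) by now apply Cmod_gt_0.
    unfold zE. rewrite Cmod_mult, Cmod_pow.
    apply Rle_trans with ((12 / Cmod (1 + w)) ^ k * (Cmod (1 + w) / e) ^ S k)%R.
    + apply Rmult_le_compat; [apply Cmod_ge_0 | apply pow_le, Cmod_ge_0 | now apply zF_disc_bound|].
      apply pow_incr. split; [apply Cmod_ge_0 | easy].
    + apply Req_le. unfold Rdiv. rewrite !Rpow_mult_distr, !pow_inv. rewrite <- tech_pow_Rmult at 1.
      field. split; apply pow_nonzero; lra.
Qed.

Lemma poly_lipschitz (p : C -> C) : poly p -> exists L : R, (0 <= L)%R /\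
  forall z w, (Cmod z <= 1)%R -> (Cmod w <= 1)%R -> (Cmod (p z - p w) <= L * Cmod (z - w))%R.
Proof.
  set (K := fun z : C => (Cmod z <= 1)%R). assert (HK : bounded K) by (exists 1%R; easy).
  induction 1 as [c| |f g Hf [L1 [P1 H1]] Hg [L2 [P2 H2]]|f g Hf [L1 [P1 H1]] Hg [L2 [P2 H2]]].
  - exists 0%R. split; [lra|]. intros. replace (c - c) with (RtoC 0) by ring. rewrite Cmod_0. lra.
  - exists 1%R. split; [lra|]. intros. lra.
  - exists (L1 + L2)%R. split; [lra|]. intros z w Hz Hw.
    replace (f z + g z - (f w + g w)) with ((f z - f w) + (g z - g w)) by ring.
    eapply Rle_trans; [apply Cmod_triangle|]. specialize (H1 z w Hz Hw). specialize (H2 z w Hz Hw). lra.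
  - destruct (poly_bounded K f HK Hf) as [B1 [Q1 F1]]. destruct (poly_bounded K g HK Hg) as [B2 [Q2 F2]].
    exists (B1 * L2 + L1 * B2)%R. split; [nra|]. intros z w Hz Hw.
    replace (f z * g z - f w * g w) with (f z * (g z - g w) + (f z - f w) * g w) by ring.
    eapply Rle_trans; [apply Cmod_triangle|]. rewrite !Cmod_mult, Rmult_plus_distr_r.
    apply Rplus_le_compat.
    + rewrite Rmult_assoc. apply Rmult_le_compat; auto using Cmod_ge_0.
    + replace (L1 * B2 * Cmod (z - w))%R with (L1 * Cmod (z - w) * B2)%R by ring.
      apply Rmult_le_compat; auto using Cmod_ge_0.
Qed.

Lemma UA_zE (K : C -> Prop) (f : C -> C) (k : nat) (e c : R) : bounded K -> (0 < c)%R -> (0 < e)%R ->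
  UA K f -> (forall z, K z -> (c - 1 <= Re (f z))%R) -> UA K (fun z => zE k e (f z)).
Proof.
  intros HK Hc He Hf H. unfold zE.
  assert (H1 : UA K (fun z => 1 + f z)) by (apply UA_plus; auto using UA_const).
  apply UA_mult; [easy | now apply (UA_zF K f k c)|]. apply UA_pow; [easy|].
  apply UA_mult; [easy | easy |]. apply (UA_inv_comp K _ c); [easy | easy | apply UA_plus; auto using UA_const |].
  intros z Hz. specialize (H z Hz). change (Re (1 + f z + RtoC e)) with (1 + Re (f z) + e)%R. lra.
Qed.

(* Dilations [w -> r w], [r < 1], approximate [zE] uniformly up to the boundary: near [-1]
   both values are small, and away from [-1] the function is uniformly continuous. *)
Lemma UA_zE_closed_disc (k : nat) (e : R) : (1 <= k)%nat -> (0 < e)%R ->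
  UA (fun w => (Cmod w <= 1)%R) (zE k e).
Proof.
  intros Hk He. set (K := fun w : C => (Cmod w <= 1)%R).
  assert (HK : bounded K) by (exists 1%R; easy).
  apply UA_limit. intros eps Heps.
  set (A := (12 ^ k * / e ^ S k)%R).
  assert (HA : (0 < A)%R).
  { apply Rmult_lt_0_compat; [apply pow_lt; lra | apply Rinv_0_lt_compat, pow_lt, He]. }
  set (kap := (eps / (2 * A))%R).
  assert (Hkap : (0 < kap)%R) by (apply Rdiv_lt_0_compat; lra).
  assert (HAk : (A * kap = eps / 2)%R) by (unfold kap; field; lra).
  (* |1 + w| > kap / 2 gives Re (1 + w) >= |1 + w|^2 / 2 >= kap^2 / 8 by [disc_Re_1p], and c <= 1
     makes the region stable under w -> r w. *)
  set (c := Rmin 1 (kap ^ 2 / 8)).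
  assert (Hc : (0 < c)%R) by (apply Rmin_pos; nra).
  pose proof (Rmin_l 1 (kap ^ 2 / 8)) as Hc1. pose proof (Rmin_r 1 (kap ^ 2 / 8)) as Hc2. fold c in Hc1, Hc2.
  set (K' := fun w : C => (Cmod w <= 1)%R /\ (c - 1 <= Re w)%R).
  assert (HU : UA K' (zE k e)).
  { apply (UA_zE K' (fun w => w) k e c); [exists 1%R; intros z [Hz _]; exact Hz | easy | easy | apply UA_id | now intros z [_ Hz]]. }
  destruct (HU (eps / 3)%R ltac:(lra)) as [p [Hp Hd]].
  destruct (poly_lipschitz p Hp) as [L [HL0 HL]].
  (* The bound kap / 2 keeps |1 + r w| at most kap when |1 + w| <= kap / 2; the last bound lets p
     vary by at most eps / 3 between w and r w. *)
  set (d := Rmin (1 / 2) (Rmin (kap / 2) (eps / 3 / (L + 1)))).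
  assert (Hd0 : (0 < d)%R).
  { repeat apply Rmin_pos; try lra. apply Rdiv_lt_0_compat; lra. }
  assert (Hd1 : (d <= 1 / 2)%R) by apply Rmin_l.
  assert (Hd23 : (d <= Rmin (kap / 2) (eps / 3 / (L + 1)))%R) by apply Rmin_r.
  pose proof (Rmin_l (kap / 2) (eps / 3 / (L + 1))) as Hd2. pose proof (Rmin_r (kap / 2) (eps / 3 / (L + 1))) as Hd3.
  set (r := (1 - d)%R).
  exists (fun w => zE k e (RtoC r * w)). split.
  - apply (UA_zE K _ k e d); [easy | easy | easy | apply UA_mult; auto using UA_const, UA_id |].
    intros z Hz. unfold K in Hz. pose proof (Re_ge_neg_Cmod (RtoC r * z)) as H.
    rewrite Cmod_mult, Cmod_RtoC_pos in H by (unfold r; lra). unfold r in H at 1. nra.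
  - intros w Hw. unfold K in Hw. pose proof (Cmod_ge_0 w) as Hw0.
    assert (Hrw : (Cmod (RtoC r * w) <= 1)%R).
    { rewrite Cmod_mult, Cmod_RtoC_pos by (unfold r; lra). unfold r. nra. }
    assert (Hdiff : (Cmod (w - RtoC r * w) <= d)%R).
    { replace (w - RtoC r * w) with (RtoC d * w) by (unfold r; rewrite RtoC_minus; ring).
      rewrite Cmod_mult, Cmod_RtoC_pos by lra. nra. }
    destruct (Rle_lt_dec (Cmod (1 + w)) (kap / 2)) as [Hn|Hn].
    + pose proof (zE_near_m1 k e w Hk He Hw) as E1. fold A in E1.
      pose proof (zE_near_m1 k e _ Hk He Hrw) as E2. fold A in E2.
      assert (Hn2 : (Cmod (1 + RtoC r * w) <= kap)%R).
      { pose proof (Cmod_le_minus (1 + RtoC r * w) (1 + w)) as H.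
        replace (1 + RtoC r * w - (1 + w)) with (- (w - RtoC r * w)) in H by ring.
        rewrite Cmod_opp in H. lra. }
      unfold Cminus. eapply Rle_trans; [apply Cmod_triangle|]. rewrite Cmod_opp. nra.
    + assert (Kw : K' w).
      { split; [easy|]. pose proof (disc_Re_1p w Hw) as H.
        change (Re (1 + w)) with (1 + Re w)%R in H. nra. }
      assert (Krw : K' (RtoC r * w)).
      { split; [easy|]. destruct Kw as [_ Kw].
        replace (Re (RtoC r * w)) with (r * Re w)%R by (unfold Cmult, RtoC, Re; cbn [fst snd]; ring). unfold r. nra. }
      replace (zE k e w - zE k e (RtoC r * w))
        with ((zE k e w - p w) + (p w - p (RtoC r * w)) + (p (RtoC r * w) - zE k e (RtoC r * w))) by ring.
      eapply Rle_trans; [apply Cmod_triangle|].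
      eapply Rle_trans; [apply Rplus_le_compat_r, Cmod_triangle|].
      rewrite (Cmod_minus_sym (p (RtoC r * w)) (zE k e _)).
      pose proof (Hd w Kw). pose proof (Hd _ Krw). specialize (HL w (RtoC r * w) Hw Hrw).
      assert (L * Cmod (w - RtoC r * w) <= eps / 3)%R.
      { apply Rle_trans with ((L + 1) * (eps / 3 / (L + 1)))%R; [|apply Req_le; field; lra].
        apply Rmult_le_compat; [easy | apply Cmod_ge_0 | lra | lra]. }
      lra.
Qed.

Lemma Cmod_pow_minus_1 (y : C) (n : nat) : (Cmod y <= 1)%R ->
  (Cmod (y ^ n - 1) <= INR n * Cmod (y - 1))%R.
Proof.
  intros Hy. induction n as [|n IH].
  - cbn [Cpow]. replace (1 - 1) with (RtoC 0) by ring. rewrite Cmod_0. simpl. lra.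
  - rewrite Cpow_S, S_INR. replace (y * y ^ n - 1) with (y * (y ^ n - 1) + (y - 1)) by ring.
    eapply Rle_trans; [apply Cmod_triangle|]. rewrite Cmod_mult.
    pose proof (Cmod_ge_0 (y ^ n - 1)). nra.
Qed.

(** The disc of radius 1/2 is enough, as coefficients are read off there by the Cauchy estimate. On
    it |1 + w| >= 1/2, so |zF| <= 24^k and the base y differs from 1 by at most 2e; with the power
    [S k] this gives [A]. *)
Lemma zE_close_zF (k : nat) (d : R) : (0 < d)%R ->
  exists e : R, (0 < e)%R /\ forall w, (Cmod w <= 1 / 2)%R -> (Cmod (zE k e w - zF k w) <= d)%R.
Proof.
  intros Hd. set (A := (24 ^ k * INR (S k) * 2)%R).
  assert (HA : (0 < A)%R).
  { apply Rmult_lt_0_compat; [|lra]. apply Rmult_lt_0_compat; [apply pow_lt; lra | apply lt_0_INR; lia]. }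
  exists (d / A)%R. split; [apply Rdiv_lt_0_compat; lra|]. intros w Hw.
  set (e := (d / A)%R). assert (He : (0 < e)%R) by (apply Rdiv_lt_0_compat; lra).
  assert (Hre : (1 / 2 <= Re (1 + w))%R).
  { pose proof (Re_ge_neg_Cmod w). change (Re (1 + w)) with (1 + Re w)%R. lra. }
  assert (Hu : (1 / 2 <= Cmod (1 + w))%R).
  { eapply Rle_trans; [exact Hre|]. eapply Rle_trans; [apply Rle_abs | apply re_le_Cmod]. }
  destruct (Cmod_shift_ge (1 + w) e ltac:(lra) He) as [_ [H2 H3]].
  destruct (Cmod_ratio (1 + w) e ltac:(lra) He) as [H4 _].
  unfold zE. set (y := (1 + w) * / (1 + w + RtoC e)) in *.
  replace (zF k w * y ^ S k - zF k w) with (zF k w * (y ^ S k - 1)) by ring.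
  rewrite Cmod_mult. pose proof (Cmod_pow_minus_1 y (S k) H4) as H5.
  assert (Hy : (Cmod (y - 1) <= 2 * e)%R).
  { replace (y - 1) with (- RtoC e / (1 + w + RtoC e)) by (unfold y; field; auto).
    rewrite Cmod_div, Cmod_opp, Cmod_RtoC_pos by (try easy; lra).
    apply Rmult_le_reg_r with (Cmod (1 + w + RtoC e)); [lra|].
    unfold Rdiv. rewrite Rmult_assoc, Rinv_l by lra. nra. }
  assert (Hz : (Cmod (zF k w) <= 24 ^ k)%R).
  { eapply Rle_trans; [apply zF_disc_bound; [lra | apply Cmod_gt_0; lra]|].
    apply pow_incr. split; [apply Rmult_le_pos; [lra | apply Rlt_le, Rinv_0_lt_compat; lra]|].
    apply Rmult_le_reg_r with (Cmod (1 + w)); [lra|]. unfold Rdiv. rewrite Rmult_assoc, Rinv_l by lra. lra. }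
  apply Rle_trans with (24 ^ k * (INR (S k) * (2 * e)))%R.
  - apply Rmult_le_compat; [apply Cmod_ge_0 | apply Cmod_ge_0 | easy |].
    eapply Rle_trans; [exact H5|]. apply Rmult_le_compat_l; [apply pos_INR | easy].
  - apply Req_le. replace (24 ^ k * (INR (S k) * (2 * e)))%R with (A * e)%R by (unfold A; ring).
    unfold e. field. lra.
Qed.

Lemma Cmod_sq_le_minus (x y : C) : (Cmod x ^ 2 <= 2 * Cmod y ^ 2 + 2 * Cmod (x - y) ^ 2)%R.
Proof.
  pose proof (Cmod_le_minus x y) as H. pose proof (Cmod_ge_0 x).
  assert (Cmod x ^ 2 <= (Cmod y + Cmod (x - y)) ^ 2)%R by (apply pow_incr; lra).
  pose proof (pow2_ge_0 (Cmod y - Cmod (x - y))). simpl in *. lra.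
Qed.

(** Parseval for q at the N-th roots of unity, where |q|^2 <= 2|zE|^2 + 2 <= 4 + 2 B dyadic; the
    mean of [dyadic] is at most 100. The bound is free of e, so that e can be taken arbitrarily
    small afterwards. *)
Lemma zE_coeff_bound (k : nat) (B e d : R) (q : nat -> C) (n J : nat) : (1 <= k)%nat -> (0 < e)%R ->
  (0 <= B)%R -> (0 <= d <= 1)%R ->
  (forall w, Cmod w = 1%R -> 1 + w <> 0 -> (Cmod (zF k w) ^ 2 <= B * sqrt (/ Cmod (1 + w)))%R) ->
  close_on 1 d (zE k e) q n ->
  (rsum (fun j => Cmod (q j) ^ 2) J <= 4 + 200 * B)%R.
Proof.
  intros Hk He HB Hd HF [V Hq].
  set (A := (12 ^ k * / e ^ S k)%R).
  assert (HA : (0 < A)%R).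
  { apply Rmult_lt_0_compat; [apply pow_lt; lra | apply Rinv_0_lt_compat, pow_lt, He]. }
  (* Closer to -1 than 4^(-I) the kernels no longer dominate; there [zE_near_m1] gives |zE| <= A
     4^(-I) < 1, the origin of the summand 1 in [Hpt]. *)
  destruct (pow_lt_1_zero (1 / 4) ltac:(rewrite Rabs_pos_eq; lra) (/ A)%R ltac:(now apply Rinv_0_lt_compat)) as [I HI].
  specialize (HI I (Nat.le_refl I)). rewrite Rabs_pos_eq in HI by (apply pow_le; lra).
  destruct (dyadic_mean I) as [N0 HN0].
  set (N := (n + J + N0 + 1)%nat).
  specialize (HN0 N ltac:(unfold N; lia) ltac:(unfold N; lia)).
  assert (HN : (0 < INR N)%R) by (apply lt_0_INR; unfold N; lia).
  assert (Hpt : forall v, Cmod v = 1%R -> (Cmod (zE k e v) ^ 2 <= 1 + B * dyadic I (1 + v))%R).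
  { intros v Hv. pose proof (disc_Re_1p_nonneg v ltac:(lra)) as Hre.
    pose proof (dyadic_nonneg I (1 + v) Hre) as Hdy. pose proof (Cmod_ge_0 (zE k e v)) as H0.
    destruct (Rle_lt_dec ((1 / 4) ^ I) (Cmod (1 + v))) as [H|H].
    - assert (Hpos : (0 < (1 / 4) ^ I)%R) by (apply pow_lt; lra).
      assert (Hn : 1 + v <> 0) by (apply Cmod_gt_0; lra).
      assert (Hle : (Cmod (1 + v) <= 4)%R) by (eapply Rle_trans; [apply Cmod_triangle|]; rewrite Cmod_1; lra).
      pose proof (dyadic_dominates I (1 + v) Hre (conj H Hle)) as Hdom.
      pose proof (HF v Hv Hn) as HFv. pose proof (zE_le_zF k e v He ltac:(lra)) as Hle2.
      assert (Cmod (zE k e v) ^ 2 <= Cmod (zF k v) ^ 2)%R by (apply pow_incr; lra).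
      assert (B * sqrt (/ Cmod (1 + v)) <= B * dyadic I (1 + v))%R by (apply Rmult_le_compat_l; lra).
      lra.
    - pose proof (zE_near_m1 k e v Hk He ltac:(lra)) as Hnear. fold A in Hnear.
      assert (A * Cmod (1 + v) <= 1)%R.
      { apply Rle_trans with (A * / A)%R; [apply Rmult_le_compat_l; lra | apply Req_le; field; lra]. }
      assert (0 <= B * dyadic I (1 + v))%R by now apply Rmult_le_pos. nra. }
  assert (Hsum : (INR N * rsum (fun j => Cmod (q j) ^ 2) N <= INR N * (4 + 200 * B))%R).
  { rewrite <- (parseval q N N) by easy.
    apply Rle_trans with (rsum (fun m => 4 + 2 * B * dyadic I (1 + root1 N ^ m))%R N).
    - apply rsum_le. intros m _. pose proof (Cmod_root1 N m) as H1.
      rewrite (evalp_extend q n N) by (easy || (unfold N; lia)).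
      specialize (Hpt _ H1). specialize (Hq (root1 N ^ m) ltac:(lra)).
      eapply Rle_trans; [apply (Cmod_sq_le_minus _ (zE k e (root1 N ^ m)))|].
      rewrite Cmod_minus_sym in Hq. pose proof (Cmod_ge_0 (evalp q n (root1 N ^ m) - zE k e (root1 N ^ m))).
      assert (Cmod (evalp q n (root1 N ^ m) - zE k e (root1 N ^ m)) ^ 2 <= 1)%R by nra. nra.
    - rewrite rsum_plus, rsum_const, rsum_mult_l. nra. }
  apply Rmult_le_reg_l in Hsum; [|easy].
  eapply Rle_trans; [|exact Hsum]. apply rsum_mono; [|unfold N; lia].
  intros j. apply pow2_ge_0.
Qed.

Lemma acoef_square_bounded (k : nat) : (1 <= k)%nat -> Lindelof ->
  exists M : R, forall J, (rsum (fun j => Cmod (acoef k j) ^ 2) J <= M)%R.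
Proof.
  intros Hk HL. destruct (lindelof_boundary k Hk HL) as [B [HB HF]].
  exists (2 * (4 + 200 * B) + 2)%R. intros J.
  assert (HJ : (0 < INR (S J))%R) by (apply lt_0_INR; lia).
  assert (H2J : (0 < 2 ^ J)%R) by (apply pow_lt; lra).
  (* The number J is fixed first; d, e and q depend on it, the final bound does not. On radius 1/2
     the coefficient error is at most 2 d 2^j <= 1/(J + 1) for j < J, so the J squared errors add up
     to at most 1. *)
  set (d := (/ (2 * 2 ^ J * INR (S J)))%R).
  assert (H2J1 : (1 <= 2 ^ J)%R) by (apply pow_R1_Rle; lra).
  assert (HJ1 : (1 <= INR (S J))%R) by (rewrite S_INR; pose proof (pos_INR J); lra).
  assert (Hd : (0 < d)%R) by (apply Rinv_0_lt_compat; nra).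
  assert (Hd1 : (d <= 1)%R) by (unfold d; rewrite <- Rinv_1; apply Rinv_le_contravar; nra).
  destruct (zE_close_zF k d Hd) as [e [He Hclose]].
  destruct (UA_close_on (zE k e) 1 d Hd (UA_zE_closed_disc k e Hk He)) as [q [n Hq]].
  pose proof (zE_coeff_bound k B e d q n J Hk He HB ltac:(lra) HF Hq) as Hqb.
  assert (Hq2 : close_on (1 / 2) (2 * d) (zF k) q n).
  { destruct Hq as [V Hq]. split; [easy|]. intros h Hh.
    eapply Rle_trans; [apply (Cmod_minus_triangle _ (zE k e h))|].
    rewrite Cmod_minus_sym. specialize (Hclose h Hh). specialize (Hq h ltac:(lra)). lra. }
  apply Rle_trans with (rsum (fun j => 2 * Cmod (q j) ^ 2 + 2 * / INR (S J))%R J).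
  - apply rsum_le. intros j Hj.
    eapply Rle_trans; [apply (Cmod_sq_le_minus _ (q j))|]. apply Rplus_le_compat_l, Rmult_le_compat_l; [lra|].
    pose proof (zF_coeff_close k (1 / 2) _ _ _ j ltac:(lra) Hq2) as Hc.
    assert (Hhj : (0 < (1 / 2) ^ j)%R) by (apply pow_lt; lra).
    assert (Hx : (Cmod (acoef k j - q j) <= / INR (S J))%R).
    { apply Rmult_le_reg_r with ((1 / 2) ^ j)%R; [easy|]. eapply Rle_trans; [exact Hc|].
      assert (Hjj : (/ 2 ^ J <= (1 / 2) ^ j)%R).
      { replace (1 / 2)%R with (/ 2)%R by field. rewrite pow_inv.
        apply Rinv_le_contravar; [apply pow_lt; lra | apply Rle_pow; [lra | lia]]. }
      replace (2 * d)%R with (/ INR (S J) * / 2 ^ J)%R by (unfold d; field; lra).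
      apply Rmult_le_compat_l; [apply Rlt_le, Rinv_0_lt_compat; easy | easy]. }
    assert (/ INR (S J) <= 1)%R by (rewrite <- Rinv_1; apply Rinv_le_contravar; lra).
    assert (0 < / INR (S J))%R by now apply Rinv_0_lt_compat.
    pose proof (Cmod_ge_0 (acoef k j - q j)). nra.
  - rewrite rsum_plus, rsum_mult_l, rsum_const.
    assert (INR J * (2 * / INR (S J)) <= 2)%R.
    { apply Rle_trans with (INR (S J) * (2 * / INR (S J)))%R; [|apply Req_le; field; lra].
      apply Rmult_le_compat_r; [|rewrite S_INR; lra].
      apply Rmult_le_pos; [lra | apply Rlt_le, Rinv_0_lt_compat; easy]. }
    lra.
Qed.

(** * From square-summability to vanishing coefficients, and the conclusion *)

Lemma tends0_of_square_lim (a : nat -> C) :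
  is_lim_seq (fun n => Cmod (a n) ^ 2)%R 0%R -> tends0 a.
Proof.
  intros H eps He. apply is_lim_seq_spec in H. assert (He2 : (0 < eps ^ 2)%R) by nra.
  destruct (H (mkposreal _ He2)) as [N HN]. simpl pos in HN.
  exists N. intros n Hn. specialize (HN n Hn).
  rewrite Rminus_0_r, Rabs_pos_eq in HN by (apply pow_le, Cmod_ge_0).
  pose proof (Cmod_ge_0 (a n)). apply Rnot_lt_le. intros Hc. nra.
Qed.

Lemma tends0_of_ell_square_summable (k : nat) :
  ex_series (fun n : nat => (Cmod (ell (Z.of_nat n) k)) ^ 2)%R -> tends0 (acoef k).
Proof.
  intros H. apply ex_series_lim_0 in H. apply tends0_of_square_lim.
  (* [acoef k] starts at index -k of [ell]; dropping its first k entries leaves the sequence of the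
     hypothesis. *)
  apply (is_lim_seq_incr_n _ k).
  apply (is_lim_seq_ext (fun n : nat => (Cmod (ell (Z.of_nat n) k)) ^ 2)%R); [|easy].
  intros n. unfold acoef. do 3 f_equal. lia.
Qed.

Lemma tends0_of_lindelof (k : nat) : (1 <= k)%nat -> Lindelof -> tends0 (acoef k).
Proof.
  intros Hk HL. destruct (acoef_square_bounded k Hk HL) as [M HM].
  apply tends0_of_square_lim. apply ex_series_lim_0.
  destruct (ex_finite_lim_seq_incr (rsum (fun j => Cmod (acoef k j) ^ 2)%R) M) as [l Hl].
  - intros n. simpl. pose proof (pow2_ge_0 (Cmod (acoef k n))). simpl in H. lra.
  - exact HM.
  - exists l. now apply is_series_rsum.
Qed.

Local Close Scope C_scope.

Theorem theorem2 :
  (forall k : nat, (1 <= k)%nat ->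
     ex_series (fun n : nat => (Cmod (ell (Z.of_nat n) k)) ^ 2) ->
     forall t : R, expansion_holds k t)
  /\
  (Lindelof -> forall k : nat, (1 <= k)%nat -> forall t : R, expansion_holds k t).
Proof.
  split.
  - intros k _ H t. now apply expansion_of_tends0, tends0_of_ell_square_summable.
  - intros HL k Hk t. now apply expansion_of_tends0, tends0_of_lindelof.
Qed.
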